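(* Let $2<a\leq b\leq c$ be integers and let $X=\mathbb{P}^a\times\mathbb{P}^b\times\mathbb{P}^c$, naturally (Segre) embedded in $\mathbb{P}^N$ with $N=(a+1)(b+1)(c+1)-1$. Let $k$ be a positive integer with $$k\le\frac{(a+1)(b+1)(c+1)}{a+b+c+1}-c-1.$$ Then a general linear subspace $L$ of codimension $a+b+2$ in $\mathbb{P}^N$ that contains the span of the tangent spaces to $X$ at $k$ general points is not tangent to $X$ elsewhere.
   Context: All varieties are over $\mathbb{C}$. A linear subspace $L\subset\mathbb{P}^N$ is tangent to $X$ at $x\in X$ if $L$ contains the (projective) tangent space $\mathbb{T}_xX$. ''Elsewhere'' means at any point of $X$ other than the $k$ given general points. *)

(* Defs.v *)
From HB Require Import structures.
From mathcomp Require Import all_boot all_order all_algebra.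
From mathcomp Require Import mpoly.
From mathcomp Require Import complex.
From mathcomp Require Import boolp reals.
Set Implicit Arguments.
Unset Strict Implicit.
Unset Printing Implicit Defensive.
Import GRing.Theory.
Local Open Scope ring_scope.

(* Linear subspaces of the projective space P(F^n) are represented by the
   vector subspaces of F^n = 'rV[F]_n, one dimension higher; points are the
   vector subspaces of dimension 1, such as <[p]> with p != 0. *)
Section Projective.
Variables (F : fieldType) (n : nat).
Implicit Types (X : {vspace 'rV[F]_n} -> Prop) (x L : {vspace 'rV[F]_n}).

Definition meval_row (r : nat) (f : {mpoly F[r]}) (v : 'rV[F]_r) : F :=
  f.@[fun i => v 0 i].

Definition vanishes_on X (f : {mpoly F[n]}) : Prop :=
  forall x, X x -> forall p, p \in x -> meval_row f p = 0.

(* v lies in the affine cone over the embedded tangent space to X at x: the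
   differential at x of every form in the homogeneous ideal of X kills v. *)
Definition tangent_vector X x (v : 'rV[F]_n) : Prop :=
  forall (e : nat) (f : {mpoly F[n]}), f \is e.-homog -> vanishes_on X f ->
  forall p, p \in x -> \sum_(i < n) meval_row (mderiv i f) p * v 0 i = 0.

Lemma vspace_of_closed (P : 'rV[F]_n -> Prop) :
  P 0 -> (forall (c : F) u v, P u -> P v -> P (c *: u + v)) ->
  exists U : {vspace 'rV[F]_n}, forall v, v \in U <-> P v.
Proof.
move=> P0 Plin.
suff [U [UP Umax]] : exists U : {vspace 'rV[F]_n},
    (forall v, v \in U -> P v) /\ (forall v, P v -> v \in U).
  by exists U => v; split; [apply: UP | apply: Umax].
suff grow m (U : {vspace 'rV[F]_n}) : (\dim {:'rV[F]_n} - \dim U <= m)%N ->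
    (forall v, v \in U -> P v) -> exists U' : {vspace 'rV[F]_n},
    (forall v, v \in U' -> P v) /\ (forall v, P v -> v \in U').
  apply: (grow _ 0%VS (leqnn _)) => v.
  by rewrite memv0 => /eqP ->.
elim: m U => [|m IH] U ledim UP.
  exists U; split=> // v _.
  suff /eqP-> : U == fullv by rewrite memvf.
  by rewrite eqEdim subvf -subn_eq0 -leqn0.
have [UPc|/existsNP[v /not_implyP[Pv /negP vU]]] :=
  pselect (forall v, P v -> v \in U); first by exists U.
have ltU : (\dim U < \dim (U + <[v]>)%VS)%N.
  rewrite ltn_neqAle dimvS ?addvSl // andbT.
  apply: contra vU => /eqP eqd.
  have /eqP-> : U == (U + <[v]>)%VS by rewrite eqEdim addvSl -eqd leqnn.
  by rewrite (subvP (addvSr _ _)) // memv_line.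
apply: (IH (U + <[v]>)%VS).
  have lef := dimvS (subvf (U + <[v]>)%VS).
  by rewrite -ltnS (leq_trans _ ledim) // ltn_sub2l // (leq_trans ltU).
move=> w /memv_addP[u uU [_ /vlineP[c ->] ->]].
by rewrite addrC; apply: Plin => //; apply: UP.
Qed.

Lemma tangent_space_exists X x : exists T : {vspace 'rV[F]_n},
  forall v, v \in T <-> tangent_vector X x v.
Proof.
apply: vspace_of_closed => [e f _ _ p _|c u v tu tv e f fh fX p px].
  by rewrite big1 // => i _; rewrite mxE mulr0.
under eq_bigr do rewrite !mxE mulrDr mulrCA.
by rewrite big_split /= -mulr_sumr (tu e) // (tv e) // mulr0 addr0.
Qed.

Definition tangent_space X x : {vspace 'rV[F]_n} :=
  projT1 (cid (tangent_space_exists X x)).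

Lemma mem_tangent_space X x v :
  v \in tangent_space X x <-> tangent_vector X x v.
Proof. exact: (projT2 (cid (tangent_space_exists X x))). Qed.

Definition tangent_at L X x : Prop := (tangent_space X x <= L)%VS.

Definition codim_eq (e : nat) L : Prop := (\dim L + e = n)%N.

Definition zariski_open (r : nat) (A : 'rV[F]_r -> Prop) : Prop :=
  exists I : {mpoly F[r]} -> Prop,
    forall v, A v <-> exists2 f, I f & meval_row f v != 0.

(* Zariski topology on (P(F^n))^k, as the quotient topology from the k-tuples
   of nonzero vectors; such a tuple is the list of rows of a k x n matrix. *)
Definition points_open (k : nat)
    (U : {ffun 'I_k -> {vspace 'rV[F]_n}} -> Prop) : Prop :=
  zariski_open (fun m : 'rV[F]_(k * n) => let M := vec_mx m in
    (forall i, row i M != 0) /\ U [ffun i => <[row i M]>%VS]).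

(* Zariski topology on the Grassmannian of the d-dimensional subspaces of F^n,
   as the quotient topology from the frames (linearly independent d-tuples). *)
Definition grass_open (d : nat) (U : {vspace 'rV[F]_n} -> Prop) : Prop :=
  zariski_open (fun m : 'rV[F]_(d * n) =>
    let L := (\sum_(i < d) <[row i (vec_mx m)]>)%VS in \dim L = d /\ U L).

End Projective.

(* P holds for a general member of Y, i.e. on a nonempty relatively open subset
   of Y, where opn is the topology of an ambient space.  This has its usual
   meaning for irreducible Y, whose nonempty open subsets are dense. *)
Definition for_general (T : Type) (opn : (T -> Prop) -> Prop)
    (Y P : T -> Prop) : Prop :=
  exists U : T -> Prop, [/\ opn U, exists2 y, Y y & U y &
    forall y, Y y -> U y -> P y].

Section Segre.
Variables (F : fieldType) (a b c : nat).

(* The coordinates of the tensor product of u, v and w, i.e. the products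
   u_i v_j w_l, listed through mxvec_index. *)
Definition segre_vec (u : 'rV[F]_a.+1) (v : 'rV[F]_b.+1) (w : 'rV[F]_c.+1) :
    'rV[F]_(a.+1 * b.+1 * c.+1) :=
  mxvec ((mxvec (u^T *m v))^T *m w).

Definition segre (x : {vspace 'rV[F]_(a.+1 * b.+1 * c.+1)}) : Prop :=
  exists u v w, [/\ u != 0, v != 0, w != 0 & x = <[segre_vec u v w]>%VS].

End Segre.
Arguments segre F a b c x : clear implicits.

(* Main.v *)
(* Let [S] be the span of the tangent spaces at the k points u_i (x) v_i (x) w_i,
   and let L be the kernel of a general matrix K with m = a + b + 2 columns that
   kills S. If L is tangent at x (x) z (x) w, then K kills x (x) z (x) W,
   x (x) V (x) w and U (x) z (x) w.
   Since (x, z) varies in a family of dimension a + b < m, the first condition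
   forces x (x) z (x) W to lie in S. For general points this implies that x (x) z
   is in the span of the u_i (x) v_i, and then that it is proportional to one of
   them, because k + a + b + 2 < (a + 1)(b + 1). So (x, z) is (u_i, v_i), and K
   kills u_i (x) V (x) w. But for w outside the line of w_i the image of this
   space modulo S has dimension at least R > (c + 1) / m, and w varies in a space
   of dimension c + 1, so a general K does not kill it.
   The properties of general points are open, and hold for one configuration:
   W is split into planes, the points are distributed evenly among them, and in
   each plane the points receive distinct coordinates (1, i). The tangent
   directions along W of the points of all the other planes must then be
   independent of the tangent spaces of the points of this plane; this is
   arranged by placing the former in the cells of an (a + 1) x (b + 1) board, and
   the bound on k guarantees that there are enough cells. *)
From HB Require Import structures.
Require Import Defs.
From mathcomp Require Import all_boot all_order all_algebra.
From mathcomp Require Import mpoly.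
From mathcomp Require Import complex reals.
From mathcomp Require Import boolp zify ring lra.
Set Implicit Arguments.
Unset Strict Implicit.
Unset Printing Implicit Defensive.
Import Order.TTheory GRing.Theory Num.Theory VectorInternalTheory.
Local Open Scope ring_scope.

(** * Polynomial functions and generic properties *)

(** Neither irreducibility nor dimension theory is invoked. A generic property holds off the zeros
    of one nonzero polynomial function, so finitely many of them combine by multiplication, an open
    rank condition needs a single example, and counts of parameters rest on one fact: a polynomial
    map into a space of larger dimension has its image in a hypersurface. The constant [R] is
    [(c + 1) %/ (a + b + 2) + 1], the least integer with [m * R > c + 1]. There are [c./2] planes,
    so that the coordinate [ord_max] of W vanishes at all special points; x (x) z is tested on x (x)
    z (x) e_max alone. The board reflects a dimension count. Each cell carries a plane. With s
    points of that plane on the diagonal, a cell with both coordinates at least s is free, a cell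
    with just one coordinate below s loses one dimension to a tangent vector along U or V, and the
    other cells are full. A point of another plane brings two dimensions, hence takes one free cell
    or two half-free ones. Different planes use different boards but must share the same u_i and
    v_i: each requirement on these is generic, so all can be met together. *)

Section PolynomialFunctions.
Variable F : numFieldType.

(* Polynomial functions, without a choice of coordinates. *)
Inductive polyf (T : lmodType F) : (T -> F) -> Prop :=
| polyf_const c : polyf (fun=> c)
| polyf_scalar (l : T -> F) :
    (forall a x y, l (a *: x + y) = a * l x + l y) -> polyf l
| polyf_add f g : polyf f -> polyf g -> polyf (fun t => f t + g t)
| polyf_mul f g : polyf f -> polyf g -> polyf (fun t => f t * g t).

(* [P] holds on a nonempty principal open set; since the values of a nonzero
   polynomial function on a line are those of a nonzero polynomial, two such
   sets always meet. *)
Definition generic (T : lmodType F) (P : T -> Prop) : Prop :=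
  exists h : T -> F, [/\ polyf h, exists t, h t != 0 & forall t, h t != 0 -> P t].

Lemma polyf_ext (T : lmodType F) (f g : T -> F) :
  f =1 g -> polyf f -> polyf g.
Proof. by move=> /funext ->. Qed.

Lemma polyf_opp (T : lmodType F) (f : T -> F) :
  polyf f -> polyf (fun t => - f t).
Proof.
move=> pf; apply: (@polyf_ext _ (fun t => -1 * f t)).
  by move=> t; rewrite mulN1r.
by apply: polyf_mul => //; apply: polyf_const.
Qed.

Lemma polyf_sum (T : lmodType F) (I : Type) (r : seq I) (P : pred I)
    (f : I -> T -> F) :
  (forall i, polyf (f i)) -> polyf (fun t => \sum_(i <- r | P i) f i t).
Proof.
move=> pf; elim: r => [|i r IH].
  by apply: polyf_ext (polyf_const _ 0) => t; rewrite big_nil.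
case Pi: (P i); last by apply: polyf_ext IH => t; rewrite big_cons Pi.
by apply: polyf_ext (polyf_add (pf i) IH) => t; rewrite big_cons Pi.
Qed.

Lemma polyf_prod (T : lmodType F) (I : Type) (r : seq I) (P : pred I)
    (f : I -> T -> F) :
  (forall i, polyf (f i)) -> polyf (fun t => \prod_(i <- r | P i) f i t).
Proof.
move=> pf; elim: r => [|i r IH].
  by apply: polyf_ext (polyf_const _ 1) => t; rewrite big_nil.
case Pi: (P i); last by apply: polyf_ext IH => t; rewrite big_cons Pi.
by apply: polyf_ext (polyf_mul (pf i) IH) => t; rewrite big_cons Pi.
Qed.

Lemma polyf_exp (T : lmodType F) (f : T -> F) m :
  polyf f -> polyf (fun t => f t ^+ m).
Proof.
move=> pf; elim: m => [|m IH]; first exact: polyf_const.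
by apply: polyf_ext (polyf_mul pf IH) => t; rewrite exprS.
Qed.

Definition polymx (T : lmodType F) m n (M : T -> 'M[F]_(m, n)) :=
  forall i j, polyf (fun t => M t i j).

Lemma polymx_const (T : lmodType F) m n (A : 'M[F]_(m, n)) :
  polymx (fun=> A : 'M[F]_(m, n)) (T := T).
Proof. by move=> i j; apply: polyf_const. Qed.

Lemma polymx_add (T : lmodType F) m n (A B : T -> 'M[F]_(m, n)) :
  polymx A -> polymx B -> polymx (fun t => A t + B t).
Proof.
move=> pA pB i j; apply: polyf_ext (polyf_add (pA i j) (pB i j)) => t.
by rewrite mxE.
Qed.

Lemma polymx_opp (T : lmodType F) m n (A : T -> 'M[F]_(m, n)) :
  polymx A -> polymx (fun t => - A t).
Proof.
by move=> pA i j; apply: polyf_ext (polyf_opp (pA i j)) => t; rewrite mxE.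
Qed.

Lemma polymx_scale (T : lmodType F) m n (f : T -> F) (A : T -> 'M[F]_(m, n)) :
  polyf f -> polymx A -> polymx (fun t => f t *: A t).
Proof.
by move=> pf pA i j; apply: polyf_ext (polyf_mul pf (pA i j)) => t; rewrite mxE.
Qed.

Lemma polymx_mul (T : lmodType F) m n p (A : T -> 'M[F]_(m, n))
    (B : T -> 'M[F]_(n, p)) :
  polymx A -> polymx B -> polymx (fun t => A t *m B t).
Proof.
move=> pA pB i j.
apply: (@polyf_ext _ (fun t => \sum_k A t i k * B t k j)) => [t|].
  by rewrite mxE.
by apply: polyf_sum => k; apply: polyf_mul.
Qed.

Lemma polymx_tr (T : lmodType F) m n (A : T -> 'M[F]_(m, n)) :
  polymx A -> polymx (fun t => (A t)^T).
Proof. by move=> pA i j; apply: polyf_ext (pA j i) => t; rewrite mxE. Qed.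

Lemma polyf_det (T : lmodType F) n (A : T -> 'M[F]_n) :
  polymx A -> polyf (fun t => \det (A t)).
Proof.
move=> pA; apply: polyf_sum => s; apply: polyf_mul; first exact: polyf_const.
by apply: polyf_prod.
Qed.

Lemma polymx_adj (T : lmodType F) n (A : T -> 'M[F]_n) :
  polymx A -> polymx (fun t => \adj (A t)).
Proof.
move=> pA i j.
apply: (@polyf_ext _
  (fun t => (-1) ^+ (j + i) * \det (row' j (col' i (A t))))) => [t|].
  by rewrite mxE.
apply: polyf_mul; first exact: polyf_const.
apply: polyf_det => x y; apply: polyf_ext (pA (lift j x) (lift i y)) => t.
by rewrite !mxE.
Qed.

Lemma polyf_comp (T1 T2 : lmodType F) (g : T1 -> T2) (f : T2 -> F) :
  (forall l : T2 -> F, (forall a x y, l (a *: x + y) = a * l x + l y) ->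
     polyf (fun t => l (g t))) ->
  polyf f -> polyf (fun t => f (g t)).
Proof.
move=> pg; elim=> {f} [c|l ll|f1 f2 _ p1 _ p2|f1 f2 _ p1 _ p2].
- exact: polyf_const.
- exact: pg.
- exact: polyf_add.
- exact: polyf_mul.
Qed.

Lemma scalar_sum (T : lmodType F) (l : T -> F) (I : Type) (r : seq I) (P : pred I)
    (a : I -> F) (x : I -> T) :
  (forall a x y, l (a *: x + y) = a * l x + l y) ->
  l (\sum_(i <- r | P i) a i *: x i) = \sum_(i <- r | P i) a i * l (x i).
Proof.
move=> ll; have l0 : l 0 = 0.
  have := ll 1 0 0; rewrite scale1r addr0 mul1r => /eqP.
  by rewrite -subr_eq subrr eq_sym => /eqP.
elim: r => [|i r IH]; first by rewrite !big_nil.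
by rewrite !big_cons; case: (P i); rewrite ?ll IH.
Qed.

Lemma polyf_comp_mx (T : lmodType F) m n (g : T -> 'M[F]_(m, n))
    (f : 'M[F]_(m, n) -> F) :
  polymx g -> polyf f -> polyf (fun t => f (g t)).
Proof.
move=> pg; apply: polyf_comp => l ll.
apply: (@polyf_ext _ (fun t => \sum_ij g t ij.1 ij.2 * l (delta_mx ij.1 ij.2))).
  move=> t; rewrite {2}[g t]matrix_sum_delta pair_big /=.
  by rewrite (scalar_sum _ _ _ _ ll).
apply: polyf_sum => ij; apply: polyf_mul; first exact: pg.
exact: polyf_const.
Qed.

Lemma poly_nonroot (p : {poly F}) : p != 0 -> exists x, p.[x] != 0.
Proof.
move=> p0; apply: contrapT => noroot.
pose s := [seq (i%:R : F) | i <- iota 0 (size p)].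
have us : uniq s.
  by rewrite map_inj_uniq ?iota_uniq // => i j /eqP; rewrite eqr_nat => /eqP.
have rs : all (root p) s.
  apply/allP => x _; rewrite rootE; apply/negPn/negP => px.
  by apply: noroot; exists x.
by have := max_poly_roots p0 rs us; rewrite size_map size_iota ltnn.
Qed.

Lemma polyf_line (T : lmodType F) (f : T -> F) (t1 t2 : T) : polyf f ->
  exists p : {poly F}, forall x, f (x *: t1 + t2) = p.[x].
Proof.
elim=> {f} [c|l ll|f1 f2 _ [p1 e1] _ [p2 e2]|f1 f2 _ [p1 e1] _ [p2 e2]].
- by exists c%:P => x; rewrite hornerC.
- by exists (l t1 *: 'X + (l t2)%:P) => x; rewrite ll !hornerE mulrC.
- by exists (p1 + p2) => x; rewrite hornerD e1 e2.
- by exists (p1 * p2) => x; rewrite hornerM e1 e2.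
Qed.

Lemma polyf_mul_neq0 (T : lmodType F) (f g : T -> F) : polyf f -> polyf g ->
  (exists t, f t != 0) -> (exists t, g t != 0) -> exists t, f t * g t != 0.
Proof.
move=> pf pg [t1 f1] [t2 g2].
have [p ep] := polyf_line (t1 - t2) t2 pf.
have [q eq] := polyf_line (t1 - t2) t2 pg.
have p1 : p.[1] != 0 by rewrite -ep scale1r subrK.
have q0 : q.[0] != 0 by rewrite -eq scale0r add0r.
have [x] : exists x, (p * q).[x] != 0.
  apply: poly_nonroot; apply: mulf_neq0.
    by apply: contraNneq p1 => ->; rewrite horner0.
  by apply: contraNneq q0 => ->; rewrite horner0.
rewrite hornerM -ep -eq => h.
by exists (x *: (t1 - t2) + t2).
Qed.

Lemma generic_and (T : lmodType F) (P Q : T -> Prop) :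
  generic P -> generic Q -> generic (fun t => P t /\ Q t).
Proof.
move=> [f [pf f0 fP]] [g [pg g0 gQ]].
exists (fun t => f t * g t); split; first exact: polyf_mul.
  exact: polyf_mul_neq0.
move=> t; rewrite mulf_eq0 negb_or => /andP[ft gt]; split; [exact: fP|exact: gQ].
Qed.

Lemma generic_sub (T : lmodType F) (P Q : T -> Prop) :
  (forall t, P t -> Q t) -> generic P -> generic Q.
Proof. by move=> PQ [h [ph h0 hP]]; exists h; split=> // t /hP /PQ. Qed.

Lemma generic_true (T : lmodType F) (P : T -> Prop) :
  (forall t, P t) -> generic P.
Proof.
move=> PT; exists (fun=> 1); split=> //; first exact: polyf_const.
by exists 0; rewrite oner_neq0.
Qed.

Lemma generic_ex (T : lmodType F) (P : T -> Prop) : generic P -> exists t, P t.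
Proof. by move=> [h [_ [t ht] hP]]; exists t; apply: hP. Qed.

Lemma generic_all (T : lmodType F) (I : finType) (P : I -> T -> Prop) :
  (forall i, generic (P i)) -> generic (fun t => forall i, P i t).
Proof.
move=> gP.
suff H (s : seq I) : generic (fun t => forall i, i \in s -> P i t).
  by apply: generic_sub (H (enum I)) => t Pt i; apply: Pt; rewrite mem_enum.
elim: s => [|i s IH]; first by apply: generic_true.
apply: generic_sub (generic_and (gP i) IH) => t [Pi Ps] j.
by rewrite inE => /predU1P[->|/Ps].
Qed.

Lemma generic_comp (T1 T2 : lmodType F) (g : T1 -> T2) (g' : T2 -> T1)
    (P : T2 -> Prop) :
  (forall a x y, g (a *: x + y) = a *: g x + g y) -> cancel g' g ->
  generic P -> generic (fun t => P (g t)).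
Proof.
move=> lg gK [h [ph [t ht] hP]]; exists (fun t => h (g t)); split.
- by apply: polyf_comp ph => l ll; apply: polyf_scalar => a x y; rewrite lg ll.
- by exists (g' t); rewrite gK.
- by move=> t' /hP.
Qed.

Lemma generic_neq0 (T : lmodType F) (f : T -> F) (t0 : T) :
  polyf f -> f t0 != 0 -> generic (fun t => f t != 0).
Proof. by move=> pf f0; exists f; split=> //; exists t0. Qed.

(** The normal form of [M t0] gives [P] and [Q] for which [P *m M t0 *m Q] is the identity of size
    [r]. Where the polynomial [\det (P *m M t *m Q)] does not vanish, [M t] still has rank at least
    [r]. *)
Lemma generic_rank (T : lmodType F) m n (M : T -> 'M[F]_(m, n)) (t0 : T) :
  polymx M -> generic (fun t => (\rank (M t0) <= \rank (M t))%N).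
Proof.
move=> pM; set r := \rank (M t0).
have [P [Q PQ]] : exists (P : 'M[F]_(r, m)) (Q : 'M[F]_(n, r)),
    P *m M t0 *m Q = 1%:M.
  exists (pid_mx r *m invmx (col_ebase (M t0))).
  exists (invmx (row_ebase (M t0)) *m pid_mx r).
  rewrite -[in X in _ *m X *m _](mulmx_ebase (M t0)) !mulmxA.
  rewrite mulmxKV ?col_ebase_unit // mulmxK ?row_ebase_unit //.
  by rewrite !pid_mx_id ?rank_leq_row ?rank_leq_col // pid_mx_1.
apply: (@generic_sub _ (fun t => \det (P *m M t *m Q) != 0)).
  move=> t; rewrite -unitfE -unitmxE -row_full_unit -[row_full _]/(_ == _).
  move=> /eqP {1}<-; apply: leq_trans (mxrankM_maxl _ _) _.
  exact: mxrankM_maxr.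
apply: (@generic_neq0 _ _ t0); last by rewrite PQ det1 oner_neq0.
apply: polyf_det; apply: polymx_mul; last exact: polymx_const.
by apply: polymx_mul => //; apply: polymx_const.
Qed.

(** The image of [mu] does not depend on [t], so injectivity of [phi t] on it means that the values
    on a fixed basis are independent, and [generic_rank] carries this over from [t0]. In the
    applications [mu] projects onto normalized data, which removes the obvious kernel of [phi t]. *)
Lemma generic_inj (T : lmodType F) (V W : vectType F) n (mu : V -> W)
    (phi : T -> W -> 'rV[F]_n) (t0 : T) :
  (forall a x y, mu (a *: x + y) = a *: mu x + mu y) ->
  (forall t a x y, phi t (a *: x + y) = a *: phi t x + phi t y) ->
  (forall w, polymx (fun t => phi t w)) ->
  (forall x, phi t0 (mu x) = 0 -> mu x = 0) ->
  generic (fun t => forall x, phi t (mu x) = 0 -> mu x = 0).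
Proof.
move=> lmu lphi pphi inj0.
pose m : {linear V -> W} := HB.pack mu (GRing.isLinear.Build F V W *:%R mu lmu).
pose D : {vspace W} := limg (linfun m).
have memD w : reflect (exists x, w = mu x) (w \in D).
  apply: (iffP memv_imgP) => [[x _ ->]|[x ->]].
    by exists x; rewrite lfunE.
  by exists x; rewrite ?memvf // lfunE.
pose M t := \matrix_(i < \dim D) phi t (vbasis D)`_i.
have phi_sum t I (r : seq I) (a : I -> F) (x : I -> W) :
    phi t (\sum_(i <- r) a i *: x i) = \sum_(i <- r) a i *: phi t (x i).
  have p0 : phi t 0 = 0.
    have := lphi t 1 0 0; rewrite !scale1r addr0 => /eqP.
    by rewrite -subr_eq subrr eq_sym => /eqP.
  elim: r => [|i r IH]; first by rewrite !big_nil.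
  by rewrite !big_cons lphi IH.
have ME t (c : 'rV_(\dim D)) :
    c *m M t = phi t (\sum_i c 0 i *: (vbasis D)`_i).
  rewrite phi_sum mulmx_sum_row; apply: eq_bigr => i _.
  by rewrite rowK.
have D2 w : w \in D -> exists c : 'rV[F]_(\dim D), w = \sum_i c 0 i *: (vbasis D)`_i.
  move=> wD; exists (\row_i coord (vbasis D) i w).
  by rewrite {1}(coord_vbasis wD); apply: eq_bigr => i _; rewrite mxE.
have free0 : row_free (M t0).
  apply/row_freeP; exists (pinvmx (M t0)); apply: mulmxVp.
  rewrite -kermx_eq0; apply/rowV0P => c /sub_kermxP; rewrite ME => c0.
  have : \sum_i c 0 i *: (vbasis D)`_i \in D.
    by apply: memv_suml => i _; apply/memvZ/vbasis_mem/mem_nth; rewrite size_tuple.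
  move=> /memD[x ex]; rewrite ex in c0; have {c0} := inj0 _ c0.
  rewrite -ex => cs; have /freeP fr := basis_free (vbasisP D).
  by apply/rowP => i; rewrite mxE; apply: fr.
apply: generic_sub (generic_rank t0 (M := M) _).
  move=> t; rewrite (eqP free0) => rk x.
  have fr : row_free (M t) by rewrite /row_free eqn_leq rank_leq_row.
  have [|c ->] := D2 (mu x); first by apply/memD; exists x.
  rewrite -ME => /eqP; rewrite mulmx_free_eq0 // => /eqP ->.
  by rewrite big1 // => i _; rewrite mxE scale0r.
move=> i j; apply: polyf_ext (pphi (vbasis D)`_i 0 j) => t.
by rewrite mxE.
Qed.

End PolynomialFunctions.

(** * Dimension counts *)

Lemma base_expansion_inj (N q : nat) (e e' : nat -> nat) :
  (forall j, (e j < N)%N) -> (forall j, (e' j < N)%N) ->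
  (\sum_(j < q) e j * N ^ j = \sum_(j < q) e' j * N ^ j)%N ->
  forall j, (j < q)%N -> e j = e' j.
Proof.
elim: q e e' => [//|q IH] e e' le le'.
have N0 : (0 < N)%N by apply: leq_ltn_trans (le 0%N).
have shift (f : nat -> nat) : (\sum_(j < q.+1) f j * N ^ j =
    f 0%N + N * \sum_(j < q) f j.+1 * N ^ j)%N.
  rewrite big_ord_recl /= expn0 muln1; congr (_ + _)%N.
  rewrite big_distrr /=; apply: eq_bigr => j _.
  by rewrite /bump /= add1n expnS mulnCA.
rewrite !shift => E; have e0 : e 0%N = e' 0%N.
  have := congr1 (modn^~ N) E.
  by rewrite /= ![(N * _)%N]mulnC ![(_ + _ * N)%N]addnC !modnMDl !modn_small.
move: E; rewrite e0 => /addnI /eqP; rewrite eqn_pmul2l // => /eqP E.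
case=> [//|j] ltj.
by apply: (IH (fun j => e j.+1) (fun j => e' j.+1)) => // i.
Qed.

Section Counting.
Variable F : numFieldType.

Lemma polyf_mpoly (T : vectType F) (f : T -> F) : polyf f ->
  exists P : {mpoly F[dim T]}, forall t, f t = meval_row P (v2r t).
Proof.
move=> pf; elim: f / pf => [c|l ll|f1 f2 _ [p1 e1] _ [p2 e2]|f1 f2 _ [p1 e1] _ [p2 e2]].
- by exists c%:MP => t; rewrite /meval_row mevalC.
- exists (\sum_i l (r2v (delta_mx 0 i)) *: 'X_i) => t.
  rewrite /meval_row raddf_sum /= -[t in LHS]v2rK {1}(row_sum_delta (v2r t)).
  rewrite linear_sum /=.
  under eq_bigr do rewrite linearZ /=.
  rewrite (scalar_sum _ _ _ _ ll); apply: eq_bigr => i _.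
  by rewrite mevalZ mevalXU mulrC.
- by exists (p1 + p2) => t; rewrite /meval_row mevalD e1 e2.
- by exists (p1 * p2) => t; rewrite /meval_row mevalM e1 e2.
Qed.

Lemma polyf_coord (n : nat) (i : 'I_n) : polyf (fun v : 'rV[F]_n => v 0 i).
Proof. by apply: polyf_scalar => a x y; rewrite !mxE. Qed.

Lemma polyf_row_mpoly (n : nat) (f : 'rV[F]_n -> F) : polyf f ->
  exists P : {mpoly F[n]}, forall v, f v = meval_row P v.
Proof.
move=> pf; elim: f / pf => [c|l ll|f1 f2 _ [p1 e1] _ [p2 e2]|f1 f2 _ [p1 e1] _ [p2 e2]].
- by exists c%:MP => t; rewrite /meval_row mevalC.
- exists (\sum_i l (delta_mx 0 i) *: 'X_i) => t.
  rewrite /meval_row raddf_sum /= {1}(row_sum_delta t).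
  rewrite (scalar_sum _ _ _ _ ll); apply: eq_bigr => i _.
  by rewrite mevalZ mevalXU mulrC.
- by exists (p1 + p2) => t; rewrite /meval_row mevalD e1 e2.
- by exists (p1 * p2) => t; rewrite /meval_row mevalM e1 e2.
Qed.

Lemma card_bounded_multinom (p K : nat) : (#|{: 'X_{1..p < K}}| <= K ^ p)%N.
Proof.
have lt (m : 'X_{1..p < K}) i : (bmnm m i < K)%N.
  apply: leq_ltn_trans (bmdeg m); rewrite mdegE (bigD1 i) //=.
  exact: leq_addr.
pose f (m : 'X_{1..p < K}) := [ffun i => Ordinal (lt m i)].
have : (#|{: 'X_{1..p < K}}| <= #|{ffun 'I_p -> 'I_K}|)%N.
  apply: (@leq_card _ _ f) => m m' /ffunP E; apply/val_inj/mnmP => i.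
  by have := E i; rewrite !ffunE => /(congr1 val).
by rewrite card_ffun !card_ord.
Qed.

Lemma msize_mul_leq n (P Q : {mpoly F[n]}) x y :
  (msize P <= x.+1)%N -> (msize Q <= y.+1)%N -> (msize (P * Q) <= (x + y).+1)%N.
Proof.
have [->|P0] := eqVneq P 0; first by rewrite mul0r msize0.
have [->|Q0] := eqVneq Q 0; first by rewrite mulr0 msize0.
move=> hP hQ; rewrite msizeM //.
have : (msize P + msize Q <= x.+1 + y.+1)%N by apply: leq_add.
by rewrite addnS addSn; case: (_ + _)%N.
Qed.

Lemma msize_monomial n q (P : 'I_q -> {mpoly F[n]}) (d N : nat) (e : 'I_q -> nat) :
  (forall j, (msize (P j) <= d)%N) -> (forall j, (e j <= N)%N) ->
  (msize (\prod_j P j ^+ e j) <= (q * (N * d)).+1)%N.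
Proof.
move=> hP he.
have hX j m : (msize (P j ^+ m) <= (m * d).+1)%N.
  elim: m => [|m IH]; first by rewrite expr0 msize1.
  by rewrite exprS mulSn; apply: msize_mul_leq => //; apply: leqW.
rewrite -[q in (q * _)%N]card_ord -sum_nat_const.
elim/big_ind2: _ => [|x1 x2 y1 y2|j _]; first by rewrite msize1.
  by move=> h1 h2; apply: msize_mul_leq.
by apply: leq_trans (hX _ _) _; rewrite ltnS leq_mul2r he orbT.
Qed.

(* Substituting [x ^ (N ^ j)] for the j-th variable separates these monomials. *)
Lemma monomials_independent (q N : nat) (c : {ffun 'I_q -> 'I_N} -> F) :
  (exists e, c e != 0) ->
  exists x : 'rV[F]_q, \sum_e c e * \prod_j x 0 j ^+ e j != 0.
Proof.
case=> e0 ce0.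
pose k (e : {ffun 'I_q -> 'I_N}) := (\sum_j e j * N ^ j)%N.
have kinj : injective k.
  move=> e e' E; apply/ffunP => j.
  case: N => [|N] in c e0 ce0 k e e' E j *; first by case: (e j).
  case: q => [|q] in c e0 ce0 k e e' E j *; first by case: j.
  apply/val_inj.
  have lt (f : {ffun 'I_q.+1 -> 'I_N.+1}) i : (f (inord i) < N.+1)%N by [].
  have := @base_expansion_inj _ q.+1 _ _ (lt e) (lt e') _ j (ltn_ord j).
  rewrite inord_val; apply.
  under eq_bigr do rewrite inord_val.
  by under [RHS]eq_bigr do rewrite inord_val.
pose P : {poly F} := \sum_e c e *: 'X^(k e).
have : P != 0.
  apply: contraNneq ce0 => P0; have := congr1 (fun p : {poly F} => p`_(k e0)) P0.
  rewrite coef0 coef_sum (bigD1 e0) //= coefZ coefXn eqxx mulr1 big1 ?addr0 => [->//|].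
  move=> e ne; rewrite coefZ coefXn eq_sym; case: eqP => [/kinj E|_].
    by rewrite E eqxx in ne.
  by rewrite mulr0.
case/poly_nonroot => x; rewrite horner_sum => hx.
exists (\row_j x ^+ (N ^ j)); apply: contraNneq hx => E; apply/eqP; rewrite -[RHS]E.
apply: eq_bigr => e _; rewrite !hornerE; congr (_ * _).
rewrite /k expr_sum; apply: eq_bigr => j _.
by rewrite mxE -exprM mulnC.
Qed.

(* The products of powers, with exponents below [N], of the coordinates of [g]
   are more numerous than the monomials available to express them when [N] is
   large; hence they satisfy a linear relation, which cuts out a hypersurface
   containing the image. *)
Lemma generic_notin_image (T1 T2 : vectType F) (g : T1 -> T2) :
  (forall l : T2 -> F, (forall a x y, l (a *: x + y) = a * l x + l y) ->
     polyf (fun x => l (g x))) ->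
  (dim T1 < dim T2)%N -> generic (fun t => forall x, g x <> t).
Proof.
move=> pg; set p := dim T1; set q := dim T2 => ltpq.
have /choice[P PE] (j : 'I_q) : exists P : {mpoly F[p]},
    forall x, v2r (g x) 0 j = meval_row P (v2r x).
  apply: polyf_mpoly; apply: (pg (fun t => v2r t 0 j)) => a x y.
  by rewrite linearP !mxE.
pose d := (\max_j msize (P j))%N.
have hd j : (msize (P j) <= d)%N by apply: (leq_bigmax j).
(* With this [N], from [K <= N * (q * d).+1] follows [K ^ p <= N ^ p * (q * d).+1 ^ p < N ^ p * N <=
   N ^ q]. *)
pose N := ((q * d).+1 ^ p).+1.
pose K := (q * (N * d)).+1.
pose E := {ffun 'I_q -> 'I_N}.
pose Q (e : E) := \prod_j P j ^+ e j.
have hQ e : (msize (Q e) <= K)%N.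
  by apply: msize_monomial => // j; apply: ltnW.
pose X := 'X_{1..p < K}.
have ltXE : (#|{: X}| < #|{: E}|)%N.
  apply: leq_ltn_trans (card_bounded_multinom _ _) _.
  rewrite card_ffun !card_ord.
  have le : (K <= N * (q * d).+1)%N.
    by rewrite /K mulnS mulnCA -addn1 addnC leq_add2r.
  apply: leq_ltn_trans (_ : (N * (q * d).+1) ^ p < _)%N.
    by case: (p) => [//|p']; rewrite leq_exp2r.
  rewrite expnMn -[X in (_ < _ ^ X)%N](subnKC (ltnW ltpq)) expnD ltn_pmul2l ?expn_gt0 //.
  rewrite -subn_gt0 in ltpq; case: (q - p)%N ltpq => // r _.
  by apply: (@leq_trans N); rewrite // expnS leq_pmulr ?expn_gt0.
pose A : 'M[F]_(#|{: E}|, #|{: X}|) :=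
  \matrix_(i, j) (Q (enum_val i))@_(bmnm (enum_val j)).
have : kermx A != 0.
  rewrite kermx_eq0 /row_free neq_ltn.
  by rewrite (leq_ltn_trans (rank_leq_col _)).
case/rowV0Pn => a /sub_kermxP aA a0.
pose c e := a 0 (enum_rank e).
pose h (t : T2) := \sum_e c e * \prod_j v2r t 0 j ^+ e j.
exists h; split.
- apply: polyf_sum => e; apply: polyf_mul; first exact: polyf_const.
  apply: polyf_prod => j; apply: polyf_exp; apply: polyf_scalar => b x y.
  by rewrite linearP !mxE.
- have [|x hx] := monomials_independent (c := c).
    have [i ai] : exists i, a 0 i != 0.
      apply: contrapT => na; case/negP: a0; apply/eqP/rowP => i; rewrite mxE.
      by apply/eqP/negPn/negP => ai; apply: na; exists i.
    by exists (enum_val i); rewrite /c enum_valK.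
  by exists (r2v (x : 'rV_(dim T2)) : T2); rewrite /h r2vK.
- move=> t ht x gx; case/negP: ht; rewrite -gx /h.
  have S0 : \sum_e c e *: Q e = 0.
    apply/mpolyP => m; rewrite mcoeff0 raddf_sum /=.
    have [ltm|lem] := ltnP (mdeg m) K; last first.
      apply: big1 => e _; rewrite mcoeffZ memN_msupp_eq0 ?mulr0 //.
      by apply: msize_mdeg_ge; apply: leq_trans (hQ e) _.
    have := congr1 (fun B : 'M_(_, _) => B 0 (enum_rank (BMultinom ltm))) aA.
    rewrite !mxE (reindex (@enum_rank E)) /=; last exact/onW_bij/enum_rank_bij.
    move=> E0; rewrite -[RHS]E0.
    by apply: eq_bigr => e _; rewrite mcoeffZ mxE !enum_rankK.
  have := congr1 (fun p => meval_row p (v2r x)) S0.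
  rewrite /meval_row meval0 raddf_sum /= => E0; apply/eqP; rewrite -[RHS]E0.
  apply: eq_bigr => e _; rewrite mevalZ rmorph_prod /=; congr (_ * _).
  by apply: eq_bigr => j _; rewrite rmorphXn PE.
Qed.

End Counting.

(** * Matrices that annihilate no member of a family of subspaces *)

Section GenericForms.
Variable F : numFieldType.

Lemma polyf_linear_comp (T1 T2 : lmodType F) (g : {linear T1 -> T2}) (f : T2 -> F) :
  polyf f -> polyf (fun t => f (g t)).
Proof.
apply: polyf_comp => l ll; apply: polyf_scalar => a x y.
by rewrite linearP ll.
Qed.

Lemma polymx_linear_comp (T1 T2 : lmodType F) (g : {linear T1 -> T2}) m n
    (A : T2 -> 'M[F]_(m, n)) :
  polymx A -> polymx (fun t => A (g t)).
Proof. by move=> pA i j; apply: polyf_linear_comp (pA i j). Qed.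

Section Extension.
Variables (n R m : nat) (f : 'I_R -> 'I_n).
Local Notation D := {ffun {x : 'I_n | x \notin codom f} -> 'rV[F]_m}.

(** The rows outside the image of [f] are free parameters; those in the image are left zero because
    they are recovered afterwards by solving a linear system. *)
Definition off_image (c : D) : 'M[F]_(n, m) :=
  \matrix_(x, y) (if insub x is Some z then c z 0 y else 0).

Lemma polymx_off_image : polymx off_image.
Proof.
move=> x y; apply: polyf_scalar => a c c'; rewrite !mxE.
by case: insub => [z|]; rewrite ?ffunE ?mxE ?mulr0 ?addr0 ?ffunE ?mxE.
Qed.

Lemma dim_off_image : injective f -> (dim D = (n - R) * m)%N.
Proof.
move=> finj; transitivity (#|{: {x : 'I_n | x \notin codom f}}| * (1 * m))%N; first by [].
rewrite mul1n card_sig; congr (_ * _)%N.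
have := cardC (mem (codom f)); rewrite card_codom // !card_ord => E.
apply/eqP; rewrite -(eqn_add2l R) subnKC -?[X in _ == X]E; last by rewrite -[X in (_ <= X)%N]E leq_addr.
by apply/eqP; congr (_ + _)%N; apply: eq_card => x; rewrite !inE.
Qed.

Lemma off_imageE (c : 'M[F]_(n, m)) : injective f ->
  off_image [ffun x => row (val x) c] +
    (\matrix_(x, b) (x == f b)%:R) *m rowsub f c = c.
Proof.
move=> finj; apply/matrixP => x y; rewrite !mxE.
case: insubP => [z zf <-|].
  rewrite ffunE mxE big1 ?addr0 // => b _; rewrite !mxE.
  case: eqP => [E|_]; last by rewrite mul0r.
  by case/negP: (valP z); rewrite E codom_f.
rewrite negbK => /codomP[b ->]; rewrite add0r (bigD1 b) //= !mxE eqxx mul1r.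
rewrite big1 ?addr0 // => b' ne; rewrite !mxE.
case: eqP => [/finj E|_]; last by rewrite mul0r.
by rewrite E eqxx in ne.
Qed.

End Extension.

(* The [c] with [E t *m c = 0] form a space of codimension [m * R] when [E t]
   has rank [R]; a nonzero minor [\det (N t)] parametrizes it. *)
Lemma generic_mul_neq0 (T : vectType F) R n m (E : T -> 'M[F]_(R, n)) :
  polymx E -> (dim T < m * R)%N ->
  generic (fun c : 'M[F]_(n, m) => forall t, row_free (E t) -> E t *m c != 0).
Proof.
move=> pE ltd.
suff gf (f : {ffun 'I_R -> 'I_n}) : generic (fun c : 'M[F]_(n, m) =>
    forall t, \det (colsub f (E t)) != 0 -> E t *m c != 0).
  apply: generic_sub (generic_all gf) => c hc t.
  move=> fE'; have fE : row_full (E t)^T by rewrite /row_full mxrank_tr.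
  apply: (hc (fullrankfun fE) t).
  have := fullrowsub_unit fE; rewrite unitmxE unitfE -det_tr.
  by congr (\det _ != 0); apply/matrixP => i j; rewrite !mxE.
have [/injectiveP finj|/injectivePn[i [j ne Eij]]] := boolP (injectiveb f); last first.
  apply: generic_true => c t; rewrite -det_tr (determinant_alternate ne) ?eqxx //.
  by move=> x; rewrite !mxE Eij.
pose D := {ffun {x : 'I_n | x \notin codom f} -> 'rV[F]_m}.
pose J : 'M[F]_(n, R) := \matrix_(x, b) (x == f b)%:R.
pose N t := colsub f (E t).
have EJ t : E t *m J = N t.
  apply/matrixP => i b; rewrite !mxE (bigD1 (f b)) //= !mxE eqxx mulr1.
  by rewrite big1 ?addr0 // => x /negPf ne; rewrite !mxE ne mulr0.
(* Cramer's rule: when [N] is invertible, [E *m c = 0] determines the rows of [c] in the image of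
   [f] from the others. The adjugate replaces the inverse to keep [g] polynomial, and the resulting
   factor [\det N] is absorbed by rescaling the parameters. *)
pose g (x : T * D) := \det (N x.1) *: off_image x.2 -
  J *m (\adj (N x.1) *m (E x.1 *m off_image x.2)).
have pg : polymx g.
  have pE1 : polymx (fun x : T * D => E x.1) by apply: (polymx_linear_comp fst).
  have pN : polymx (fun x : T * D => N x.1).
    by move=> i j; apply: polyf_ext (pE1 i (f j)) => x; rewrite !mxE.
  have po : polymx (fun x : T * D => off_image x.2).
    by apply: (polymx_linear_comp snd); apply: polymx_off_image.
  apply: polymx_add; first by apply: polymx_scale => //; apply: polyf_det.
  apply: polymx_opp; apply: polymx_mul; first exact: polymx_const.
  by apply: polymx_mul; [apply: polymx_adj|apply: polymx_mul].
have leRn : (R <= n)%N by have := leq_card f finj; rewrite !card_ord.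
apply: generic_sub (generic_notin_image (g := g) _ _).
- move=> c hc t dN; apply/eqP => Ec; set d := \det _ in dN.
  apply: (hc (t, [ffun x => d^-1 *: row (val x) c] : D)).
  set co := off_image (f := f) [ffun x => row (val x) c].
  have -> : [ffun x => d^-1 *: row (val x) c] =
      d^-1 *: [ffun x => row (val x) c] :> D by apply/ffunP => x; rewrite !ffunE.
  have offZ (x : D) : off_image (d^-1 *: x) = d^-1 *: off_image x.
    apply/matrixP => i j; rewrite !mxE; case: insub => [z|]; last by rewrite mulr0.
    by rewrite ffunE mxE.
  rewrite /g /= offZ -/co -/d scalerA divff // scale1r.
  have Eco : E t *m co = - (N t *m rowsub f c).
    apply/eqP; rewrite -addr_eq0 -EJ -mulmxA -mulmxDr.
    by rewrite off_imageE // Ec.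
  rewrite -scalemxAr Eco scalerN mulmxN -scalemxAr !mulmxA mul_adj_mx.
  rewrite mul_scalar_mx scalerA mulVf // scale1r mulmxN opprK.
  exact: off_imageE.
- by move=> l ll; apply: polyf_comp_mx => //; apply: polyf_scalar.
- rewrite dim_matrix.
  have -> : dim (T * D)%type = (dim T + dim D)%N by [].
  rewrite dim_off_image // mulnBl -[X in (_ < X)%N](subnKC (leq_mul leRn (leqnn m))).
  by rewrite ltn_add2r mulnC.
Qed.

End GenericForms.

(** * Products in the span of general products *)

Section Trisecant.
Variable F : numFieldType.

Lemma generic_fst (T1 T2 : lmodType F) (P : T1 -> Prop) :
  generic P -> generic (fun t : T1 * T2 => P t.1).
Proof. exact: (@generic_comp _ _ _ fst (fun x => (x, 0))). Qed.

Lemma generic_snd (T1 T2 : lmodType F) (P : T2 -> Prop) :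
  generic P -> generic (fun t : T1 * T2 => P t.2).
Proof. exact: (@generic_comp _ _ _ snd (fun x => (0, x))). Qed.

Lemma polyf_pair (T T1 T2 : lmodType F) (g1 : T -> T1) (g2 : T -> T2) :
  (forall l : T1 -> F, (forall a x y, l (a *: x + y) = a * l x + l y) ->
     polyf (fun x => l (g1 x))) ->
  (forall l : T2 -> F, (forall a x y, l (a *: x + y) = a * l x + l y) ->
     polyf (fun x => l (g2 x))) ->
  forall l : T1 * T2 -> F, (forall a x y, l (a *: x + y) = a * l x + l y) ->
     polyf (fun x => l (g1 x, g2 x)).
Proof.
move=> h1 h2 l ll.
have lD x y : l (x + y) = l x + l y by have := ll 1 x y; rewrite scale1r mul1r.
apply: (@polyf_ext _ _ (fun x => l (g1 x, 0) + l (0, g2 x))) => [x|].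
  by rewrite -lD; congr l; congr pair; rewrite /= ?addr0 ?add0r.
have e1 (V W : lmodType F) a (x y : V) : (a *: x + y, 0 : W) = a *: (x, 0) + (y, 0).
  by congr pair; rewrite /= scaler0 addr0.
have e2 (V W : lmodType F) a (x y : W) : (0 : V, a *: x + y) = a *: (0, x) + (0, y).
  by congr pair; rewrite /= scaler0 addr0.
apply: polyf_add.
  by apply: (h1 (fun x => l (x, 0))) => a x y; rewrite e1 ll.
by apply: (h2 (fun x => l (0, x))) => a x y; rewrite e2 ll.
Qed.

Lemma generic_rows_free (k n r : nat) (f : 'I_r -> 'I_k) : injective f -> (r <= n)%N ->
  generic (fun u : 'M[F]_(k, n) => row_free (rowsub f u)).
Proof.
move=> finj lern.
pose u0 : 'M[F]_(k, n) := (\matrix_(x, b) (x == f b)%:R) *m (pid_mx r : 'M_(r, n)).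
have pm : polymx (fun u : 'M[F]_(k, n) => rowsub f u).
  by move=> i j; apply: polyf_scalar => a x y; rewrite !mxE.
apply: generic_sub (generic_rank u0 pm) => u.
have -> : rowsub f u0 = pid_mx r.
  apply/matrixP => i j; rewrite !mxE (bigD1 i) //= !mxE eqxx mul1r.
  rewrite big1 ?addr0 // => i' ne; rewrite !mxE; case: eqP => [/finj E|_].
    by rewrite E eqxx in ne.
  by rewrite mul0r.
by rewrite rank_pid_mx // => h; rewrite /row_free eqn_leq rank_leq_row.
Qed.

(* The only products [x (x) z] in the span of the [u_i (x) v_i] are multiples of
   one of these. *)
Definition good_pairs (k A B : nat) (y : 'M[F]_(k, A) * 'M[F]_(k, B)) : Prop :=
  forall (x : 'rV[F]_A) (z : 'rV[F]_B) (c : 'rV[F]_k), x != 0 -> z != 0 ->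
  x^T *m z = y.1^T *m diag_mx c *m y.2 ->
  exists i, (exists a, x = a *: row i y.1) /\ (exists b, z = b *: row i y.2).

Section Param.
Variables (k A B : nat) (f : 'I_A -> 'I_k).
Local Notation D := {ffun {x : 'I_k | x \notin codom f} -> 'rV[F]_B}.
Local Notation T := ('M[F]_(k, A) * 'rV[F]_k * 'rV[F]_A * 'rV[F]_B * D)%type.

(* In [x^T z = u^T diag(c) v] with [rowsub f u] invertible, the rows [f _] of
   [v] are determined up to scaling by the other data; the scaling factors are
   stored in the entries [f _] of the vector [t.1.1.1.2]. *)
Definition secant_param (t : T) : 'M[F]_(k, A) * 'M[F]_(k, B) :=
  let u := t.1.1.1.1 in let c := t.1.1.1.2 in let o := off_image t.2 in
  (u, o + (\matrix_(x, b) (x == f b)%:R) *m diag_mx (colsub f c) *m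
          \adj (rowsub f u)^T *m (t.1.1.2^T *m t.1.2 - u^T *m diag_mx c *m o)).

Lemma polyf_secant_param (l : 'M[F]_(k, A) * 'M[F]_(k, B) -> F) :
  (forall a x y, l (a *: x + y) = a * l x + l y) -> polyf (fun t => l (secant_param t)).
Proof.
have pu : polymx (fun t : T => t.1.1.1.1) by move=> i j; apply: polyf_scalar => a x y; rewrite !mxE.
have pc m n (g : 'I_m -> 'I_n -> 'I_k) (s : 'I_m -> 'I_n -> nat) :
    polymx (fun t : T => \matrix_(i, j) (t.1.1.1.2 0 (g i j) *+ s i j)).
  move=> i j; apply: polyf_scalar => a x y.
  by rewrite !mxE mulrnDl mulrnAr.
have po : polymx (fun t : T => off_image t.2).
  by apply: (polymx_linear_comp snd); apply: polymx_off_image.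
apply: polyf_pair => l' ll'.
  by apply: polyf_comp_mx => //; apply: polyf_scalar.
apply: polyf_comp_mx; last exact: polyf_scalar.
apply: polymx_add => //; apply: polymx_mul.
  apply: polymx_mul.
    apply: polymx_mul; first exact: polymx_const.
    move=> i j; apply: polyf_ext (pc _ _ (fun i j => f i) (fun i j => i == j) i j) => t.
    by rewrite !mxE.
  apply: polymx_adj; apply: polymx_tr => i j.
  by apply: polyf_ext (pu (f i) j) => t; rewrite mxE.
apply: polymx_add.
  by apply: polymx_mul => i j; apply: polyf_scalar => a x y; rewrite !mxE.
apply: polymx_opp; apply: polymx_mul => //; apply: polymx_mul.
  exact: polymx_tr.
move=> i j; apply: polyf_ext (pc _ _ (fun i j => i) (fun i j => i == j) i j) => t.
by rewrite !mxE.
Qed.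

Lemma secant_paramP (u : 'M[F]_(k, A)) (v : 'M[F]_(k, B)) (x : 'rV[F]_A)
    (z : 'rV[F]_B) (c : 'rV[F]_k) :
  injective f -> row_free (rowsub f u) -> (forall a, c 0 (f a) != 0) ->
  x^T *m z = u^T *m diag_mx c *m v -> exists t, secant_param t = (u, v).
Proof.
move=> finj uf cf E; set U := rowsub f u; set d := \det U.
have d0 : d != 0 by rewrite -unitfE -unitmxE -row_free_unit.
(* Off the image of [f] the entries of [c] are kept, since they multiply the free rows. On it, the
   inverse cancels both the entry of [c] and the determinant produced by the adjugate. *)
pose c' : 'rV[F]_k := \row_i if i \in codom f then (d * c 0 i)^-1 else c 0 i.
exists (u, c', x, z, [ffun i => row (val i) v]).
rewrite /secant_param /=; congr pair.
set o := off_image _; set J := (X in o + X *m _ *m _ *m _).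
have vE : o + J *m rowsub f v = v by apply: off_imageE.
have -> : u^T *m diag_mx c' *m o = u^T *m diag_mx c *m o.
  by rewrite -!mulmxA; congr (_ *m _); rewrite !mul_diag_mx; apply/matrixP => i j;
     rewrite !mxE; case: insubP => [w wf _|]; rewrite ?mulr0 // (negPf wf).
have -> : x^T *m z - u^T *m diag_mx c *m o = U^T *m diag_mx (colsub f c) *m rowsub f v.
  rewrite E -{1}vE mulmxDr addrC addKr mulmxA; congr (_ *m _).
  rewrite !mul_mx_diag; apply/matrixP => i b; rewrite !mxE (bigD1 (f b)) //=.
  rewrite !mxE eqxx mulr1 big1 ?addr0 // => i' /negPf ne.
  by rewrite !mxE ne mulr0.
rewrite -[RHS]vE; congr (_ + _); rewrite -!mulmxA; congr (_ *m _).
rewrite [_ *m (U^T *m _)]mulmxA mul_adj_mx mul_scalar_mx det_tr -/d.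
rewrite -scalemxAr !mulmxA mulmx_diag mul_diag_mx.
apply/matrixP => i j; rewrite !mxE codom_f.
by rewrite -mulrA mulrCA [d * (_ * _)]mulrA mulKf // mulf_neq0.
Qed.

End Param.

Lemma outer_eq0 A B (x : 'rV[F]_A) (z : 'rV[F]_B) :
  x^T *m z = 0 -> z != 0 -> x = 0.
Proof.
move=> xz /rV0Pn[j zj]; apply/rowP => i; have := congr1 (fun M : 'M_(_, _) => M i j) xz.
by rewrite !mxE big_ord1 !mxE => /eqP; rewrite mulf_eq0 (negPf zj) orbF => /eqP.
Qed.

(** If more than [A] coefficients are nonzero, solving for [A] of the rows of [v] puts the pair in
    the image of [secant_param], whose source has dimension [k * A + k + A + B + (k - A) * B]; this
    is below [k * A + k * B] exactly when [k + A + B < A * B]. Otherwise the rows of [u] involved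
    are independent, so the rows of [v] involved are multiples of [z]; as any two rows of [v] are
    independent, at most one is involved. *)
Lemma generic_good_pairs (k A B : nat) : (1 < B)%N -> (k + A + B < A * B)%N ->
  generic (@good_pairs k A B).
Proof.
move=> B1 kAB.
have rowsA : generic (fun y : 'M[F]_(k, A) * 'M[F]_(k, B) =>
    forall (r : 'I_A.+1) (f : {ffun 'I_r -> 'I_k}),
      injective f -> row_free (rowsub f y.1)).
  apply: generic_all => r; apply: generic_all => f.
  have [/injectiveP finj|/injectiveP ninj] := boolP (injectiveb f); last first.
    by apply: generic_true.
  apply: generic_sub (generic_fst _ (generic_rows_free finj _)) => //.
  by rewrite -ltnS.
have rowsB : generic (fun y : 'M[F]_(k, A) * 'M[F]_(k, B) =>
    forall (r : 'I_3) (f : {ffun 'I_r -> 'I_k}),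
      injective f -> row_free (rowsub f y.2)).
  apply: generic_all => r; apply: generic_all => f.
  have [/injectiveP finj|/injectiveP ninj] := boolP (injectiveb f); last first.
    by apply: generic_true.
  apply: generic_sub (generic_snd _ (generic_rows_free finj _)) => //.
  by apply: leq_trans B1; rewrite -ltnS.
have secants : generic (fun y : 'M[F]_(k, A) * 'M[F]_(k, B) =>
    forall (f : {ffun 'I_A -> 'I_k}), injective f -> forall t, secant_param (f := f) t <> y).
  apply: generic_all => f.
  have [/injectiveP finj|/injectiveP ninj] := boolP (injectiveb f); last first.
    by apply: generic_true.
  apply: generic_sub (generic_notin_image (@polyf_secant_param k A B f) _) => //.
  have leAk : (A <= k)%N by have := leq_card f finj; rewrite !card_ord.
  pose D := {ffun {x : 'I_k | x \notin codom f} -> 'rV[F]_B}.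
  have -> : dim ('M[F]_(k, A) * 'rV[F]_k * 'rV[F]_A * 'rV[F]_B * D)%type =
      (k * A + 1 * k + 1 * A + 1 * B + dim D)%N by [].
  have -> : dim ('M[F]_(k, A) * 'M[F]_(k, B))%type = (k * A + k * B)%N by [].
  rewrite dim_off_image // !mul1n mulnBl.
  by have := leq_mul leAk (leqnn B); lia.
apply: generic_sub (generic_and rowsA (generic_and rowsB secants)).
move=> [u v] /= [fu [fv nsec]] x z c x0 z0 E.
set S := [set i | c 0 i != 0].
pose e (r : nat) (h : (r <= #|S|)%N) : {ffun 'I_r -> 'I_k} :=
  [ffun i => enum_val (widen_ord h i)].
have einj r (h : (r <= #|S|)%N) : injective (e r h).
  move=> i j; rewrite !ffunE => /enum_val_inj /(congr1 val) /= ij.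
  exact: val_inj.
have ec r (h : (r <= #|S|)%N) i : c 0 (e r h i) != 0.
  by rewrite ffunE; have := enum_valP (widen_ord h i); rewrite inE.
have [ltA|leA] := ltnP A #|S|.
  have [t ht] := secant_paramP (einj _ (ltnW ltA)) (fu (Ordinal (ltnSn A)) _ (einj _ (ltnW ltA)))
    (ec _ (ltnW ltA)) E.
  by case: (nsec _ (einj _ (ltnW ltA)) t ht).
pose f : {ffun 'I_#|S| -> 'I_k} := [ffun i => enum_val i].
have finj : injective f by move=> i j; rewrite !ffunE => /enum_val_inj.
have Ef : x^T *m z = (rowsub f u)^T *m diag_mx (colsub f c) *m rowsub f v.
  rewrite E !mul_mx_diag; apply/matrixP => i j; rewrite !mxE.
  rewrite (bigID (mem S)) /= [X in _ + X]big1 ?addr0; last first.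
    by move=> l; rewrite inE negbK !mxE => /eqP ->; rewrite mulr0 mul0r.
  by rewrite big_enum_val /=; apply: eq_bigr => l _; rewrite !mxE !ffunE.
have /row_freeP[P UP] := fu (Ordinal (leA : #|S| < A.+1)%N) f finj.
have vz a : exists b, row (f a) v = b *: z.
  have : P^T *m (x^T *m z) = diag_mx (colsub f c) *m rowsub f v.
    by rewrite Ef !mulmxA -trmx_mul UP trmx1 mul1mx.
  move=> Ea; exists ((c 0 (f a))^-1 * (P^T *m x^T) a 0); apply/rowP => j.
  have := congr1 (fun M : 'M_(_, _) => M a j) Ea.
  rewrite mulmxA mul_diag_mx !mxE big_ord1 !mxE -mulrA => ->.
  by rewrite mulKf // ffunE; have := enum_valP a; rewrite inE.
have z_unique (a a' : 'I_#|S|) : a = a'.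
  apply: contrapT => /eqP ne; have [b vb] := vz a; have [b' vb'] := vz a'.
  pose g : {ffun 'I_2 -> 'I_k} := [ffun i : 'I_2 => if i == 0 then f a else f a'].
  have ginj : injective g.
    move=> [[|[|//]] hi] [[|[|//]] hj]; rewrite !ffunE => /= E2; apply/val_inj => //=.
      by rewrite (enum_val_inj E2) eqxx in ne.
    by rewrite (enum_val_inj E2) eqxx in ne.
  have := fv (Ordinal (isT : (2 < 3)%N)) g ginj.
  have -> : rowsub g v = (\col_i if i == 0 then b else b') *m z.
    apply/matrixP => i j; rewrite !mxE big_ord1 !mxE ffunE.
    by move/rowP/(_ j): vb; move/rowP/(_ j): vb'; rewrite !mxE; case: (i == 0).
  rewrite /row_free => /eqP rk; have := mxrankM_maxr (\col_(i < 2) if i == 0 then b else b') z.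
  by rewrite rk leqNgt ltnS rank_leq_row.
have [S0|[i iS]] : S = set0 \/ exists i, i \in S.
  by have [->|[i iS]] := set_0Vmem S; [left|right; exists i].
  case/negP: x0; apply/eqP/(outer_eq0 _ z0); rewrite E mul_mx_diag.
  apply/matrixP => i j; rewrite !mxE big1 // => l _; rewrite !mxE.
  have : l \notin S by rewrite S0 inE.
  by rewrite inE negbK => /eqP ->; rewrite mulr0 mul0r.
have [b vb] := vz (enum_rank_in iS i).
rewrite ffunE enum_rankK_in // in vb.
have E1 : x^T *m z = c 0 i *: ((row i u)^T *m row i v).
  rewrite E mul_mx_diag; apply/matrixP => p q; rewrite !mxE (bigD1 i) //= big_ord1 !mxE.
  rewrite big1 ?addr0 => [|l li]; first by rewrite mulrCA mulrA.
  rewrite !mxE; have [lS|] := boolP (l \in S).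
    have := z_unique (enum_rank_in lS l) (enum_rank_in iS i).
    move/(congr1 enum_val); rewrite !enum_rankK_in // => El.
    by rewrite El eqxx in li.
  by rewrite inE negbK => /eqP ->; rewrite mulr0 mul0r.
have b0 : b != 0.
  apply: contraNneq x0 => b0; apply/eqP/(outer_eq0 _ z0).
  by rewrite E1 vb b0 scale0r mulmx0 scaler0.
exists i; split; last by exists b^-1; rewrite /= vb scalerA mulVf // scale1r.
exists (c 0 i * b); apply/eqP; rewrite -subr_eq0; apply/eqP/(outer_eq0 _ z0).
rewrite linearB /= mulmxBl E1 vb [(_ *: row i u)^T]linearZ /= -scalemxAl -scalemxAr scalerA.
by rewrite subrr.
Qed.

End Trisecant.

(** * A special configuration of points *)

Section Tensors.
Variable F : numFieldType.

Definition tensor A B C (u : 'rV[F]_A) (v : 'rV[F]_B) (w : 'rV[F]_C) : 'rV[F]_(A * B * C) :=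
  mxvec ((mxvec (u^T *m v))^T *m w).

Definition tcoord A B C (i : 'I_A) (j : 'I_B) (l : 'I_C) (x : 'rV[F]_(A * B * C)) : F :=
  x 0 (mxvec_index (mxvec_index i j) l).

Lemma tcoord_tensor A B C (u : 'rV[F]_A) (v : 'rV[F]_B) (w : 'rV[F]_C) i j l :
  tcoord i j l (tensor u v w) = u 0 i * v 0 j * w 0 l.
Proof. by rewrite /tcoord /tensor mxvecE mxE big_ord1 mxE mxvecE mxE big_ord1 mxE. Qed.

Lemma tcoordP A B C (x y : 'rV[F]_(A * B * C)) :
  (forall i j l, tcoord i j l x = tcoord i j l y) -> x = y.
Proof.
move=> E; apply/rowP => t.
by case/mxvec_indexP: t => ij l; case/mxvec_indexP: ij => i j; apply: E.
Qed.

Lemma tcoord_linear A B C i j l : linear (@tcoord A B C i j l : _ -> F^o).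
Proof. by move=> c x y; rewrite /tcoord !mxE. Qed.
HB.instance Definition _ A B C i j l :=
  GRing.isLinear.Build F 'rV[F]_(A * B * C) F^o *:%R (@tcoord A B C i j l)
    (tcoord_linear i j l).

(* The sum of one vector of each of the k tangent spaces, at the tensors
   [u_i v_i w_i], and of the vectors [u_i0 v'_r h_r]. *)
Definition tangent_sum k R A B C (u : 'M[F]_(k, A)) (v : 'M[F]_(k, B))
    (w : 'M[F]_(k, C)) (v' : 'M[F]_(R, B)) (i0 : 'I_k)
    (x : 'M[F]_(k, A)) (z : 'M[F]_(k, B)) (o : 'M[F]_(k, C)) (h : 'M[F]_(R, C)) :
    'rV[F]_(A * B * C) :=
  \sum_i (tensor (row i x) (row i v) (row i w) + tensor (row i u) (row i z) (row i w) +
          tensor (row i u) (row i v) (row i o)) +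
  \sum_r tensor (row i0 u) (row r v') (row r h).

Lemma tcoord_tangent_sum k R A B C u v w v' i0 x z o h a b l :
  tcoord a b l (@tangent_sum k R A B C u v w v' i0 x z o h) =
  \sum_i (x i a * v i b * w i l + u i a * z i b * w i l + u i a * v i b * o i l) +
  \sum_r u i0 a * v' r b * h r l.
Proof.
rewrite linearD !linear_sum /=; congr (_ + _); apply: eq_bigr => i _.
  by rewrite !linearD /= !tcoord_tensor !mxE.
by rewrite tcoord_tensor !mxE.
Qed.

End Tensors.

Lemma exists_inj (X Y : finType) (S : {set X}) (S' : {set Y}) (y0 : Y) :
  (#|S| <= #|S'|)%N ->
  exists f : X -> Y, {in S &, injective f} /\ {in S, forall x, f x \in S'}.
Proof.
move=> le; exists (fun x => nth y0 (enum S') (index x (enum S))).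
have lt x : x \in S -> (index x (enum S) < size (enum S'))%N.
  by move=> xS; rewrite -cardE (leq_trans _ le) // cardE index_mem mem_enum.
split=> [x y xS yS /eqP|x xS].
  rewrite nth_uniq ?enum_uniq ?lt // => /eqP E.
  by rewrite -(nth_index x (_ : x \in enum S)) ?mem_enum // E nth_index ?mem_enum.
by rewrite -mem_enum mem_nth ?lt.
Qed.

(** * The special configuration in one plane *)

Section Block.
Variables (F : numFieldType) (a b k R : nat) (G : {set 'I_k}) (i0 : 'I_k).
Local Notation A := a.+1.
Local Notation B := b.+1.
Local Notation s := #|G|.
Hypothesis (ltsA : (s <= a)%N) (ltsB : (s + R <= b)%N).

Definition pos (i : 'I_k) : nat := index i (enum G).
Definition at_pos (n : nat) : 'I_k := nth i0 (enum G) n.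

Lemma pos_lt i : i \in G -> (pos i < s)%N.
Proof. by move=> iG; rewrite cardE index_mem mem_enum. Qed.

Lemma at_posK n : (n < s)%N -> pos (at_pos n) = n.
Proof. by move=> ns; rewrite /pos index_uniq ?enum_uniq // -cardE. Qed.

Lemma posK i : i \in G -> at_pos (pos i) = i.
Proof. by move=> iG; rewrite /at_pos nth_index ?mem_enum. Qed.

Lemma at_pos_in n : (n < s)%N -> at_pos n \in G.
Proof. by move=> ns; rewrite -mem_enum mem_nth -?cardE. Qed.

(* The cells of an [A x B] board that serve as slots for the points outside
   [G]; a slot in a row [n < s] (with [n] even) stands for the two cells in the
   rows [n] and [n + 1], and similarly for columns. *)
Definition low n := ~~ odd n && (n.+1 < s)%N.
Definition slots : {set 'I_A * 'I_B} :=
  setX [set n : 'I_A | (s <= n)%N || low n] [set n : 'I_B | (s <= n)%N] :|: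
  setX [set n : 'I_A | (s <= n)%N] [set n : 'I_B | low n].

Lemma card_high n : (n.+1 - s <= #|[set i : 'I_n.+1 | (s <= i)%N]|)%N.
Proof.
have [le|lt] := leqP s n.+1; last by rewrite (eqP (ltnW lt)).
pose f (i : 'I_(n.+1 - s)) : 'I_n.+1 := inord (s + i).
have fv i : f i = s + i :> nat.
  by rewrite inordK //; have := ltn_ord i; lia.
have finj : injective f.
  by move=> i j /(congr1 val) /=; rewrite !fv => /addnI E; apply/val_inj.
rewrite -[X in (X <= _)%N]card_ord -(card_codom finj) subset_leq_card //.
by apply/subsetP => _ /codomP[i ->]; rewrite inE fv leq_addr.
Qed.

Lemma card_low n : (s <= n.+1)%N -> (s./2 <= #|[set i : 'I_n.+1 | low i]|)%N.
Proof.
move=> le; pose f (i : 'I_(s./2)) : 'I_n.+1 := inord i.*2.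
have lt (i : 'I_(s./2)) : (i.*2.+1 < s)%N by have := ltn_ord i; lia.
have fv i : f i = i.*2 :> nat by rewrite inordK //; have := lt i; lia.
have finj : injective f.
  by move=> i j /(congr1 val) /=; rewrite !fv => /double_inj E; apply/val_inj.
rewrite -[X in (X <= _)%N]card_ord -(card_codom finj) subset_leq_card //.
by apply/subsetP => _ /codomP[i ->]; rewrite inE /low fv odd_double lt.
Qed.

(** The summands count the free cells and the pairs of half-free cells. For odd [s] the last row and
    the last column below [s] have no partner, whence [s./2]. *)
Lemma card_slots :
  ((A - s) * (B - s) + s./2 * (A - s + (B - s)) <= #|slots|)%N.
Proof.
rewrite cardsU disjoint_setI0 ?cards0 ?subn0.
  have hA : (A - s + s./2 <= #|[set n : 'I_A | (s <= n)%N || low n]|)%N.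
    have -> : [set n : 'I_A | (s <= n)%N || low n] = [set n : 'I_A | (s <= n)%N] :|: [set n : 'I_A | low n].
      by apply/setP => n; rewrite !inE.
    rewrite cardsU disjoint_setI0 ?cards0 ?subn0.
      by apply: leq_add; [apply: card_high | apply: card_low; lia].
    by rewrite disjoint_subset; apply/subsetP => n; rewrite !inE /low; lia.
  have -> : ((A - s) * (B - s) + s./2 * (A - s + (B - s)) =
             (A - s + s./2) * (B - s) + (A - s) * s./2)%N.
    by rewrite mulnDr mulnDl; lia.
  rewrite !cardsX leq_add // leq_mul // ?card_high //; apply: card_low; lia.
rewrite disjoint_subset; apply/subsetP => n; rewrite !inE /low; lia.
Qed.

(** Slots met by the vectors [u_i0 v'_r], where [v'_r] will be the unit vector at column
    [b - 1 - r]. By [ltsB] these columns are not below [s], and they leave column [b] to the cell of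
    [i0]. For [i0] in [G], the row [pos i0] belongs to a slot named by an even row, whence the
    rounding. *)
Definition reserved : {set 'I_A * 'I_B} :=
  [set ((if i0 \in G then inord (pos i0)./2.*2 else ord_max) : 'I_A,
        inord (b.-1 - r) : 'I_B) | r : 'I_R].

(** The [R] spare slots make up for the reserved ones. If [i0] is outside [G], it is put into the
    corner by hand, which takes away one slot and one point, so the count is not affected. *)
Lemma slot_assignment : (k - s + R <= #|slots|)%N ->
  exists f : 'I_k -> 'I_A * 'I_B,
  [/\ {in ~: G &, injective f}, {in ~: G, forall j, f j \in slots},
      {in ~: G, forall j, j != i0 -> f j \notin reserved} &
      i0 \notin G -> f i0 = (ord_max, ord_max)].
Proof.
move=> cap; pose top : 'I_A * 'I_B := (ord_max, ord_max).
pose S := ~: G :\ i0; pose S' := slots :\: (if i0 \in G then reserved else top |: reserved).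
have cR : (#|reserved| <= R)%N by rewrite (leq_trans (leq_imset_card _ _)) ?card_ord.
have leS : (#|S| <= #|S'|)%N.
  have E := cardsID (if i0 \in G then reserved else top |: reserved) slots.
  have cG : (#|~: G| = k - s)%N by rewrite -[X in (X - _)%N](card_ord k) -(cardsC G) addKn.
  have E2 := cardsD1 i0 (~: G).
  have le2 : (#|slots :&: (if i0 \in G then reserved else top |: reserved)| <=
              R + (i0 \notin G))%N.
    apply: leq_trans (subset_leq_card (subsetIr _ _)) _.
    case: (i0 \in G); first by rewrite addn0.
    by rewrite cardsU1 addnC leq_add // leq_b1.
  move: E2; rewrite !inE cG => E2; rewrite -/S in E2.
  move: E2 le2 cap; rewrite -E -/S'; move: #|S| #|S'| => m m'.
  by move: #|_ :&: _| (nat_of_bool _) => x y; lia.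
have [f [finj fS]] := exists_inj top leS.
exists (fun j => if j == i0 then top else f j); split.
- move=> i j; rewrite !inE => iG jG.
  have [ei|ni] := eqVneq i i0; have [ej|nj] := eqVneq j i0; first by rewrite ei ej.
  + have jS : j \in S by rewrite !inE nj.
    move=> E; have := fS j jS; rewrite -E !inE -ei (negPf iG).
    by rewrite in_setU1 eqxx.
  + have iS : i \in S by rewrite !inE ni.
    move=> E; have := fS i iS; rewrite E !inE -ej (negPf jG).
    by rewrite in_setU1 eqxx.
  + by apply: finj; rewrite !inE ?ni ?nj.
- move=> j; rewrite inE => jG; have [ej|nj] := eqVneq j i0.
    by rewrite !inE /= ltsA (leq_trans _ ltsB) ?leq_addr ?orbT.
  have jS : j \in S by rewrite !inE nj.
  by have := fS j jS; rewrite inE => /andP[].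
- move=> j; rewrite inE => jG nj; rewrite (negPf nj).
  have jS : j \in S by rewrite !inE nj.
  have := fS j jS; rewrite inE => /andP[+ _].
  by case: (i0 \in G); rewrite // in_setU1 negb_or => /andP[].
- by rewrite eqxx.
Qed.

Definition hits n c := (c == n) || ((n < s)%N && (c == n.+1)).

Lemma hits_inj n n' c : (s <= n)%N || low n -> (s <= n')%N || low n' ->
  hits n c -> hits n' c -> n = n'.
Proof. rewrite /low /hits; lia. Qed.

Lemma hits_high n c : (s <= n)%N || low n -> hits n c -> (s <= c)%N -> n = c.
Proof. rewrite /low /hits; lia. Qed.

Lemma hits_low n c : (s <= n)%N || low n -> hits n c -> (c < s)%N -> n = c./2.*2.
Proof. rewrite /low /hits; lia. Qed.

Lemma slot_rows c : c \in slots ->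
  ((s <= c.1)%N || low c.1) /\ ((s <= c.2)%N || low c.2).
Proof. by rewrite !inE => /orP[] /andP[-> ->]; rewrite ?orbT. Qed.

Lemma sum_at_pos (f : 'I_k -> F) (c : nat) :
  \sum_(i in G) (c == pos i)%:R * f i = if (c < s)%N then f (at_pos c) else 0.
Proof.
case: ltnP => [lt|le]; last first.
  apply: big1 => i /pos_lt ilt; case: eqP => [E|_]; last by rewrite mul0r.
  by rewrite E leqNgt ilt in le.
rewrite (bigD1 (at_pos c)) ?at_pos_in //= at_posK // eqxx mul1r big1 ?addr0 //.
move=> i /andP[iG ni]; case: eqP => [E|_]; last by rewrite mul0r.
by rewrite E posK ?eqxx in ni.
Qed.

Definition block_w : 'M[F]_(k, 2) :=
  \matrix_(i, l) if i \in G then (if l == 0 then 1 else i%:R) else 0.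

(* One plane of the last factor. The points of [G] are [e_n (x) e_n (x) (1, i)],
   those outside [G] have no component in the plane. A point outside [G] in the
   cell (n, n') only interacts, through its slots, with the tangent vectors of
   two points of [G], which have distinct second components. *)
Lemma block_special : (k - s + R <= #|slots|)%N ->
  exists (u : 'M[F]_(k, A)) (v : 'M[F]_(k, B)) (v' : 'M[F]_(R, B)),
  {in G, forall i, u i (inord (pos i)) = 1 /\ v i (inord (pos i)) = 1} /\
  forall (x : 'M_(k, A)) (z : 'M_(k, B)) (o : 'M_(k, 2)) (h : 'M_(R, 2)),
  (forall i (c : 'I_A), (i \notin G) || (c == pos i :> nat) -> x i c = 0) ->
  (forall i (c : 'I_B), (i \notin G) || (c == pos i :> nat) -> z i c = 0) ->
  (i0 \in G -> forall r, h r 0 = 0) ->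
  tangent_sum u v block_w v' i0 x z o h = 0 ->
  [/\ x = 0, z = 0, o = 0 & h = 0].
Proof.
case/slot_assignment => f [finj fslot fres f0].
pose u : 'M[F]_(k, A) :=
  \matrix_(i, c) (if i \in G then c == pos i :> nat else hits (f i).1 c)%:R.
pose v : 'M[F]_(k, B) :=
  \matrix_(i, c) (if i \in G then c == pos i :> nat else hits (f i).2 c)%:R.
pose v' : 'M[F]_(R, B) := \matrix_(r, c) (c == (b.-1 - r)%N :> nat)%:R.
exists u, v, v'; split.
  move=> i iG; have lt := pos_lt iG.
  by rewrite !mxE iG !inordK ?eqxx //; lia.
move=> x z o h x0 z0 h0 E.
pose w (i : 'I_k) (l : 'I_2) : F := if l == 0 then 1 else i%:R.
pose extra c1 c2 l := \sum_r u i0 c1 * v' r c2 * h r l.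
(* The relation read at one cell. The points of [G] are products of unit vectors on the diagonal, so
   from [G] only [x] at the point of column [c2], [z] at the point of row [c1] and, on the diagonal,
   [o] contribute. The rest comes from the points outside [G] placed there and from [h]. *)
have cell (c1 : 'I_A) (c2 : 'I_B) (l : 'I_2) :
    (if (c2 < s)%N then x (at_pos c2) c1 * w (at_pos c2) l else 0) +
    (if (c1 < s)%N then z (at_pos c1) c2 * w (at_pos c1) l else 0) +
    (if (c1 < s)%N then (c2 == c1 :> nat)%:R * o (at_pos c1) l else 0) +
    \sum_(i in ~: G) (hits (f i).1 c1 && hits (f i).2 c2)%:R * o i l +
    extra c1 c2 l = 0.
  have := congr1 (tcoord c1 c2 l) E; rewrite raddf0 tcoord_tangent_sum.
  move=> E0; rewrite -[RHS]E0; congr (_ + _); rewrite [RHS](bigID (mem G)) /=; congr (_ + _).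
    rewrite -[if (c2 < s)%N then _ else _](sum_at_pos (fun i => x i c1 * w i l)).
    rewrite -[if (c1 < s)%N then z _ _ * _ else _](sum_at_pos (fun i => z i c2 * w i l)).
    have -> : (if (c1 < s)%N then (c2 == c1 :> nat)%:R * o (at_pos c1) l else 0) =
        \sum_(i in G) (c1 == pos i :> nat)%:R * ((c2 == pos i :> nat)%:R * o i l).
      rewrite (sum_at_pos (fun i => (c2 == pos i :> nat)%:R * o i l)).
      by case: ifP => // lt; rewrite at_posK.
    rewrite -!big_split /=; apply: eq_bigr => i iG.
    rewrite !mxE iG; congr (_ + _ + _).
    - by rewrite mulrA [_%:R * _]mulrC.
    - by rewrite mulrA.
    - by rewrite mulrA.
  apply: eq_big => [i|i]; first by rewrite inE.
  rewrite inE => iG; rewrite x0 ?iG // z0 ?iG // !mul0r mulr0 !add0r mul0r add0r.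
  by rewrite !mxE (negPf iG) -mulnb natrM.
have host_sum j c1 c2 l : j \notin G -> hits (f j).1 c1 -> hits (f j).2 c2 ->
    \sum_(i in ~: G) (hits (f i).1 c1 && hits (f i).2 c2)%:R * o i l = o j l.
  move=> jG h1 h2; rewrite (bigD1 j) ?inE //= h1 h2 mul1r big1 ?addr0 // => i.
  rewrite inE => /andP[iG ij]; case: andP => [[g1 g2]|_]; last by rewrite mul0r.
  case/eqP: ij; apply: finj; rewrite ?inE //.
  have [|si1 si2] := @slot_rows (f i); first by apply: fslot; rewrite inE.
  have [|sj1 sj2] := @slot_rows (f j); first by apply: fslot; rewrite inE.
  have e1 : (f i).1 = (f j).1 :> nat by apply: (hits_inj (c := c1)).
  have e2 : (f i).2 = (f j).2 :> nat by apply: (hits_inj (c := c2)).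
  by rewrite [f i]surjective_pairing [f j]surjective_pairing (val_inj e1) (val_inj e2).
(* No outside point other than [i0] occupies a reserved slot, and [i0] itself sits in column [b],
   which differs from all [b - 1 - r]. *)
have host_extra j (c1 : 'I_A) (c2 : 'I_B) l : j \notin G ->
    hits (f j).1 c1 -> hits (f j).2 c2 -> extra c1 c2 l = 0.
  move=> jG h1 h2; apply: big1 => r _; rewrite !mxE.
  case: (eqVneq (c2 : nat) (b.-1 - r)%N) => [Ec2|_]; last by rewrite mulr0 mul0r.
  have ltr : (r < R)%N by [].
  have hc2 : (s <= b.-1 - r)%N by have := ltsB; lia.
  have ltb : (b.-1 - r < b)%N by have := ltsB; lia.
  have [|sj1 sj2] := @slot_rows (f j); first by apply: fslot; rewrite inE.
  have fj2 : (f j).2 = (b.-1 - r)%N :> nat.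
    by apply: hits_high => //; rewrite -Ec2.
  have fj2' : (f j).2 = inord (b.-1 - r).
    by apply/val_inj; rewrite /= inordK ?fj2 // ltnW.
  have := fres j; rewrite !inE jG => /(_ isT) nres.
  case: ifP => i0G.
    case: eqP => [Ec1|_]; last by rewrite !mul0r.
    have ltp := pos_lt i0G.
    have nj : j != i0 by apply: contraNneq jG => ->.
    case/negP: (nres nj).
    apply/imsetP; exists r => //; rewrite i0G [f j]surjective_pairing fj2'.
    have fj1 := hits_low sj1 h1; rewrite Ec1 in fj1.
    congr pair; apply/val_inj; rewrite /= inordK; first exact: fj1.
    by apply: leq_ltn_trans (_ : pos i0 < _)%N; [lia|apply: leq_trans ltp _; apply: leqW].
  rewrite f0 ?i0G //=; case: (boolP (hits a c1)) => [ha|_]; last by rewrite !mul0r.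
  have c1a : c1 = a :> nat by move: ha; rewrite /hits ltnNge ltsA orbF => /eqP.
  have fj1 : (f j).1 = ord_max.
    by apply/val_inj; rewrite /= (hits_high sj1 h1) c1a.
  have [ej|nj] := eqVneq j i0.
    by move: fj2; rewrite ej f0 ?i0G //=; lia.
  case/negP: (nres nj); apply/imsetP; exists r => //.
  by rewrite i0G [f j]surjective_pairing fj2' fj1.
have w_indep i i' p q : i != i' -> (forall l, p * w i l + q * w i' l = 0) -> p = 0 /\ q = 0.
  move=> ne H; have := H 0; have := H 1; rewrite /w /= !mulr1 => H1 /eqP.
  rewrite addr_eq0 => /eqP Ep; move/eqP: H1; rewrite Ep mulNr addrC -mulrBr mulf_eq0.
  have ne' : (i' == i :> nat) = false by apply: contraNF ne => /eqP e; apply/eqP; apply: ord_inj.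
  rewrite subr_eq0 eqr_nat ne' orbF => /eqP ->.
  by rewrite oppr0.
have lesB : (s <= b)%N by apply: leq_trans ltsB; apply: leq_addr.
have at_neq m n : (m < s)%N -> (n < s)%N -> m != n -> at_pos m != at_pos n.
  by move=> ms ns; apply: contraNneq => E1; rewrite -(at_posK ms) E1 at_posK.
(* In a free cell [o j] stands alone. In a slot of two cells it is a multiple of [w] at two
   different points, and these two vectors are independent. *)
have host0 j l : j \notin G -> o j l = 0.
  move=> jG; have := fslot j; rewrite !inE jG => /(_ isT).
  have hit1 : hits (f j).1 (f j).1 by rewrite /hits eqxx.
  have hit2 : hits (f j).2 (f j).2 by rewrite /hits eqxx.
  case/orP=> /andP[]; last first.
    move=> hi1 lo2; have [_ lt2] := andP lo2; have lt2' := ltnW lt2.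
    pose c2 : 'I_B := inord (f j).2.+1.
    have c2E : c2 = (f j).2.+1 :> nat by rewrite inordK // (leq_trans lt2) // leqW.
    have ltc2 : (c2 < s)%N by rewrite c2E.
    have hit2' : hits (f j).2 c2 by rewrite /hits c2E eqxx lt2' orbT.
    have E1 l' : x (at_pos (f j).2) (f j).1 * w (at_pos (f j).2) l' + o j l' = 0.
      have := cell (f j).1 (f j).2 l'; rewrite lt2' ltnNge hi1 /= (host_sum j) //.
      by rewrite (host_extra j) // !addr0.
    have E2 l' : x (at_pos c2) (f j).1 * w (at_pos c2) l' + o j l' = 0.
      have := cell (f j).1 c2 l'; rewrite ltc2 ltnNge hi1 /= (host_sum j) //.
      by rewrite (host_extra j) // !addr0.
    have [||x1 _] := w_indep (at_pos (f j).2) (at_pos c2)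
        (x (at_pos (f j).2) (f j).1) (- x (at_pos c2) (f j).1).
    - by apply: at_neq; rewrite ?c2E // ltn_eqF.
    - by move=> m; rewrite mulNr; apply/eqP; rewrite subr_eq0 -(inj_eq (addIr (o j m))) E1 E2.
    by have := E1 l; rewrite x1 mul0r add0r.
  case/orP=> [hi1|lo1] hi2.
    have := cell (f j).1 (f j).2 l; rewrite !ltnNge hi1 hi2 /= (host_sum j) //.
    by rewrite (host_extra j) // !addr0 !add0r.
  have [_ lt1] := andP lo1; have lt1' := ltnW lt1.
  pose c1 : 'I_A := inord (f j).1.+1.
  have c1E : c1 = (f j).1.+1 :> nat by rewrite inordK // (leq_trans lt1) // leqW.
  have ltc1 : (c1 < s)%N by rewrite c1E.
  have hit1' : hits (f j).1 c1 by rewrite /hits c1E eqxx lt1' orbT.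
  have neq c : (c < s)%N -> ((f j).2 == c :> nat) = false.
    by move=> cs; apply/negbTE; rewrite neq_ltn (leq_trans cs hi2) orbT.
  have E1 l' : z (at_pos (f j).1) (f j).2 * w (at_pos (f j).1) l' + o j l' = 0.
    have := cell (f j).1 (f j).2 l'; rewrite lt1' ltnNge hi2 neq //= (host_sum j) //.
    by rewrite (host_extra j) // mul0r !addr0 add0r.
  have E2 l' : z (at_pos c1) (f j).2 * w (at_pos c1) l' + o j l' = 0.
    have := cell c1 (f j).2 l'; rewrite ltc1 ltnNge hi2 neq //= (host_sum j) //.
    by rewrite (host_extra j) // mul0r !addr0 add0r.
  have [||z1 _] := w_indep (at_pos (f j).1) (at_pos c1)
      (z (at_pos (f j).1) (f j).2) (- z (at_pos c1) (f j).2).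
  - by apply: at_neq; rewrite ?c1E // ltn_eqF.
  - by move=> m; rewrite mulNr; apply/eqP; rewrite subr_eq0 -(inj_eq (addIr (o j m))) E1 E2.
  by have := E1 l; rewrite z1 mul0r add0r.
have cell' (c1 : 'I_A) (c2 : 'I_B) (l : 'I_2) :
    (if (c2 < s)%N then x (at_pos c2) c1 * w (at_pos c2) l else 0) +
    (if (c1 < s)%N then z (at_pos c1) c2 * w (at_pos c1) l else 0) +
    (if (c1 < s)%N then (c2 == c1 :> nat)%:R * o (at_pos c1) l else 0) +
    extra c1 c2 l = 0.
  rewrite -[RHS](cell c1 c2 l); congr (_ + _); rewrite -[LHS]addr0; congr (_ + _).
  by rewrite big1 // => i; rewrite inE => iG; rewrite host0 ?mulr0.
pose col r : 'I_B := inord (b.-1 - r).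
have colE r : (r < R)%N -> col r = (b.-1 - r)%N :> nat.
  by move=> rR; rewrite inordK //; have := ltsB; lia.
have col_high r : (r < R)%N -> (s <= col r)%N.
  by move=> rR; rewrite colE //; have := ltsB; lia.
have extra_col c1 (r : 'I_R) l : extra c1 (col r) l = u i0 c1 * h r l.
  rewrite /extra (bigD1 r) //= [v' r _]mxE colE // eqxx mulr1 big1 ?addr0 // => r' nr.
  rewrite [v' r' _]mxE colE //; case: eqP => [Er|_]; last by rewrite mulr0 mul0r.
  case/eqP: nr; apply/val_inj; have := ltsB; have := ltn_ord r; have := ltn_ord r'.
  by move: Er => /=; lia.
have extra_low c1 (c2 : 'I_B) l : (c2 < s)%N -> extra c1 c2 l = 0.
  move=> lt; apply: big1 => r _; rewrite [v' r _]mxE; case: eqP => [Er|_]; last by rewrite mulr0 mul0r.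
  by have := col_high r (ltn_ord r); rewrite colE // -Er leqNgt lt.
(* The coordinate 0 of the plane, where every [w] is 1, does not see [h] in these cells: if [i0] is
   in [G], because of the normalization [h r 0 = 0]; otherwise because [u i0] is supported on the
   last row. *)
have z_high i (c2 : 'I_B) : i \in G -> (s <= c2)%N -> z i c2 = 0.
  move=> iG hi2; have ltp := pos_lt iG.
  pose c1 : 'I_A := inord (pos i).
  have c1E : c1 = pos i :> nat by rewrite inordK // (leq_trans ltp) // leqW.
  have := cell' c1 c2 0; rewrite ltnNge hi2 /= c1E ltp posK // /w /= mulr1 add0r.
  have -> : (c2 == pos i :> nat) = false.
    by apply/negbTE; rewrite neq_ltn (leq_trans ltp hi2) orbT.
  rewrite mul0r addr0 /extra big1 ?addr0 // => r _.
  rewrite !mxE; case: ifP => i0G; first by rewrite h0 ?mulr0.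
  rewrite f0 ?i0G //= /hits c1E ltnNge ltsA orbF.
  have -> : (pos i == a) = false by apply/negbTE; rewrite neq_ltn (leq_trans ltp).
  by rewrite !mul0r.
have x_high i (c1 : 'I_A) : i \in G -> (s <= c1)%N -> x i c1 = 0.
  move=> iG hi1; have ltp := pos_lt iG.
  pose c2 : 'I_B := inord (pos i).
  have c2E : c2 = pos i :> nat by rewrite inordK // (leq_trans ltp) // leqW.
  have := cell' c1 c2 0; rewrite extra_low c2E ?ltp // ltnNge hi1 /= posK //.
  by rewrite /w /= mulr1 !addr0.
have low_pair i i' : i \in G -> i' \in G -> i != i' ->
    x i' (inord (pos i)) = 0 /\ z i (inord (pos i')) = 0.
  move=> iG iG' ne; have ltp := pos_lt iG; have ltp' := pos_lt iG'.
  pose c1 : 'I_A := inord (pos i); pose c2 : 'I_B := inord (pos i').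
  have c1E : c1 = pos i :> nat by rewrite inordK // (leq_trans ltp) // leqW.
  have c2E : c2 = pos i' :> nat by rewrite inordK // (leq_trans ltp') // leqW.
  apply: (w_indep i' i); first by rewrite eq_sym.
  move=> l; have := cell' c1 c2 l; rewrite extra_low c2E ?ltp' // c1E ltp !posK //.
  have -> : (pos i' == pos i) = false.
    by apply: contraNF ne => /eqP E1; rewrite -(posK iG) -(posK iG') E1.
  by rewrite mul0r !addr0.
have xz : x = 0.
  apply/matrixP => i c; rewrite mxE; have [iG|iG] := boolP (i \in G); last by rewrite x0 ?iG.
  have [hi|lt] := leqP s c; first exact: x_high.
  have [Ei|ne] := eqVneq (at_pos c) i; first by rewrite x0 // -Ei at_posK ?eqxx ?orbT.
  have [+ _] := low_pair (at_pos c) i (at_pos_in lt) iG ne.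
  by rewrite at_posK // inord_val.
have zz : z = 0.
  apply/matrixP => i c; rewrite mxE; have [iG|iG] := boolP (i \in G); last by rewrite z0 ?iG.
  have [hi|lt] := leqP s c; first exact: z_high.
  have [Ei|ne] := eqVneq i (at_pos c); first by rewrite z0 // {2}Ei at_posK ?eqxx ?orbT.
  have [_] := low_pair i (at_pos c) iG (at_pos_in lt) ne.
  by rewrite at_posK // inord_val.
split=> //.
  apply/matrixP => i l; rewrite mxE; have [iG|iG] := boolP (i \in G); last exact: host0.
  have ltp := pos_lt iG.
  pose c1 : 'I_A := inord (pos i); pose c2 : 'I_B := inord (pos i).
  have c1E : c1 = pos i :> nat by rewrite inordK // (leq_trans ltp) // leqW.
  have c2E : c2 = pos i :> nat by rewrite inordK // (leq_trans ltp) // leqW.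
  have := cell' c1 c2 l; rewrite extra_low c2E ?ltp // c1E ltp posK // xz zz !mxE.
  by rewrite eqxx !mul0r mul1r !add0r addr0.
apply/matrixP => r l; rewrite mxE.
have [i0G|i0G] := boolP (i0 \in G).
  have ltp := pos_lt i0G; pose c1 : 'I_A := inord (pos i0).
  have c1E : c1 = pos i0 :> nat by rewrite inordK // (leq_trans ltp) // leqW.
  have := cell' c1 (col r) l; rewrite ltnNge col_high //= extra_col zz !mxE i0G c1E ltp eqxx.
  have -> : (col r == pos i0 :> nat) = false.
    by apply/negbTE; rewrite neq_ltn (leq_trans ltp (col_high _ _)) // orbT.
  by rewrite !mul0r !add0r mul1r.
have := cell' ord_max (col r) l; rewrite extra_col !ltnNge col_high //= ltsA /= !add0r mxE.
by rewrite (negPf i0G) f0 // /hits /= eqxx mul1r.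
Qed.

End Block.

Section GenericBlock.
Variable F : numFieldType.

(** This projection turns conditions [x i j = 0] into a linear parametrization of their solutions,
    the form that [generic_inj] expects from [mu]. *)
Definition zero_at m n (P : 'I_m -> 'I_n -> bool) (x : 'M[F]_(m, n)) : 'M[F]_(m, n) :=
  \matrix_(i, j) if P i j then 0 else x i j.

Lemma zero_at_linear m n (P : 'I_m -> 'I_n -> bool) c (x y : 'M[F]_(m, n)) :
  zero_at P (c *: x + y) = c *: zero_at P x + zero_at P y.
Proof. by apply/matrixP => i j; rewrite !mxE; case: (P i j); rewrite ?mulr0 ?addr0. Qed.

Lemma zero_at_id m n (P : 'I_m -> 'I_n -> bool) (x : 'M[F]_(m, n)) :
  (forall i j, P i j -> x i j = 0) -> zero_at P x = x.
Proof.
by move=> H; apply/matrixP => i j; rewrite !mxE; case: ifP => // /H ->.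
Qed.

Lemma polymx_tcoord (T : lmodType F) A B C (g : T -> 'rV[F]_(A * B * C)) :
  (forall i j l, polyf (fun t => tcoord i j l (g t))) -> polymx g.
Proof.
move=> pg i t; rewrite (ord1 i).
by case/mxvec_indexP: t => ij l; case/mxvec_indexP: ij => p q; apply: pg.
Qed.

Lemma polymx_tangent_sum (T : lmodType F) k R A B C (u : T -> 'M[F]_(k, A))
    (v : T -> 'M[F]_(k, B)) (w : T -> 'M[F]_(k, C)) (v' : T -> 'M[F]_(R, B)) i0 x z o h :
  polymx u -> polymx v -> polymx w -> polymx v' ->
  polymx (fun t => tangent_sum (u t) (v t) (w t) (v' t) i0 x z o h).
Proof.
move=> pu pv pw pv'; apply: polymx_tcoord => i j l.
apply: polyf_ext => [t|]; first by rewrite tcoord_tangent_sum.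
by apply: polyf_add; apply: polyf_sum => e; do ![apply: polyf_add | apply: polyf_mul |
  apply: polyf_const | apply: pu | apply: pv | apply: pw | apply: pv'].
Qed.

Lemma tangent_sum_linear k R A B C (u : 'M[F]_(k, A)) (v : 'M[F]_(k, B))
    (w : 'M[F]_(k, C)) (v' : 'M[F]_(R, B)) i0 c x z o h x' z' o' h' :
  tangent_sum u v w v' i0 (c *: x + x') (c *: z + z') (c *: o + o') (c *: h + h') =
  c *: tangent_sum u v w v' i0 x z o h + tangent_sum u v w v' i0 x' z' o' h'.
Proof.
apply: tcoordP => i j l; rewrite linearP /= !tcoord_tangent_sum /=.
rewrite [in RHS]/GRing.scale /= mulrDr addrACA !mulr_sumr -!big_split /=.
congr (_ + _); apply: eq_bigr => e _; rewrite !mxE; ring.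
Qed.

Lemma generic_block a b k R (G : {set 'I_k}) (i0 : 'I_k) :
  (#|G| <= a)%N -> (#|G| + R <= b)%N ->
  (k - #|G| + R <= (a.+1 - #|G|) * (b.+1 - #|G|) +
     #|G|./2 * (a.+1 - #|G| + (b.+1 - #|G|)))%N ->
  generic (fun y : 'M[F]_(k, a.+1) * 'M[F]_(k, b.+1) * 'M[F]_(R, b.+1) =>
    {in G, forall i, y.1.1 i (inord (pos G i)) * y.1.2 i (inord (pos G i)) != 0} /\
    forall (x : 'M_(k, a.+1)) (z : 'M_(k, b.+1)) (o : 'M_(k, 2)) (h : 'M_(R, 2)),
    (forall i (c : 'I_a.+1), (i \notin G) || (c == pos G i :> nat) -> x i c = 0) ->
    (forall i (c : 'I_b.+1), (i \notin G) || (c == pos G i :> nat) -> z i c = 0) ->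
    (i0 \in G -> forall r, h r 0 = 0) ->
    tangent_sum y.1.1 y.1.2 (block_w F G) y.2 i0 x z o h = 0 ->
    [/\ x = 0, z = 0, o = 0 & h = 0]).
Proof.
move=> ga gb gab.
have [|u [v [v' [uv1 inj0]]]] := block_special F i0 ga gb.
  by apply: leq_trans gab _; apply: (card_slots ga gb).
have pu : polymx (fun y : 'M[F]_(k, a.+1) * 'M[F]_(k, b.+1) * 'M[F]_(R, b.+1) => y.1.1).
  by move=> i j; apply: polyf_scalar => d x y; rewrite !mxE.
have pv : polymx (fun y : 'M[F]_(k, a.+1) * 'M[F]_(k, b.+1) * 'M[F]_(R, b.+1) => y.1.2).
  by move=> i j; apply: polyf_scalar => d x y; rewrite !mxE.
have pv' : polymx (fun y : 'M[F]_(k, a.+1) * 'M[F]_(k, b.+1) * 'M[F]_(R, b.+1) => y.2).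
  by move=> i j; apply: polyf_scalar => d x y; rewrite !mxE.
apply: generic_and.
  apply: generic_sub (generic_all (P := fun i (y : 'M[F]_(k, a.+1) * 'M[F]_(k, b.+1) * 'M[F]_(R, b.+1)) =>
    (i \in G) ==> (y.1.1 i (inord (pos G i)) * y.1.2 i (inord (pos G i)) != 0)) _).
    by move=> y H i iG; have := H i; rewrite iG.
  move=> i; case: (boolP (i \in G)) => iG /=; last by apply: generic_true.
  apply: (generic_neq0 (t0 := (u, v, v'))).
    by apply: polyf_mul; [apply: pu | apply: pv].
  by have [/= -> ->] := uv1 i iG; rewrite mulr1 oner_neq0.
pose V := ('M[F]_(k, a.+1) * 'M[F]_(k, b.+1) * 'M[F]_(k, 2) * 'M[F]_(R, 2))%type.
pose mx := fun (i : 'I_k) (c : 'I_a.+1) => (i \notin G) || (c == pos G i :> nat).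
pose mz := fun (i : 'I_k) (c : 'I_b.+1) => (i \notin G) || (c == pos G i :> nat).
pose mh := fun (r : 'I_R) (l : 'I_2) => (i0 \in G) && (l == 0).
pose mu (t : V) : V := (zero_at mx t.1.1.1, zero_at mz t.1.1.2, t.1.2, zero_at mh t.2).
pose phi (y : 'M[F]_(k, a.+1) * 'M[F]_(k, b.+1) * 'M[F]_(R, b.+1)) (t : V) :=
  tangent_sum y.1.1 y.1.2 (block_w F G) y.2 i0 t.1.1.1 t.1.1.2 t.1.2 t.2.
have zero_at0 m n (P : 'I_m -> 'I_n -> bool) (x : 'M[F]_(m, n)) i j : P i j -> zero_at P x i j = 0.
  by move=> Pij; rewrite mxE Pij.
apply: generic_sub (generic_inj (mu := mu) (phi := phi) (t0 := (u, v, v')) _ _ _ _).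
- move=> y H x z o h hx hz hh E.
  have hh' i l : mh i l -> h i l = 0 by case/andP=> iG /eqP ->; apply: hh.
  have Emu : mu (x, z, o, h) = (x, z, o, h) by rewrite /mu /= !zero_at_id.
  by have := H (x, z, o, h); rewrite Emu => /(_ E) [-> -> -> ->].
- by move=> d t t'; rewrite /mu /= !zero_at_linear.
- by move=> y d t t'; rewrite /phi /= tangent_sum_linear.
- move=> t; apply: polymx_tangent_sum => //; exact: polymx_const.
- move=> t E; have [|||ex ez eo eh] := inj0 _ _ _ _ _ _ _ E.
  + by move=> i j ij; apply: zero_at0.
  + by move=> i j ij; apply: zero_at0.
  + by move=> iG r; apply: zero_at0; rewrite /mh iG.
  + by move: ex ez eo eh; rewrite /mu /= => -> -> -> ->.
Qed.

End GenericBlock.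

(** * Sums of tangent spaces at general points *)

Section TangentSpan.
Variable F : numFieldType.

Definition slice A B C (q : 'rV[F]_(A * B)) (e : 'rV[F]_C) : 'rV[F]_(A * B * C) :=
  mxvec (q^T *m e).

Lemma tcoord_slice A B C (q : 'rV[F]_(A * B)) (e : 'rV[F]_C) i j l :
  tcoord i j l (slice q e) = q 0 (mxvec_index i j) * e 0 l.
Proof. by rewrite /tcoord /slice mxvecE mxE big_ord1 mxE. Qed.

Lemma tensor_slice A B C (u : 'rV[F]_A) (v : 'rV[F]_B) (w : 'rV[F]_C) :
  tensor u v w = slice (mxvec (u^T *m v)) w.
Proof. by []. Qed.

Lemma slice_linearl A B C a (q q' : 'rV[F]_(A * B)) (e : 'rV[F]_C) :
  slice (a *: q + q') e = a *: slice q e + slice q' e.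
Proof. by rewrite /slice !linearP /= mulmxDl -scalemxAl linearP. Qed.

Variables (k A B C : nat).
Implicit Types (u : 'M[F]_(k, A)) (v : 'M[F]_(k, B)) (w : 'M[F]_(k, C)).

Definition in_tangents u v w (t : 'rV[F]_(A * B * C)) : Prop :=
  exists x z o, t = \sum_i (tensor (row i x) (row i v) (row i w) +
    tensor (row i u) (row i z) (row i w) + tensor (row i u) (row i v) (row i o)).

Lemma in_tangents_lin u v w a t t' :
  in_tangents u v w t -> in_tangents u v w t' -> in_tangents u v w (a *: t + t').
Proof.
move=> [x [z [o ->]]] [x' [z' [o' ->]]].
exists (a *: x + x'), (a *: z + z'), (a *: o + o').
rewrite scaler_sumr -big_split; apply: eq_bigr => e _; apply: tcoordP => i j l.
by rewrite !(linearD, linearZ) /= !tcoord_tensor !mxE /GRing.scale /=; ring.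
Qed.

Lemma in_tangents0 u v w : in_tangents u v w 0.
Proof.
exists 0, 0, 0; apply: tcoordP => i j l; rewrite raddf0 linear_sum /= big1 // => e _.
by rewrite !linearD /= !tcoord_tensor !mxE; ring.
Qed.

Lemma in_tangents_sum u v w n (t : 'I_n -> 'rV[F]_(A * B * C)) :
  (forall i, in_tangents u v w (t i)) -> in_tangents u v w (\sum_i t i).
Proof.
move=> H; elim/big_rec: _ => [|i x _ IH]; first exact: in_tangents0.
by rewrite -[t i]scale1r; apply: in_tangents_lin.
Qed.

Lemma in_tangents_sub u v w t t' :
  in_tangents u v w t -> in_tangents u v w t' -> in_tangents u v w (t - t').
Proof.
by move=> h h'; rewrite addrC -scaleN1r; apply: in_tangents_lin.
Qed.

Lemma in_tangents1 u v w i x z o :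
  in_tangents u v w (tensor x (row i v) (row i w) + tensor (row i u) z (row i w) +
                     tensor (row i u) (row i v) o).
Proof.
exists (\matrix_(j, p) ((j == i)%:R * x 0 p)), (\matrix_(j, p) ((j == i)%:R * z 0 p)),
  (\matrix_(j, p) ((j == i)%:R * o 0 p)).
apply: tcoordP => p q l; rewrite !linearD linear_sum /= (bigD1 i) //= big1 => [|e /negPf ne].
  by rewrite !linearD /= !tcoord_tensor !mxE eqxx mulr1n; ring.
by rewrite !linearD /= !tcoord_tensor !mxE ne mulr0n; ring.
Qed.

(* The k-fold indeterminacy in the presentation of a sum of tangent vectors
   allows to prescribe zero entries. *)
Lemma in_tangents_normal u v w (p : 'I_k -> 'I_A) (p' : 'I_k -> 'I_B) t :
  (forall i, u i (p i) != 0) -> (forall i, v i (p' i) != 0) ->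
  in_tangents u v w t ->
  exists (x : 'M[F]_(k, A)) (z : 'M[F]_(k, B)) (o : 'M[F]_(k, C)),
  [/\ forall i, x i (p i) = 0, forall i, z i (p' i) = 0 &
    t = \sum_i (tensor (row i x) (row i v) (row i w) +
    tensor (row i u) (row i z) (row i w) + tensor (row i u) (row i v) (row i o))].
Proof.
move=> u0 v0 [x [z [o ->]]].
pose al i := x i (p i) / u i (p i); pose be i := z i (p' i) / v i (p' i).
exists (\matrix_(i, j) (x i j - al i * u i j)), (\matrix_(i, j) (z i j - be i * v i j)),
  (\matrix_(i, j) (o i j + (al i + be i) * w i j)); split.
- by move=> i; rewrite !mxE /al divfK // subrr.
- by move=> i; rewrite !mxE /be divfK // subrr.
apply: eq_bigr => i _; apply: tcoordP => i1 i2 i3.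
by rewrite !linearD /= !tcoord_tensor !mxE; ring.
Qed.

End TangentSpan.

(** * Assembling the planes of the last factor *)

Section Configuration.
Variables (F : numFieldType) (a b c k R q : nat) (i0 : 'I_k).
Local Notation A := a.+1.
Local Notation B := b.+1.
Local Notation C := c.+1.

Definition group l : {set 'I_k} := [set i : 'I_k | i %% q == l]%N.

Hypothesis (q0 : (0 < q)%N) (qc : (q.*2 <= c)%N).
Hypothesis group_small : forall l, (l < q)%N ->
  [/\ (#|group l| <= a)%N, (#|group l| + R <= b)%N &
  (k - #|group l| + R <= (A - #|group l|) * (B - #|group l|) +
     #|group l|./2 * (A - #|group l| + (B - #|group l|)))%N].
Hypothesis (leRb : (R <= b)%N) (kRAB : (k + R <= A * B)%N).

(** On the board of its own class the i-th point sits at this coordinate, so [u_i] and [v_i] do not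
    vanish there; [in_tangents_normal] asks for such entries. *)
Definition pivot (n : nat) (i : 'I_k) : 'I_n.+1 := inord (pos (group (i %% q)%N) i).

(** A coordinate where the special [w_i0] is 1. As the vectors [u_i0 v'_r w_i0] are tangent, [h] is
    only determined modulo [w_i0]; requiring [h r wpivot = 0] removes this freedom. *)
Definition wpivot : 'I_C := inord (i0 %% q)%N.*2.

(* The i-th vector is [e_2l + i e_(2l+1)] with [l = i mod q]: the last factor
   splits into [q] planes, one for each residue class, and a coordinate
   [ord_max] that no point uses. *)
Definition base_w : 'M[F]_(k, C) :=
  \matrix_(i, l) if l == (i %% q)%N.*2 :> nat then 1
                 else if l == (i %% q)%N.*2.+1 :> nat then i%:R else 0.

(** In a coordinate of W where all [w_i] vanish, [tangent_sum] reduces to a combination of these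
    rows with entries of [o] and [h] as coefficients. *)
Definition pairs_mx (u : 'M[F]_(k, A)) (v : 'M[F]_(k, B)) (v' : 'M[F]_(R, B)) :
    'M[F]_(k + R, A * B) :=
  col_mx (\matrix_i mxvec ((row i u)^T *m row i v))
         (\matrix_r mxvec ((row i0 u)^T *m row r v')).

Lemma pairs_mxE u v v' (x : 'rV[F]_(k + R)) i j :
  (x *m pairs_mx u v v') 0 (mxvec_index i j) =
  \sum_e u e i * v e j * x 0 (lshift R e) + \sum_r u i0 i * v' r j * x 0 (rshift k r).
Proof.
rewrite -[x in LHS]hsubmxK mul_row_col !mxE; congr (_ + _); apply: eq_bigr => e _.
  by rewrite !mxE mxvecE !mxE big_ord1 !mxE mulrC.
by rewrite !mxE mxvecE !mxE big_ord1 !mxE mulrC.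
Qed.

(** In the coordinates of the l-th plane only the points of class l have a nonzero [w], so the
    relation becomes that of [generic_block] for [group l], to which the other points contribute
    through [o] alone. Each block is injective for general (u, v, v'), hence one choice serves all.
    In the remaining coordinates no [w] is left, and the pairs are independent of each other (the
    block of the empty group) and of [Q]. *)
Lemma exists_configuration :
  exists (u : 'M[F]_(k, A)) (v : 'M[F]_(k, B)) (v' : 'M[F]_(R, B)),
  [/\ forall i, u i (pivot a i) * v i (pivot b i) != 0,
      row_free (pairs_mx u v v') &
  forall (Q : 'M[F]_(A * B)) (x : 'M_(k, A)) (z : 'M_(k, B)) (o : 'M_(k, C))
      (h : 'M_(R, C)) (t : 'rV[F]_(A * B)),
    (pairs_mx u v v' :&: Q)%MS = 0 ->
    (forall i, x i (pivot a i) = 0) -> (forall i, z i (pivot b i) = 0) ->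
    (forall r, h r wpivot = 0) ->
    tangent_sum u v base_w v' i0 x z o h + slice (t *m Q) (delta_mx 0 ord_max) = 0 ->
    [/\ x = 0, z = 0, o = 0, h = 0 & t *m Q = 0]].
Proof.
have gen0 : generic (fun y : 'M[F]_(k, A) * 'M[F]_(k, B) * 'M[F]_(R, B) =>
    forall (o : 'M_(k, 2)) (h : 'M_(R, 2)),
    tangent_sum y.1.1 y.1.2 (0 : 'M_(k, 2)) y.2 i0 0 0 o h = 0 -> o = 0 /\ h = 0).
  apply: generic_sub (@generic_block F a b k R set0 i0 _ _ _).
  - move=> y [_ H] o h E.
    case: (H 0 0 o h) => //; try by move=> *; rewrite mxE.
      by rewrite inE.
    have -> : block_w F set0 = 0 :> 'M_(k, 2) by apply/matrixP => i j; rewrite !mxE inE.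
    exact: E.
  - by rewrite cards0.
  - by rewrite cards0.
  - by rewrite cards0 !subn0 addn0.
have gen (l : 'I_q) := let: And3 h1 h2 h3 := group_small (ltn_ord l) in
   generic_block F i0 h1 h2 h3.
have /generic_ex[[[u v] v'] /= [inj0 injl]] := generic_and gen0 (generic_all gen).
exists u, v, v'.
have ltq i : (i %% q < q)%N by rewrite ltn_mod.
have free : row_free (pairs_mx u v v').
  rewrite -kermx_eq0; apply/rowV0P => x /sub_kermxP Ex.
  pose o : 'M[F]_(k, 2) := \matrix_(i, j) x 0 (lshift R i).
  pose h : 'M[F]_(R, 2) := \matrix_(i, j) x 0 (rshift k i).
  have [|o0 h0] := inj0 o h.
    apply: tcoordP => i j l; rewrite tcoord_tangent_sum raddf0.
    have := congr1 (fun y : 'rV_(A * B) => y 0 (mxvec_index i j)) Ex.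
    rewrite pairs_mxE mxE => E0; rewrite -[RHS]E0; congr (_ + _); apply: eq_bigr => e _.
      by rewrite !mxE; ring.
    by rewrite !mxE.
  rewrite -[x]hsubmxK; have -> : lsubmx x = 0.
    apply/rowP => e; have := congr1 (fun y : 'M_(k, 2) => y e 0) o0.
    by rewrite !mxE.
  have -> : rsubmx x = 0; last exact: row_mx0.
  apply/rowP => e; have := congr1 (fun y : 'M_(R, 2) => y e 0) h0.
  by rewrite !mxE.
split=> //.
  move=> i; have [H _] := injl (Ordinal (ltq i)).
  by apply: H; rewrite inE.
move=> Q x z o h t QP x0 z0 h0 E.
pose bi (l : nat) (e : 'I_2) : 'I_C := inord (l.*2 + e).
have biE l e : (l < q)%N -> bi l e = (l.*2 + e)%N :> nat.
  by move=> lq; rewrite inordK //; have := ltn_ord e; have := qc; lia.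
have block l : (l < q)%N -> [/\ forall i p, i \in group l -> x i p = 0,
    forall i p, i \in group l -> z i p = 0, forall i e, o i (bi l e) = 0 &
    forall r e, h r (bi l e) = 0].
  move=> lq; have [_ H] := injl (Ordinal lq).
  pose xl : 'M[F]_(k, A) := \matrix_(i, p) if i \in group l then x i p else 0.
  pose zl : 'M[F]_(k, B) := \matrix_(i, p) if i \in group l then z i p else 0.
  pose ol : 'M[F]_(k, 2) := \matrix_(i, e) o i (bi l e).
  pose hl : 'M[F]_(R, 2) := \matrix_(i, e) h i (bi l e).
  have [||||ex ez eo eh] := H xl zl ol hl.
  - move=> i p; rewrite mxE; case: ifP => //= iG /eqP Ep.
    rewrite -[RHS](x0 i); congr (x _ _); have il : (i %% q)%N = l.
      by move: iG; rewrite inE => /eqP.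
    by rewrite /pivot il -Ep inord_val.
  - move=> i p; rewrite mxE; case: ifP => //= iG /eqP Ep.
    rewrite -[RHS](z0 i); congr (z _ _); have il : (i %% q)%N = l.
      by move: iG; rewrite inE => /eqP.
    by rewrite /pivot il -Ep inord_val.
  - move=> iG r; rewrite mxE -[RHS](h0 r); congr (h _ _); rewrite /bi /wpivot.
    by move: iG; rewrite inE addn0 => /eqP ->.
  - apply: tcoordP => i j e; rewrite tcoord_tangent_sum raddf0.
    have := congr1 (tcoord i j (bi l e)) E.
    rewrite raddf0 linearD /= tcoord_tangent_sum tcoord_slice.
    have -> : (delta_mx 0 ord_max : 'rV[F]_C) 0 (bi l e) = 0.
      rewrite mxE /= -val_eqE /= biE //; have := ltn_ord e; have := qc.
      by case: eqP => //; lia.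
    rewrite mulr0 addr0 => E0; rewrite -[RHS]E0; congr (_ + _); apply: eq_bigr => i' _.
      rewrite !mxE !biE //; case: ifP => iG.
        move: iG; rewrite inE => /eqP ->; case: (e) => -[|[|//]] ? /=.
          by rewrite addn0 eqxx.
        by rewrite addn1 gtn_eqF // eqxx.
      have ni : (i' %% q)%N != l by move: iG; rewrite inE => ->.
      have lt2 := ltn_ord e; rewrite !ifF ?mulr0 ?mul0r //.
        by apply/negbTE; move: (i' %% q)%N (nat_of_ord e) ni lt2 => m n; lia.
      by apply/negbTE; move: (i' %% q)%N (nat_of_ord e) ni lt2 => m n; lia.
    by rewrite !mxE.
  split=> [i p iG|i p iG|i e|r e].
  - by have := congr1 (fun y : 'M_(_, _) => y i p) ex; rewrite !mxE iG.
  - by have := congr1 (fun y : 'M_(_, _) => y i p) ez; rewrite !mxE iG.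
  - by have := congr1 (fun y : 'M_(_, _) => y i e) eo; rewrite !mxE.
  - by have := congr1 (fun y : 'M_(_, _) => y r e) eh; rewrite !mxE.
have xz : x = 0.
  apply/matrixP => i p; rewrite mxE; have [-> //] := block _ (ltq i).
  by rewrite inE.
have zz : z = 0.
  apply/matrixP => i p; rewrite mxE; have [_ -> //] := block _ (ltq i).
  by rewrite inE.
have rest (l : 'I_C) : (q.*2 <= l)%N ->
    [/\ forall i, o i l = 0, forall r, h r l = 0 & (l == ord_max) -> t *m Q = 0].
  move=> ql; pose y : 'rV[F]_(k + R) := row_mx (\row_i o i l) (\row_r h r l).
  have E0 : y *m pairs_mx u v v' + (l == ord_max)%:R *: (t *m Q) = 0.
    apply/rowP => ij; case/mxvec_indexP: ij => i j.
    have := congr1 (tcoord i j l) E.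
    rewrite raddf0 linearD /= tcoord_tangent_sum tcoord_slice xz zz => E1.
    rewrite [RHS]mxE -[RHS]E1 mxE pairs_mxE; congr (_ + _ + _).
    - by apply: eq_bigr => e _; rewrite row_mxEl !mxE; ring.
    - by apply: eq_bigr => e _; rewrite row_mxEr !mxE.
    - by rewrite !mxE mulrC.
  have y0 : y *m pairs_mx u v v' = 0.
    apply/eqP; rewrite -submx0 -QP sub_capmx submxMl /=.
    move/eqP: E0; rewrite addr_eq0 => /eqP ->; rewrite eqmx_opp.
    by apply: scalemx_sub; apply: submxMl.
  have /eqP y00 : y == 0 by rewrite -(mulmx_free_eq0 _ free) y0.
  split=> [i|r|lm].
  - have := congr1 (fun w : 'rV_(k + R) => w 0 (lshift R i)) y00.
    by rewrite row_mxEl !mxE.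
  - have := congr1 (fun w : 'rV_(k + R) => w 0 (rshift k r)) y00.
    by rewrite row_mxEr !mxE.
  - by move: E0; rewrite y0 add0r lm scale1r.
have low l : (l < q.*2)%N -> exists l' e, (l' < q)%N /\ inord l = bi l' e.
  move=> lq; exists l./2, (inord (odd l)); split; first by lia.
  rewrite /bi inordK; last by case: (odd l).
  by rewrite addnC odd_double_half.
split=> //.
- apply/matrixP => i l; rewrite mxE; have [ql|lq] := leqP q.*2 l.
    by have [-> _] := rest l ql.
  have [l' [e [l'q]]] := low l lq; rewrite inord_val => ->.
  by have [_ _ -> _] := block l' l'q.
- apply/matrixP => i l; rewrite mxE; have [ql|lq] := leqP q.*2 l.
    by have [_ -> _] := rest l ql.
  have [l' [e [l'q]]] := low l lq; rewrite inord_val => ->.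
  by have [_ _ _ ->] := block l' l'q.
- by have [_ _ ->] := rest ord_max qc.
Qed.

(* With [S] the span of the tangent spaces: [t (x) e] lies in [S] only for [t] in
   the span of the [u_i (x) v_i]; [S] meets [u_i0 (x) V' (x) W] in
   [u_i0 (x) V' (x) w_i0], for some [V'] of dimension [R]; and the codimension of
   [S] is large. *)
Definition separated (y : 'M[F]_(k, A) * 'M[F]_(k, B) * 'M[F]_(k, C)) : Prop :=
  let u := y.1.1 in let v := y.1.2 in let w := y.2 in
  [/\ forall t : 'rV_(A * B), in_tangents u v w (slice t (delta_mx 0 ord_max)) ->
        exists x : 'rV_k, t = \sum_i x 0 i *: mxvec ((row i u)^T *m row i v),
      exists v' : 'M_(R, B), forall h : 'M_(R, C),
        in_tangents u v w (\sum_r tensor (row i0 u) (row r v') (row r h)) ->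
        forall r, exists d, row r h = d *: row i0 w &
      exists Q : 'M_(A * B), (A * B <= k + R + \rank Q)%N /\ forall t : 'rV_(A * B),
        in_tangents u v w (slice (t *m Q) (delta_mx 0 ord_max)) -> t *m Q = 0].

Lemma polymx_pairs (v' : 'M[F]_(R, B)) :
  polymx (fun y : 'M[F]_(k, A) * 'M[F]_(k, B) * 'M[F]_(k, C) => pairs_mx y.1.1 y.1.2 v').
Proof.
move=> i ij; case/mxvec_indexP: ij => p q'.
have pu : polymx (fun y : 'M[F]_(k, A) * 'M[F]_(k, B) * 'M[F]_(k, C) => y.1.1).
  by move=> ? ?; apply: polyf_scalar => d x y; rewrite !mxE.
have pv : polymx (fun y : 'M[F]_(k, A) * 'M[F]_(k, B) * 'M[F]_(k, C) => y.1.2).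
  by move=> ? ?; apply: polyf_scalar => d x y; rewrite !mxE.
case: (split_ordP i) => j ->.
  apply: polyf_ext (polyf_mul (pu j p) (pv j q')) => y.
  by rewrite col_mxEu mxE mxvecE mxE big_ord1 !mxE.
apply: polyf_ext (polyf_mul (pu i0 p) (polyf_const _ (v' j q'))) => y.
by rewrite col_mxEd mxE mxvecE mxE big_ord1 !mxE.
Qed.

(** The three properties have one source: injectivity of [phi] on normalized data, which spreads
    from the special configuration by [generic_inj]. *)
Lemma generic_separated : generic separated.
Proof.
have [u0 [v0 [v' [piv0 free0 inj0]]]] := exists_configuration.
set P0 := pairs_mx u0 v0 v' in free0 inj0; pose Q : 'M[F]_(A * B) := (P0^C)%MS.
pose e : 'rV[F]_C := delta_mx 0 ord_max.
pose T := ('M[F]_(k, A) * 'M[F]_(k, B) * 'M[F]_(k, C))%type.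
pose y0 : T := (u0, v0, base_w).
pose V := ('M[F]_(k, A) * 'M[F]_(k, B) * 'M[F]_(k, C) * 'M[F]_(R, C) * 'rV[F]_(A * B))%type.
pose mx := fun (i : 'I_k) (j : 'I_A) => j == pivot a i.
pose mz := fun (i : 'I_k) (j : 'I_B) => j == pivot b i.
pose mh := fun (r : 'I_R) (l : 'I_C) => l == wpivot.
pose mu (t : V) : V :=
  (zero_at mx t.1.1.1.1, zero_at mz t.1.1.1.2, t.1.1.2, zero_at mh t.1.2, t.2 *m Q).
pose phi (y : T) (t : V) :=
  tangent_sum y.1.1 y.1.2 y.2 v' i0 t.1.1.1.1 t.1.1.1.2 t.1.1.2 t.1.2 + slice t.2 e.
have pu : polymx (fun y : T => y.1.1) by move=> ? ?; apply: polyf_scalar => d x y; rewrite !mxE.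
have pv : polymx (fun y : T => y.1.2) by move=> ? ?; apply: polyf_scalar => d x y; rewrite !mxE.
have pw : polymx (fun y : T => y.2) by move=> ? ?; apply: polyf_scalar => d x y; rewrite !mxE.
have injective : generic (fun y => forall t, phi y (mu t) = 0 -> mu t = 0).
  apply: (generic_inj (t0 := y0)).
  - by move=> d t t'; rewrite /mu /= !zero_at_linear mulmxDl -scalemxAl.
  - move=> y d t t'; rewrite /phi /= tangent_sum_linear slice_linearl.
    by rewrite addrACA -scalerDr.
  - move=> t; apply: polymx_add; last exact: polymx_const.
    by apply: polymx_tangent_sum => //; apply: polymx_const.
  - move=> t E; have [|||| ex ez eo eh eq] := inj0 Q _ _ _ _ _ _ _ _ _ E.
    + exact: capmx_compl.
    + by move=> i; rewrite mxE /mx eqxx.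
    + by move=> i; rewrite mxE /mz eqxx.
    + by move=> r; rewrite mxE /mh eqxx.
    + by move: ex ez eo eh eq; rewrite /mu /= => -> -> -> -> ->.
have pivots : generic (fun y : T => forall i, y.1.1 i (pivot a i) * y.1.2 i (pivot b i) != 0).
  apply: generic_all => i; apply: (generic_neq0 (t0 := y0)); last exact: piv0.
  by apply: polyf_mul.
have wpiv : generic (fun y : T => y.2 i0 wpivot != 0).
  apply: (generic_neq0 (t0 := y0)) => //.
  have lt : ((i0 %% q)%N.*2 < C)%N by have := ltn_pmod i0 q0; have := qc; lia.
  by rewrite mxE inordK // eqxx oner_neq0.
(* [Q] complements the special pairs and stays fixed while the points vary; generically every [t] is
   still a combination of pairs plus a part in [Q]. *)
have spans : generic (fun y : T => row_full (col_mx (pairs_mx y.1.1 y.1.2 v') Q)).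
  apply: generic_sub (generic_rank (M := fun y : T => col_mx (pairs_mx y.1.1 y.1.2 v') Q) y0 _).
    move=> y le; rewrite /row_full eqn_leq rank_leq_col (leq_trans _ le) //.
    rewrite -addsmxE; have := addsmx_compl_full P0.
    by rewrite /row_full => /eqP ->.
  move=> i j; case: (split_ordP i) => i' ->.
    by apply: polyf_ext (polymx_pairs v' i' j) => y; rewrite col_mxEu.
  by apply: polyf_ext (polyf_const _ (Q i' j)) => y; rewrite col_mxEd.
apply: generic_sub (generic_and injective (generic_and pivots (generic_and wpiv spans))).
move=> [[u v] w] /= [inj [piv [wp /row_fullP[D Dspan]]]].
have pivu i : u i (pivot a i) != 0 by have := piv i; rewrite mulf_eq0 negb_or => /andP[].
have pivv i : v i (pivot b i) != 0 by have := piv i; rewrite mulf_eq0 negb_or => /andP[].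
(* The separation property that follows from the injectivity of [phi]. *)
have key (h : 'M_(R, C)) t : (forall r, h r wpivot = 0) ->
    in_tangents u v w (\sum_r tensor (row i0 u) (row r v') (row r h) + slice (t *m Q) e) ->
    h = 0 /\ t *m Q = 0.
  move=> h0 /(in_tangents_normal pivu pivv)[x [z [o [x0 z0 E]]]].
  have Emu : mu (x, z, o, - h, - t) = (x, z, o, - h, - t *m Q).
    rewrite /mu /= !zero_at_id // => i j /eqP ->; rewrite ?x0 ?z0 //.
    by rewrite mxE h0 oppr0.
  have := inj (x, z, o, - h, - t); rewrite Emu /phi /= => H.
  have {H} : (x, z, o, - h, - t *m Q) = 0 :> V.
    apply: H; rewrite mulNmx /tangent_sum -E.
    have -> : slice (- (t *m Q)) e = - slice (t *m Q) e.
      by rewrite /slice !linearN /= mulNmx linearN.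
    rewrite addrAC addrK -big_split /= big1 // => r _; apply: tcoordP => i j l.
    by rewrite linearD raddf0 /= !tcoord_tensor !mxE; ring.
  case=> _ _ _ /eqP h00 tQ; split; last by apply/eqP; rewrite -oppr_eq0 -mulNmx tQ.
  by apply/eqP; rewrite -oppr_eq0.
have tangent_w i z : in_tangents u v w (tensor (row i u) z (row i w)).
  have := in_tangents1 u v w i 0 z 0; congr in_tangents; apply: tcoordP => p p' l.
  by rewrite !linearD /= !tcoord_tensor !mxE; ring.
have tangent_o i o : in_tangents u v w (tensor (row i u) (row i v) o).
  have := in_tangents1 u v w i 0 0 o; congr in_tangents; apply: tcoordP => p p' l.
  by rewrite !linearD /= !tcoord_tensor !mxE; ring.
have wp_max : (ord_max == wpivot) = false.
  rewrite -val_eqE /= inordK; have := ltn_pmod i0 q0; have := qc; last by lia.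
  by move=> h1 h2; apply/negbTE; lia.
have slice0 : slice (0 *m Q) e = 0 by rewrite mul0mx /slice linear0 mul0mx linear0.
split.
- move=> t Et; pose x := lsubmx (t *m D); pose y := rsubmx (t *m D).
  have Ex : t = x *m pairs_mx u v v' + y *m Q.
    by rewrite -mul_row_col hsubmxK -mulmxA Dspan mulmx1.
  (* The part of [t] along the [u_i0 v'_r] is carried by [h] in the coordinate [ord_max]. This is
     not [wpivot], so [key] applies and kills it together with the part in [Q]. *)
  pose h : 'M[F]_(R, C) := \matrix_(r, l) (x 0 (rshift k r) * e 0 l).
  have [||h0 yQ] := key h y.
  + by move=> r; rewrite !mxE /= eq_sym wp_max mulr0.
  + have -> : \sum_r tensor (row i0 u) (row r v') (row r h) + slice (y *m Q) e =
        slice t e - \sum_i tensor (row i u) (row i v) (x 0 (lshift R i) *: e).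
      apply: tcoordP => i j l; rewrite linearB linearD !linear_sum /= !tcoord_slice.
      have := congr1 (fun M : 'rV_(A * B) => M 0 (mxvec_index i j)) Ex.
      rewrite mxE pairs_mxE => ->; set s1 := (X in (X + _ + _) * _);
      set s2 := (X in (_ + X + _) * _).
      have -> : \sum_r tcoord i j l (tensor (row i0 u) (row r v') (row r h)) = s2 * e 0 l.
        by rewrite mulr_suml; apply: eq_bigr => r _; rewrite tcoord_tensor !mxE; ring.
      have -> : \sum_i' tcoord i j l (tensor (row i' u) (row i' v) (x 0 (lshift R i') *: e)) =
          s1 * e 0 l.
        by rewrite mulr_suml; apply: eq_bigr => r _; rewrite tcoord_tensor !mxE; ring.
      by ring.
    by apply: in_tangents_sub => //; apply: in_tangents_sum.
  exists (lsubmx x); rewrite Ex yQ addr0 -[x in LHS]hsubmxK mul_row_col.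
  have -> : rsubmx x = 0.
    apply/rowP => r; have := congr1 (fun M : 'M_(R, C) => M r ord_max) h0.
    by rewrite !mxE /= eqxx mulr1.
  rewrite mul0mx addr0 mulmx_sum_row; apply: eq_bigr => i _.
  by rewrite rowK.
- exists v' => h Eh r; pose d r := h r wpivot / w i0 wpivot.
  pose h' : 'M[F]_(R, C) := \matrix_(r, l) (h r l - d r * w i0 l).
  have [||h0 _] := key h' 0.
  + by move=> r'; rewrite mxE /d divfK // subrr.
  + rewrite slice0 addr0.
    have -> : \sum_r tensor (row i0 u) (row r v') (row r h') =
        \sum_r tensor (row i0 u) (row r v') (row r h) -
        \sum_r tensor (row i0 u) (d r *: row r v') (row i0 w).
      rewrite -sumrB; apply: eq_bigr => r' _; apply: tcoordP => i j l.
      by rewrite linearB /= !tcoord_tensor !mxE; ring.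
    by apply: in_tangents_sub => //; apply: in_tangents_sum.
  exists (d r); apply/rowP => l; apply/eqP; rewrite -subr_eq0 !mxE.
  by have := congr1 (fun M : 'M_(R, C) => M r l) h0; rewrite !mxE => ->.
- exists Q; split.
    by rewrite /Q mxrank_compl (eqP free0) subnKC.
  move=> t Et; have [||_ //] := key 0 t; first by move=> r; rewrite mxE.
  rewrite big1 => [|r _]; first by rewrite add0r; exact: Et.
  by apply: tcoordP => i j l; rewrite [RHS]raddf0 tcoord_tensor !mxE mulr0.
Qed.

End Configuration.

(** * Tangent spaces of the Segre variety *)

Section SegreTangent.
Variable F : numFieldType.

Definition dir_deriv n (f : {mpoly F[n]}) (p t : 'rV[F]_n) : F :=
  \sum_(i < n) meval_row (mderiv i f) p * t 0 i.

Lemma dir_derivD n (f g : {mpoly F[n]}) p t :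
  dir_deriv (f + g) p t = dir_deriv f p t + dir_deriv g p t.
Proof.
rewrite -big_split; apply: eq_bigr => i _.
by rewrite mderivD /meval_row mevalD mulrDl.
Qed.

Lemma dir_derivM n (f g : {mpoly F[n]}) p t : dir_deriv (f * g) p t =
  dir_deriv f p t * meval_row g p + meval_row f p * dir_deriv g p t.
Proof.
rewrite /dir_deriv [X in _ = X + _]mulr_suml [X in _ = _ + X]mulr_sumr -big_split.
apply: eq_bigr => i _ /=.
by rewrite mderivM /meval_row mevalD !mevalM; ring.
Qed.

Lemma dir_derivC n c (p t : 'rV[F]_n) : dir_deriv c%:MP p t = 0.
Proof. by apply: big1 => i _; rewrite mderivC /meval_row meval0 mul0r. Qed.

Lemma dir_derivX n j (p t : 'rV[F]_n) : dir_deriv 'X_j p t = t 0 j.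
Proof.
rewrite /dir_deriv (bigD1 j) //= big1 => [|i ne].
  rewrite mderivX mnm1E eqxx.
  have -> : (U_(j) - U_(j) = 0 :> 'X_{1..n})%MM by apply/mnmP => l; rewrite mnmBE mnm0E subnn.
  by rewrite scale1r mpolyX0 /meval_row meval1 mul1r addr0.
by rewrite mderivX mnm1E eq_sym (negPf ne) scale0r /meval_row meval0 mul0r.
Qed.

Lemma dir_deriv_lin n (f : {mpoly F[n]}) p a t t' :
  dir_deriv f p (a *: t + t') = a * dir_deriv f p t + dir_deriv f p t'.
Proof.
by rewrite /dir_deriv mulr_sumr -big_split; apply: eq_bigr => i _; rewrite !mxE /=; ring.
Qed.

Lemma dir_deriv0 n (f : {mpoly F[n]}) p : dir_deriv f p 0 = 0.
Proof. by apply: big1 => i _; rewrite mxE mulr0. Qed.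

Lemma dir_derivP n (f : {mpoly F[n]}) (p t : 'rV[F]_n) :
  exists P : {poly F}, (forall s, meval_row f (p + s *: t) = P.[s]) /\
    P^`().[0] = dir_deriv f p t.
Proof.
pose ok (f : {mpoly F[n]}) := exists P : {poly F},
  (forall s, meval_row f (p + s *: t) = P.[s]) /\ P^`().[0] = dir_deriv f p t.
have okC c : ok c%:MP.
  exists c%:P; split=> [s|]; first by rewrite /meval_row mevalC hornerC.
  by rewrite derivC horner0 dir_derivC.
have okM g h : ok g -> ok h -> ok (g * h).
  move=> [P [P1 P2]] [Q [Q1 Q2]]; exists (P * Q); split=> [s|].
    by rewrite /meval_row mevalM hornerM -P1 -Q1.
  have p0 : p = p + 0 *: t by rewrite scale0r addr0.
  by rewrite derivM hornerD !hornerM P2 Q2 dir_derivM -P1 -Q1 -p0.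
have okX j : ok 'X_j.
  exists ((p 0 j)%:P + t 0 j *: 'X); split=> [s|].
    by rewrite /meval_row mevalXU !mxE !hornerE mulrC.
  by rewrite derivD derivC derivZ derivX !hornerE dir_derivX.
rewrite -/(ok f); elim/mpolyind: f => [|c m g _ _ okg]; first by rewrite -mpolyC0.
have okm : ok 'X_[m].
  rewrite mpolyXE_id; elim/big_ind: _ => [|x y|i _]; first exact: (okC 1).
    exact: okM.
  elim: (m i) => [|e IH]; first exact: (okC 1).
  by rewrite exprS; apply: okM.
have [P [P1 P2]] : ok (c *: 'X_[m]) by rewrite -mul_mpolyC; apply: okM.
have [Q [Q1 Q2]] := okg.
exists (P + Q); split=> [s|]; first by rewrite hornerD -P1 -Q1 /meval_row mevalD.
by rewrite derivD hornerD P2 Q2 dir_derivD.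
Qed.

(** The restriction of [f] to the line vanishes off the finitely many roots of [L], hence
    identically. Exceptions must be allowed because [segre] admits only nonzero factors, and a line
    of products may pass through 0. *)
Lemma dir_deriv_eq0 n (f : {mpoly F[n]}) (p t : 'rV[F]_n) (L : {poly F}) :
  L != 0 -> (forall s, L.[s] != 0 -> meval_row f (p + s *: t) = 0) ->
  dir_deriv f p t = 0.
Proof.
move=> L0 Lf; have [P [P1 <-]] := dir_derivP f p t.
suff -> : P = 0 by rewrite deriv0 horner0.
have /eqP : P * L = 0.
  apply: contrapT => /eqP /poly_nonroot[s]; rewrite hornerM mulf_eq0 negb_or -P1.
  by case/andP => /eqP h /Lf.
by rewrite mulf_eq0 (negPf L0) orbF => /eqP.
Qed.

Variables a b c : nat.
Local Notation A := a.+1.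
Local Notation B := b.+1.
Local Notation C := c.+1.
Local Notation X := (segre F a b c).

Lemma affine_poly_neq0 n (u x : 'rV[F]_n) : (u != 0) || (x != 0) ->
  exists L : {poly F}, L != 0 /\ forall s, L.[s] != 0 -> u + s *: x != 0.
Proof.
move=> ux; have [j hj] : exists j, (u 0 j != 0) || (x 0 j != 0).
  by case/orP: ux => /rV0Pn[j hj]; exists j; rewrite hj ?orbT.
exists ((u 0 j)%:P + x 0 j *: 'X); split.
  apply: contraTneq hj => E; rewrite negb_or !negbK.
  have h s : u 0 j + x 0 j * s = 0 by have := congr1 (horner^~ s) E; rewrite /= !hornerE.
  by have := h 1; have := h 0; rewrite mulr0 addr0 mulr1 => ->; rewrite add0r => ->; rewrite eqxx.
move=> s; rewrite !hornerE => h; apply: contraNneq h => E.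
have := congr1 (fun v : 'rV_n => v 0 j) E; rewrite !mxE => E1.
by rewrite mulrC E1.
Qed.

Lemma segre_vanish (f : {mpoly F[A * B * C]}) u v w : vanishes_on X f ->
  u != 0 -> v != 0 -> w != 0 -> meval_row f (tensor u v w) = 0.
Proof.
move=> fX u0 v0 w0; apply: (fX <[tensor u v w]>%VS); last exact: memv_line.
by exists u, v, w.
Qed.

Lemma tensor_lin1 s (u x : 'rV[F]_A) (v : 'rV[F]_B) (w : 'rV[F]_C) :
  tensor u v w + s *: tensor x v w = tensor (u + s *: x) v w.
Proof.
by apply: tcoordP => i j l; rewrite linearD linearZ /= !tcoord_tensor !mxE /GRing.scale /=; ring.
Qed.

Lemma tensor_lin2 s (u : 'rV[F]_A) (v z : 'rV[F]_B) (w : 'rV[F]_C) :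
  tensor u v w + s *: tensor u z w = tensor u (v + s *: z) w.
Proof.
by apply: tcoordP => i j l; rewrite linearD linearZ /= !tcoord_tensor !mxE /GRing.scale /=; ring.
Qed.

Lemma tensor_lin3 s (u : 'rV[F]_A) (v : 'rV[F]_B) (w o : 'rV[F]_C) :
  tensor u v w + s *: tensor u v o = tensor u v (w + s *: o).
Proof.
by apply: tcoordP => i j l; rewrite linearD linearZ /= !tcoord_tensor !mxE /GRing.scale /=; ring.
Qed.

Lemma tensor_neq0 (u : 'rV[F]_A) (v : 'rV[F]_B) (w : 'rV[F]_C) :
  u != 0 -> v != 0 -> w != 0 -> tensor u v w != 0.
Proof.
move=> /rV0Pn[i ui] /rV0Pn[j vj] /rV0Pn[l wl]; apply/eqP => E.
have /eqP := congr1 (tcoord i j l) E.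
by rewrite raddf0 tcoord_tensor !mulf_eq0 (negPf ui) (negPf vj) (negPf wl).
Qed.

(** Varying one factor moves the tensor along a line in the cone over X, on which [f] vanishes. The
    multiple [k], possibly 0, is absorbed into the varying factor, which is nonzero for almost all
    [s]. *)
Lemma segre_tangent_sup (u x : 'rV[F]_A) (v z : 'rV[F]_B) (w o : 'rV[F]_C) :
  u != 0 -> v != 0 -> w != 0 ->
  tangent_vector X <[tensor u v w]>%VS (tensor x v w + tensor u z w + tensor u v o).
Proof.
move=> u0 v0 w0 e f _ fX p /vlineP[k ->].
rewrite -/(dir_deriv f (k *: tensor u v w) _) -[tensor x v w]scale1r -addrA dir_deriv_lin.
rewrite -[tensor u z w]scale1r dir_deriv_lin !mul1r.
have -> : dir_deriv f (k *: tensor u v w) (tensor x v w) = 0.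
  have -> : k *: tensor u v w = tensor (k *: u) v w.
    by apply: tcoordP => i j l; rewrite linearZ /= !tcoord_tensor !mxE /GRing.scale /=; ring.
  have [->|x0] := eqVneq x 0.
    by rewrite (_ : tensor 0 v w = 0) ?dir_deriv0 //; apply: tcoordP => i j l;
       rewrite raddf0 tcoord_tensor !mxE !mul0r.
  have [|L [L0 hL]] := @affine_poly_neq0 _ (k *: u) x; first by rewrite x0 orbT.
  by apply: (dir_deriv_eq0 L0) => s /hL h; rewrite tensor_lin1; apply: segre_vanish.
have -> : dir_deriv f (k *: tensor u v w) (tensor u z w) = 0.
  have -> : k *: tensor u v w = tensor u (k *: v) w.
    by apply: tcoordP => i j l; rewrite linearZ /= !tcoord_tensor !mxE /GRing.scale /=; ring.
  have [->|z0] := eqVneq z 0.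
    by rewrite (_ : tensor u 0 w = 0) ?dir_deriv0 //; apply: tcoordP => i j l;
       rewrite raddf0 tcoord_tensor !mxE mulr0 mul0r.
  have [|L [L0 hL]] := @affine_poly_neq0 _ (k *: v) z; first by rewrite z0 orbT.
  by apply: (dir_deriv_eq0 L0) => s /hL h; rewrite tensor_lin2; apply: segre_vanish.
rewrite !add0r.
have -> : k *: tensor u v w = tensor u v (k *: w).
  by apply: tcoordP => i j l; rewrite linearZ /= !tcoord_tensor !mxE /GRing.scale /=; ring.
have [->|o0] := eqVneq o 0.
  by rewrite (_ : tensor u v 0 = 0) ?dir_deriv0 //; apply: tcoordP => i j l;
     rewrite raddf0 tcoord_tensor !mxE mulr0.
have [|L [L0 hL]] := @affine_poly_neq0 _ (k *: w) o; first by rewrite o0 orbT.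
by apply: (dir_deriv_eq0 L0) => s /hL h; rewrite tensor_lin3; apply: segre_vanish.
Qed.

Definition quadric n (p q r s : 'I_n) : {mpoly F[n]} := 'X_p * 'X_q - 'X_r * 'X_s.

Lemma quadric_homog n (p q r s : 'I_n) : quadric p q r s \is 2.-homog.
Proof.
have h (i j : 'I_n) : ('X_i * 'X_j : {mpoly F[n]}) \is 2.-homog.
  by rewrite -mpolyXD dhomogX /= mdegD !mdeg1.
by rewrite rpredB.
Qed.

Lemma dir_deriv_quadric n (p q r s : 'I_n) (x t : 'rV[F]_n) :
  dir_deriv (quadric p q r s) x t =
  t 0 p * x 0 q + x 0 p * t 0 q - (t 0 r * x 0 s + x 0 r * t 0 s).
Proof.
have -> : quadric p q r s = 'X_p * 'X_q + (- 1)%:MP * ('X_r * 'X_s).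
  by rewrite mul_mpolyC scaleN1r.
rewrite dir_derivD !dir_derivM dir_derivC !dir_derivX /meval_row mevalC !mevalM !mevalXU.
by ring.
Qed.

Lemma quadric_vanishes (p q r s : 'I_(A * B * C)) :
  (forall (u : 'rV[F]_A) (v : 'rV[F]_B) (w : 'rV[F]_C), tensor u v w 0 p * tensor u v w 0 q =
                tensor u v w 0 r * tensor u v w 0 s) ->
  vanishes_on X (quadric p q r s).
Proof.
move=> H _ [u [v [w [_ _ _ ->]]]] y /vlineP[k ->].
rewrite /meval_row mevalB !mevalM !mevalXU !mxE.
have := H u v w; rewrite -[segre_vec u v w]/(tensor u v w) => E.
set tp := tensor _ _ _ _ p in E *; set tq := tensor _ _ _ _ q in E *.
set tr := tensor _ _ _ _ r in E *; set ts := tensor _ _ _ _ s in E *.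
transitivity (k * k * (tp * tq - tr * ts)); first by ring.
by rewrite E subrr mulr0.
Qed.

(** At a base entry where the tensor does not vanish, the linearized 2 x 2 minors exchanging the
    first or the second index express every [T i j l] through entries that differ from the base
    entry in at most one index; these give [x], [z] and [o]. *)
Lemma segre_tangent_sub (u : 'rV[F]_A) (v : 'rV[F]_B) (w : 'rV[F]_C) t :
  u != 0 -> v != 0 -> w != 0 ->
  tangent_vector X <[tensor u v w]>%VS t ->
  exists x z o, t = tensor x v w + tensor u z w + tensor u v o.
Proof.
move=> /rV0Pn[i0 ui] /rV0Pn[j0 vj] /rV0Pn[l0 wl] tan.
pose T i j l : F := tcoord i j l t.
have swap1 i j l i' j' l' :
    T i j l * (u 0 i' * v 0 j' * w 0 l') + (u 0 i * v 0 j * w 0 l) * T i' j' l' =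
    T i' j l * (u 0 i * v 0 j' * w 0 l') + (u 0 i' * v 0 j * w 0 l) * T i j' l'.
  pose ix i j l : 'I_(A * B * C) := mxvec_index (mxvec_index i j) l.
  have := tan 2 _ (quadric_homog (ix i j l) (ix i' j' l') (ix i' j l) (ix i j' l')) _ _ (memv_line _).
  move=> /(_ _)/wrap[].
    apply: quadric_vanishes => u1 v1 w1.
    by rewrite -!/(tcoord _ _ _ _) !tcoord_tensor; ring.
  rewrite -/(dir_deriv _ _ _) dir_deriv_quadric -!/(tcoord _ _ _ _) !tcoord_tensor.
  by move/eqP; rewrite subr_eq0 => /eqP.
have swap2 i j l i' j' l' :
    T i j l * (u 0 i' * v 0 j' * w 0 l') + (u 0 i * v 0 j * w 0 l) * T i' j' l' =
    T i j' l * (u 0 i' * v 0 j * w 0 l') + (u 0 i * v 0 j' * w 0 l) * T i' j l'.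
  pose ix i j l : 'I_(A * B * C) := mxvec_index (mxvec_index i j) l.
  have := tan 2 _ (quadric_homog (ix i j l) (ix i' j' l') (ix i j' l) (ix i' j l')) _ _ (memv_line _).
  move=> /(_ _)/wrap[].
    apply: quadric_vanishes => u1 v1 w1.
    by rewrite -!/(tcoord _ _ _ _) !tcoord_tensor; ring.
  rewrite -/(dir_deriv _ _ _) dir_deriv_quadric -!/(tcoord _ _ _ _) !tcoord_tensor.
  by move/eqP; rewrite subr_eq0 => /eqP.
pose x : 'rV[F]_A := \row_i (T i j0 l0 / (v 0 j0 * w 0 l0)).
pose z : 'rV[F]_B := \row_j (T i0 j l0 / (u 0 i0 * w 0 l0)).
(* At the base entry, [x], [z] and the first term of [o] contribute [T i0 j0 l0] each; the
   correction removes the two extra copies. *)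
pose o : 'rV[F]_C := \row_l (T i0 j0 l / (u 0 i0 * v 0 j0) -
  2%:R * T i0 j0 l0 * w 0 l / (u 0 i0 * v 0 j0 * w 0 l0)).
exists x, z, o; apply: tcoordP => i j l.
rewrite !linearD /= !tcoord_tensor !mxE -/(T i j l).
have E1 := swap1 i j l i0 j0 l0; have E2 := swap2 i0 j l i0 j0 l0.
set N := u 0 i0 * v 0 j0 * w 0 l0 in E1 E2.
have N0 : N != 0 by rewrite !mulf_neq0.
have E1' : T i j l = (T i0 j l * (u 0 i * v 0 j0 * w 0 l0) +
    u 0 i0 * v 0 j * w 0 l * T i j0 l0 - u 0 i * v 0 j * w 0 l * T i0 j0 l0) / N.
  by apply: (canRL (mulfK N0)); rewrite -E1; ring.
have E2' : T i0 j l = (T i0 j0 l * (u 0 i0 * v 0 j * w 0 l0) +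
    u 0 i0 * v 0 j0 * w 0 l * T i0 j l0 - u 0 i0 * v 0 j * w 0 l * T i0 j0 l0) / N.
  by apply: (canRL (mulfK N0)); rewrite -E2; ring.
rewrite E1' E2' /N; field; by rewrite ui vj wl.
Qed.

Lemma mem_segre_tangent (u : 'rV[F]_A) (v : 'rV[F]_B) (w : 'rV[F]_C) t :
  u != 0 -> v != 0 -> w != 0 ->
  t \in tangent_space X <[tensor u v w]>%VS <->
  exists x z o, t = tensor x v w + tensor u z w + tensor u v o.
Proof.
move=> u0 v0 w0; split=> [/mem_tangent_space|[x [z [o ->]]]].
  exact: segre_tangent_sub.
by apply/mem_tangent_space; apply: segre_tangent_sup.
Qed.

End SegreTangent.

(** * General subspaces containing the tangent spaces *)

Section GenericSubspace.
Variable F : numFieldType.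

Lemma vline_scale (V : vectType F) (r : F) (x : V) : r != 0 -> <[r *: x]>%VS = <[x]>%VS.
Proof.
move=> r0; apply/eqP; rewrite eqEsubv -!memvE memvZ ?memv_line //=.
by rewrite -{1}[x](scalerK r0) memvZ ?memv_line.
Qed.

Lemma vspace_mx n (U : {vspace 'rV[F]_n}) :
  exists M : 'M[F]_n, forall t, (t \in U) = (t <= M)%MS.
Proof.
pose M : 'M[F]_(\dim U, n) := \matrix_i (vbasis U)`_i.
exists <<M>>%MS => t; rewrite genmxE; apply/idP/submxP => [tU|[c ->]].
  exists (\row_i coord (vbasis U) i t); rewrite mulmx_sum_row {1}(coord_vbasis tU).
  by apply: eq_bigr => i _; rewrite rowK mxE.
rewrite mulmx_sum_row; apply: memv_suml => i _; rewrite rowK.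
by apply/memvZ/vbasis_mem/mem_nth; rewrite size_tuple.
Qed.

(** The matrices killed by [M] are those that factor through [cokermx M]. A pseudo-inverse chooses
    the factor linearly in [K], which lets genericity pass from all matrices to those killed by
    [M]. *)
Lemma annihilator_factor n m (M : 'M[F]_n) :
  exists G : 'M[F]_n, forall K : 'M[F]_(n, m), M *m K = 0 ->
    cokermx M *m (G *m K) = K.
Proof.
exists (pinvmx (cokermx M)^T)^T => K MK.
have le : ((cokermx M)^T <= kermx M^T)%MS.
  by apply/sub_kermxP; rewrite -trmx_mul mulmx_coker trmx0.
have eq : (kermx M^T <= (cokermx M)^T)%MS.
  have := mxrank_leqif_sup le; rewrite mxrank_tr mxrank_coker mxrank_ker mxrank_tr.
  by case=> _ <-; rewrite eqxx.
have KM : (K^T <= (cokermx M)^T)%MS.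
  by apply: submx_trans eq; apply/sub_kermxP; rewrite -trmx_mul MK trmx0.
by apply: trmx_inj; rewrite trmx_mul (trmx_mul _ K) trmxK mulmxKpV.
Qed.

Lemma generic_full_rank n m (H : 'M[F]_n) : (m <= \rank H)%N ->
  generic (fun c : 'M[F]_(n, m) => \rank (H *m c) = m).
Proof.
move=> mr; pose c0 : 'M[F]_(n, m) := invmx (row_ebase H) *m pid_mx m.
have pm : polymx (fun c : 'M[F]_(n, m) => H *m c).
  apply: polymx_mul; first exact: polymx_const.
  by move=> i j; apply: polyf_scalar => a x y; rewrite !mxE.
apply: generic_sub (generic_rank c0 pm) => c.
have -> : \rank (H *m c0) = m.
  rewrite /c0 -{1}(mulmx_ebase H) -!mulmxA (mulmxA (row_ebase H)) mulmxV ?row_ebase_unit //.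
  rewrite mul1mx eqmxMfull ?row_full_unit ?col_ebase_unit //.
  have rn := rank_leq_row H; rewrite mul_pid_mx rank_pid_mx; move: mr rn; lia.
by move=> le; apply/eqP; rewrite eqn_leq rank_leq_col.
Qed.

Variables (a b c k R m : nat).
Local Notation A := a.+1.
Local Notation B := b.+1.
Local Notation C := c.+1.
Local Notation n := (A * B * C)%N.
Variables (u : 'M[F]_(k, A)) (v : 'M[F]_(k, B)) (w : 'M[F]_(k, C)).

Hypothesis good : good_pairs (u, v).
Hypothesis sep : forall i, separated R i (u, v, w).
Hypothesis k_gt0 : (0 < k)%N.
Hypothesis mE : m = (A + B)%N.
Hypothesis mR : (C < m * R)%N.
Hypothesis room : (k + R + m <= A * B)%N.

Variable M : 'M[F]_n.
Hypothesis MP : forall t, (t <= M)%MS <-> in_tangents u v w t.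

(** The slices of the row space of [Q] at [ord_max] meet the row space of [M] trivially, so the
    latter has codimension at least [\rank Q], and [room] makes this at least [m]. *)
Lemma rank_cokermx_tangents : (m <= \rank (cokermx M))%N.
Proof.
have [_ _ [Q [rQ QM]]] := sep (Ordinal k_gt0).
pose e : 'rV[F]_C := delta_mx 0 ord_max.
pose S : 'M[F]_(A * B, n) := \matrix_(i, j) slice (delta_mx 0 i) e 0 j.
have SE (t : 'rV_(A * B)) : t *m S = slice t e.
  rewrite mulmx_sum_row; apply: tcoordP => i j l; rewrite tcoord_slice linear_sum /=.
  rewrite (bigD1 (mxvec_index i j)) //= big1 => [|i' ne].
    rewrite addr0 linearZ /= (_ : row _ S = slice (delta_mx 0 (mxvec_index i j)) e).
      by rewrite tcoord_slice mxE !eqxx mul1r.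
    by apply/rowP => x; rewrite !mxE.
  rewrite linearZ /= (_ : row _ S = slice (delta_mx 0 i') e); last first.
    by apply/rowP => x; rewrite !mxE.
  by rewrite tcoord_slice mxE eqxx /= eq_sym (negPf ne) mul0r scaler0.
have Sfree : row_free S.
  rewrite -kermx_eq0; apply/rowV0P => t /sub_kermxP; rewrite SE => E.
  apply/rowP => ij; case/mxvec_indexP: ij => i j.
  have := congr1 (tcoord i j ord_max) E.
  by rewrite tcoord_slice raddf0 /e !mxE !eqxx mulr1.
have cap0 : (M :&: (Q *m S))%MS = 0.
  apply/eqP/rowV0P => t; rewrite sub_capmx => /andP[/MP tM /submxP[d td]].
  rewrite mulmxA SE in td; rewrite td in tM.
  by have := QM d tM; rewrite td => ->; rewrite -SE mul0mx.
rewrite mxrank_coker -(leq_add2r (\rank M)) subnK ?rank_leq_col //.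
have := mxrank_disjoint_sum cap0; rewrite mxrankMfree // => E.
have mQ : (m <= \rank Q)%N by rewrite -(leq_add2l (k + R)) (leq_trans room).
have := rank_leq_col (M + Q *m S)%MS; rewrite E; apply: leq_trans.
by rewrite addnC leq_add2l.
Qed.

(** Normalizing a nonzero coordinate of x to 1 saves the decisive parameter: [a + B], that is
    [m - 1], remain for the pair (x, z). *)
Definition chart d (i : 'I_d.+1) (x : 'rV[F]_d) : 'rV[F]_d.+1 :=
  \row_j if unlift i j is Some j' then x 0 j' else 1.

Lemma chartP d (i : 'I_d.+1) (x : 'rV[F]_d.+1) : x 0 i != 0 ->
  exists y, x = x 0 i *: chart i y.
Proof.
move=> xi; exists (\row_j (x 0 (lift i j) / x 0 i)); apply/rowP => j; rewrite !mxE.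
case: unliftP => [j' ->|->]; last by rewrite mulr1.
by rewrite mxE mulrC divfK.
Qed.

(* Here [cokermx M *m d] is a general matrix killed by [M]. The products [x (x) z]
   depend on [a + B < m] parameters, so a general such matrix kills no
   [x (x) z (x) e_l] outside the row space of [M]. *)
Lemma generic_base_locus : generic (fun d : 'M[F]_(n, m) =>
  forall (x : 'rV_A) (z : 'rV_B) l, x != 0 ->
    tensor x z (delta_mx 0 l) *m (cokermx M *m d) = 0 ->
    in_tangents u v w (tensor x z (delta_mx 0 l))).
Proof.
pose E (il : 'I_A * 'I_C) (t : 'rV[F]_a * 'rV[F]_B) : 'M[F]_(1, n) :=
  tensor (chart il.1 t.1) t.2 (delta_mx 0 il.2) *m cokermx M.
have pE il : polymx (E il).
  apply: polymx_mul; last exact: polymx_const.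
  apply: polymx_tcoord => i j l; apply: polyf_ext => [t|].
    by rewrite tcoord_tensor mxE.
  apply: polyf_mul; last exact: polyf_const.
  apply: polyf_mul; last by apply: polyf_scalar => s x y; rewrite !mxE.
  case: (unlift il.1 i) => [j'|]; last exact: polyf_const.
  by apply: polyf_scalar => s x y; rewrite !mxE.
have dimE : (dim ('rV[F]_a * 'rV[F]_B)%type < m * 1)%N.
  rewrite muln1 mE; have -> : dim ('rV[F]_a * 'rV[F]_B)%type = (1 * a + 1 * B)%N by [].
  by rewrite !mul1n addSn.
apply: generic_sub (generic_all (fun il => generic_mul_neq0 (pE il) dimE)).
move=> d H x z l /rV0Pn[i xi] E0; have [y Ey] := chartP xi.
apply/MP; rewrite submxE; apply: contraT => ne; have := H (i, l) (y, z).
have xE : tensor x z (delta_mx 0 l) = x 0 i *: tensor (chart i y) z (delta_mx 0 l).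
  apply: tcoordP => p q r; rewrite linearZ /= !tcoord_tensor {1}Ey mxE /GRing.scale /=.
  by ring.
have E1 : E (i, l) (y, z) != 0.
  by apply: contraNneq ne; rewrite /E /= xE -scalemxAl => ->; rewrite scaler0.
have -> : row_free (E (i, l) (y, z)).
  by rewrite /row_free eqn_leq rank_leq_row lt0n mxrank_eq0.
move=> /(_ isT); rewrite /E /= -mulmxA => /eqP[].
by move/eqP: E0; rewrite xE -scalemxAl scaler_eq0 (negPf xi) => /eqP.
Qed.

(** By [separated], the [R] vectors [u_i v'_r o] are independent modulo the row space of [M] when
    [o] is off the line of [w_i]. They depend on [C] parameters, and [C < m * R]. *)
Lemma generic_fiber i : exists v' : 'M[F]_(R, B), generic (fun d : 'M[F]_(n, m) =>
  forall o : 'rV_C, (forall s, o <> s *: row i w) ->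
    exists r, tensor (row i u) (row r v') o *m (cokermx M *m d) != 0).
Proof.
have [_ [v' sepv] _] := sep i; exists v'.
pose E (o : 'rV[F]_C) : 'M[F]_(R, n) :=
  (\matrix_(r, j) tensor (row i u) (row r v') o 0 j) *m cokermx M.
have pE : polymx E.
  apply: polymx_mul; last exact: polymx_const.
  move=> r j; case/mxvec_indexP: j => pq l; case/mxvec_indexP: pq => p q.
  apply: polyf_ext => [o|].
    by rewrite mxE -/(tcoord p q l _) tcoord_tensor.
  by apply: polyf_mul; [apply: polyf_const | apply: polyf_coord].
have dimE : (dim 'rV[F]_C < m * R)%N by rewrite dim_matrix mul1r.
apply: generic_sub (generic_mul_neq0 pE dimE) => d H o ow.
have free : row_free (E o).
  rewrite -kermx_eq0; apply/rowV0P => x /sub_kermxP; rewrite mulmxA => /eqP.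
  rewrite -submxE => /MP tan; apply/rowP => r; rewrite mxE.
  have [|s es] := sepv (\matrix_(r, l) (x 0 r * o 0 l)) _ r.
    move: tan; congr in_tangents; rewrite mulmx_sum_row; apply: eq_bigr => r' _.
    apply: tcoordP => p q l; rewrite linearZ /= /tcoord !mxE -!/(tcoord _ _ _ _).
    by rewrite !tcoord_tensor !mxE /GRing.scale /=; ring.
  apply: contrapT => /eqP xr; apply: (ow ((x 0 r)^-1 * s)).
  rewrite -scalerA -es; apply/rowP => l; rewrite !mxE.
  by rewrite mulKf.
have := H o free; apply: contra_neqP => /forallNP h.
rewrite -mulmxA; apply/row_matrixP => r; rewrite row_mul row0.
have := h r => /negP; rewrite negbK => /eqP <-.
by congr (_ *m _); apply/rowP => j; rewrite !mxE.
Qed.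

Lemma generic_subspace : exists h : 'M[F]_(n, m) -> F,
  [/\ polyf h, exists K, [/\ M *m K = 0, \rank K = m & h K != 0] &
  forall K, M *m K = 0 -> h K != 0 ->
  forall (x : 'rV_A) (z : 'rV_B) (o : 'rV_C), x != 0 -> z != 0 -> o != 0 ->
    (forall x' z' o', (tensor x' z o + tensor x z' o + tensor x z o') *m K = 0) ->
    exists i, <[tensor x z o]>%VS = <[tensor (row i u) (row i v) (row i w)]>%VS].
Proof.
have [v' fib] := choice generic_fiber.
have [h [ph [d0 hd0] hP]] := generic_and generic_base_locus (generic_all fib).
have [d1 [hd1 rd1]] : exists d, h d != 0 /\ \rank (cokermx M *m d) = m.
  apply: generic_ex; apply: generic_and; first by apply: (generic_neq0 ph hd0).
  by apply: generic_full_rank; apply: rank_cokermx_tangents.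
have [G GP] := annihilator_factor m M.
have cok1 : cokermx M *m (G *m (cokermx M *m d1)) = cokermx M *m d1.
  by apply: GP; rewrite mulmxA mulmx_coker mul0mx.
(* The correction term makes [g] a section of [d |-> cokermx M *m d] through [d1]. *)
pose g (K : 'M[F]_(n, m)) := G *m K + (d1 - G *m (cokermx M *m d1)).
have gK K : M *m K = 0 -> cokermx M *m g K = K.
  by move=> MK; rewrite mulmxDr GP // mulmxBr cok1 subrr addr0.
exists (fun K => h (g K)); split.
- apply: polyf_comp_mx => //; apply: polymx_add; last exact: polymx_const.
  apply: polymx_mul; first exact: polymx_const.
  by move=> i j; apply: polyf_scalar => s x y; rewrite !mxE.
- exists (cokermx M *m d1); split=> //; first by rewrite mulmxA mulmx_coker mul0mx.
  by rewrite /g addrC subrK.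
move=> K MK hK x z o x0 z0 o0 tan; have [base fibK] := hP _ hK.
have tanx x' : tensor x' z o *m K = 0.
  rewrite -[RHS](tan x' 0 0); congr (_ *m _); apply: tcoordP => i j l.
  by rewrite !linearD /= !tcoord_tensor !mxE; ring.
have tanz z' : tensor x z' o *m K = 0.
  rewrite -[RHS](tan 0 z' 0); congr (_ *m _); apply: tcoordP => i j l.
  by rewrite !linearD /= !tcoord_tensor !mxE; ring.
have tano o' : tensor x z o' *m K = 0.
  rewrite -[RHS](tan 0 0 o'); congr (_ *m _); apply: tcoordP => i j l.
  by rewrite !linearD /= !tcoord_tensor !mxE; ring.
have [C2 _ _] := sep (Ordinal k_gt0).
have [|y Ey] := C2 (mxvec (x^T *m z)).
  by rewrite -tensor_slice; apply: base => //; rewrite gK.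
have [i [[s es] [r er]]] : exists i, (exists s, x = s *: row i u) /\ (exists s, z = s *: row i v).
  apply: (good (c := y)) => //=; apply: (can_inj mxvecK); rewrite Ey.
  apply/rowP => ij; case/mxvec_indexP: ij => i j; rewrite mxvecE summxE mul_mx_diag mxE.
  apply: eq_bigr => l _; rewrite !mxE mxvecE !mxE big_ord1 !mxE.
  by ring.
have s0 : s != 0 by apply: contraNneq x0 => s0; rewrite es s0 scale0r.
have r0 : r != 0 by apply: contraNneq z0 => r0; rewrite er r0 scale0r.
exists i; have [[q eq]|no] := pselect (exists q, o = q *: row i w); last first.
  have [|r' /negP[]] := fibK i o; first by move=> q eq; apply: no; exists q.
  rewrite gK //; have := tanz (row r' (v' i)).
  have -> : tensor x (row r' (v' i)) o = s *: tensor (row i u) (row r' (v' i)) o.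
    apply: tcoordP => j j' l; rewrite linearZ /= !tcoord_tensor es !mxE /GRing.scale /=.
    by ring.
  by rewrite -scalemxAl => /eqP; rewrite scaler_eq0 (negPf s0).
have q0 : q != 0 by apply: contraNneq o0 => q0; rewrite eq q0 scale0r.
have -> : tensor x z o = (s * r * q) *: tensor (row i u) (row i v) (row i w).
  apply: tcoordP => j j' l; rewrite linearZ /= !tcoord_tensor es er eq !mxE /GRing.scale /=.
  by ring.
by apply: vline_scale; rewrite !mulf_neq0.
Qed.

End GenericSubspace.

(** * Open sets of subspaces and of tuples of points *)

Section OpenSets.
Variable F : numFieldType.

Lemma zariski_openP r (A : 'rV[F]_r -> Prop) :
  (forall v0, A v0 -> exists f : 'rV[F]_r -> F,
    [/\ polyf f, f v0 != 0 & forall v, f v != 0 -> A v]) ->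
  zariski_open A.
Proof.
move=> H; exists (fun P => forall v, meval_row P v != 0 -> A v) => v.
split=> [/H[f [pf f0 fA]]|[P PA]]; last exact: PA.
have [P PE] := polyf_row_mpoly pf.
by exists P; rewrite -?PE // => v'; rewrite -PE; apply: fA.
Qed.

Lemma dim_mx n m (U : {vspace 'rV[F]_n}) (M : 'M[F]_(m, n)) :
  (forall t, (t \in U) = (t <= M)%MS) -> \dim U = \rank M.
Proof.
move=> UM; pose N : 'M[F]_(\dim U, n) := \matrix_i (vbasis U)`_i.
have Nfree : row_free N.
  rewrite -kermx_eq0; apply/rowV0P => c /sub_kermxP; rewrite mulmx_sum_row => E.
  have /freeP fr := basis_free (vbasisP U); apply/rowP => i; rewrite mxE.
  by apply: fr; rewrite -[RHS]E; apply: eq_bigr => j _; rewrite rowK.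
have NM : (N :=: M)%MS.
  apply/eqmxP/andP; split; apply/rV_subP => t.
    case/submxP => c ->; rewrite -UM mulmx_sum_row; apply: memv_suml => i _.
    by rewrite rowK; apply/memvZ/vbasis_mem/mem_nth; rewrite size_tuple.
  rewrite -UM => tU; rewrite (coord_vbasis tU); apply: summx_sub => i _.
  by apply: scalemx_sub; rewrite -(rowK (fun i : 'I_(\dim U) => (vbasis U)`_i)) row_sub.
by rewrite -NM (eqP Nfree).
Qed.

Lemma mem_sum_rows n d (M : 'M[F]_(d, n)) t :
  (t \in (\sum_(i < d) <[row i M]>)%VS) = (t <= M)%MS.
Proof.
apply/memv_sumP/submxP => [[x xr ->]|[c ->]].
  have /fin_all_exists[e ex] i : exists e, x i = e *: row i M.
    by apply/vlineP; apply: xr.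
  exists (\row_i e i); rewrite mulmx_sum_row; apply: eq_bigr => i _.
  by rewrite mxE ex.
exists (fun i => c 0 i *: row i M); last by rewrite mulmx_sum_row.
by move=> i _; rewrite memvZ ?memv_line.
Qed.

(** On a Zariski neighbourhood of a frame [M0], a kernel matrix [K M] is polynomial in the frame [M]
    and specializes to [K0], so [h (K M) != 0] is an open condition on frames. *)
Lemma grass_open_kernels n m d (h : 'M[F]_(n, m) -> F) : (d + m)%N = n -> polyf h ->
  grass_open d (fun L : {vspace 'rV[F]_n} =>
    exists K, [/\ \rank K = m, h K != 0 & forall t, (t \in L) = (t *m K == 0)]).
Proof.
move=> dmn ph; apply: zariski_openP => v0 /= [dimL [K0 [rK0 hK0 LK0]]].
set M0 := vec_mx v0 in dimL LK0.
have rM0 : row_free M0.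
  by rewrite /row_free -(dim_mx (mem_sum_rows M0)) dimL.
have /row_freeP[D MD] := rM0.
have /row_freeP[C' KC'] : row_free K0^T by rewrite /row_free mxrank_tr rK0.
pose C0 := C'^T; have CK : C0 *m K0 = 1%:M.
  by rewrite -[K0]trmxK -trmx_mul KC' trmx1.
have MK : M0 *m K0 = 0.
  apply/row_matrixP => i; rewrite row_mul row0; apply/eqP; rewrite -LK0.
  by rewrite mem_sum_rows row_sub.
(* A right inverse of [M0], corrected so that [C0 *m D0 = 0]. Then [C0 *m K M] is the scalar matrix
   of [\det (M *m D0)], which forces [K M] to have full rank. *)
pose D0 := D - K0 *m (C0 *m D).
have MD0 : M0 *m D0 = 1%:M by rewrite mulmxBr mulmxA MK mul0mx subr0.
have CD0 : C0 *m D0 = 0 by rewrite mulmxBr (mulmxA C0 K0) CK mul1mx subrr.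
(* A kernel matrix of [M], depending polynomially on [M] and equal to [K0] at [M0]. *)
pose K (M : 'M[F]_(d, n)) := \det (M *m D0) *: K0 - D0 *m (\adj (M *m D0) *m (M *m K0)).
have pM : polymx (fun v : 'rV[F]_(d * n) => vec_mx v).
  by move=> i j; apply: polyf_scalar => s x y; rewrite !mxE.
have pMD : polymx (fun v : 'rV[F]_(d * n) => vec_mx v *m D0).
  by apply: polymx_mul => //; apply: polymx_const.
have pK : polymx (fun v : 'rV[F]_(d * n) => K (vec_mx v)).
  apply: polymx_add.
    by apply: polymx_scale; [apply: polyf_det | apply: polymx_const].
  apply: polymx_opp; apply: polymx_mul; first exact: polymx_const.
  apply: polymx_mul; first exact: polymx_adj.
  by apply: polymx_mul => //; apply: polymx_const.
exists (fun v => \det (vec_mx v *m D0) * h (K (vec_mx v))); split.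
- by apply: polyf_mul; [apply: polyf_det | apply: polyf_comp_mx].
- rewrite /K -/M0 MD0 det1 MK !mulmx0 subr0 scale1r mul1r.
  exact: hK0.
move=> v; rewrite mulf_eq0 negb_or => /andP[]; set M := vec_mx v => dM hK.
have uM : M *m D0 \in unitmx by rewrite unitmxE unitfE.
have fM : row_free M.
  rewrite /row_free eqn_leq rank_leq_row; have := mxrankM_maxl M D0.
  by rewrite mxrank_unit.
split; first by rewrite (dim_mx (mem_sum_rows M)) (eqP fM).
have MKM : M *m K M = 0.
  rewrite mulmxBr -scalemxAr mulmxA (mulmxA (M *m D0)) mul_mx_adj mul_scalar_mx.
  by rewrite subrr.
have rK : \rank (K M) = m.
  apply/eqP; rewrite eqn_leq rank_leq_col; have := mxrankM_maxr C0 (K M).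
  rewrite mulmxBr -scalemxAr CK mulmxA CD0 mul0mx subr0.
  by rewrite mxrank_scale_nz // mxrank1.
exists (K M); split=> // t; rewrite mem_sum_rows.
apply/idP/eqP => [/submxP[x ->]|tK]; first by rewrite -mulmxA MKM mulmx0.
have Mker : (M <= kermx (K M))%MS by apply/sub_kermxP.
have kerM : (kermx (K M) <= M)%MS.
  have := mxrank_leqif_sup Mker; case=> _ <-.
  by rewrite mxrank_ker rK (eqP fM) -dmn addnK.
by apply: submx_trans kerM; apply/sub_kermxP.
Qed.

Lemma vline_eqP n (x y : 'rV[F]_n) : x != 0 -> <[x]>%VS = <[y]>%VS ->
  exists2 s, s != 0 & x = s *: y.
Proof.
move=> x0 E; have : x \in <[y]>%VS by rewrite -E memv_line.
case/vlineP => s es; exists s => //.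
by apply: contraNneq x0 => s0; rewrite es s0 scale0r.
Qed.

(** [H] is a function of vectors and is not assumed homogeneous, so a tuple of lines is tested on
    some choice of representatives. The scalars that yield it at one tuple are kept for the
    neighbouring ones. *)
Lemma points_open_lines k n (H : 'M[F]_(k, n) -> F) : polyf H ->
  points_open (fun p : {ffun 'I_k -> {vspace 'rV[F]_n}} =>
    exists z : 'M[F]_(k, n), (forall i, row i z != 0 /\ p i = <[row i z]>%VS) /\ H z != 0).
Proof.
move=> pH; apply: zariski_openP => v0 /= []; set M0 := vec_mx v0 => M0row [z [zp Hz]].
have /fin_all_exists2[s s0 es] i : exists2 s, s != 0 & row i z = s *: row i M0.
  have [z0 E] := zp i; apply: vline_eqP => //.
  by rewrite -E ffunE.
have /fin_all_exists[j jM] i : exists j, M0 i j != 0.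
  by have /rV0Pn[j] := M0row i; rewrite mxE; exists j.
pose Z (v : 'rV[F]_(k * n)) : 'M[F]_(k, n) := \matrix_(i, j) (s i * vec_mx v i j).
have rowZ v i : row i (Z v) = s i *: row i (vec_mx v).
  by apply/rowP => l; rewrite !mxE.
exists (fun v => \prod_i vec_mx v i (j i) * H (Z v)); split.
- apply: polyf_mul.
    by apply: polyf_prod => i; apply: polyf_scalar => t x y; rewrite !mxE.
  apply: polyf_comp_mx => // i l; apply: polyf_scalar => t x y; rewrite !mxE.
  by ring.
- apply: mulf_neq0; first by apply/prodf_neq0 => i _; apply: jM.
  have -> // : Z v0 = z.
  by apply/row_matrixP => i; rewrite rowZ es.
move=> v; rewrite mulf_eq0 negb_or => /andP[/prodf_neq0 hj hH].
have v_row i : row i (vec_mx v) != 0.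
  apply: contraNneq (hj i isT) => /rowP/(_ (j i)).
  by rewrite [LHS]mxE [RHS]mxE => ->.
split=> //; exists (Z v); split=> // i.
rewrite rowZ ffunE vline_scale //; split=> //.
by rewrite scaler_eq0 negb_or s0 v_row.
Qed.

End OpenSets.

(** * General points of the Segre variety, and general subspaces through their tangent spaces *)

Section GeneralMembers.
Variable F : numFieldType.
Variables (a b c k : nat).
Local Notation n := (a.+1 * b.+1 * c.+1)%N.
Local Notation triples := ('M[F]_(k, a.+1) * 'M[F]_(k, b.+1) * 'M[F]_(k, c.+1))%type.

Definition spanned_by (p : {ffun 'I_k -> {vspace 'rV[F]_n}}) (y : triples) : Prop :=
  forall i, [/\ row i y.1.1 != 0, row i y.1.2 != 0, row i y.2 != 0 &
    p i = <[tensor (row i y.1.1) (row i y.1.2) (row i y.2)]>%VS].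

Lemma row_neq0 m l (M : 'M[F]_(m, l)) i j : M i j != 0 -> row i M != 0.
Proof. by apply: contraNneq => /rowP/(_ j); rewrite !mxE => ->. Qed.

Lemma general_segre_points (P : triples -> Prop) : generic P ->
  for_general (@points_open F n k) (fun p => forall i, segre F a b c (p i))
    (fun p => exists2 y, P y & spanned_by p y).
Proof.
move=> gP.
pose t0 : triples := (const_mx 1, const_mx 1, const_mx 1).
have pu : polymx (fun y : triples => y.1.1).
  by move=> ? ?; apply: polyf_scalar => d x y; rewrite !mxE.
have pv : polymx (fun y : triples => y.1.2).
  by move=> ? ?; apply: polyf_scalar => d x y; rewrite !mxE.
have pw : polymx (fun y : triples => y.2).
  by move=> ? ?; apply: polyf_scalar => d x y; rewrite !mxE.
(* The map [D] below recovers each factor from the tensor entries whose other two indices are 0, so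
   these coordinates must not vanish. *)
have g0 : generic (fun y : triples => forall i : 'I_k,
    y.1.1 i 0 * (y.1.2 i 0 * y.2 i 0) != 0).
  apply: generic_all => i; apply: (generic_neq0 (t0 := t0)).
    by apply: polyf_mul => //; apply: polyf_mul.
  by rewrite /= !mxE !mulr1 oner_neq0.
have [H [pH [y1 Hy1] HP]] := generic_and gP g0.
have [_ nz1] := HP y1 Hy1.
have nzE (y : triples) : (forall i : 'I_k, y.1.1 i 0 * (y.1.2 i 0 * y.2 i 0) != 0) ->
    forall i, [/\ y.1.1 i 0 != 0, y.1.2 i 0 != 0 & y.2 i 0 != 0].
  by move=> y0 i; have := y0 i; rewrite !mulf_eq0 !negb_or => /and3P[].
have {}nz1 := nzE _ nz1.
pose rows (y : triples) : 'M[F]_(k, n) :=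
  \matrix_i tensor (row i y.1.1) (row i y.1.2) (row i y.2).
(* A linear map sending the products of the rows of [y1] back to [y1], and
   products of other vectors to multiples of these. *)
pose D (z : 'M[F]_(k, n)) : triples :=
  (\matrix_(i, j) ((y1.1.2 i 0 * y1.2 i 0)^-1 * tcoord j 0 0 (row i z)),
   \matrix_(i, j) ((y1.1.1 i 0 * y1.2 i 0)^-1 * tcoord 0 j 0 (row i z)),
   \matrix_(i, j) ((y1.1.1 i 0 * y1.1.2 i 0)^-1 * tcoord 0 0 j (row i z))).
have Dlin s x y : D (s *: x + y) = s *: D x + D y.
  by congr (_, _, _); apply/matrixP => i j; rewrite !mxE !linearP /=; rewrite /GRing.scale /=; ring.
have Drows : D (rows y1) = y1.
  rewrite [RHS]surjective_pairing [y1.1 in RHS]surjective_pairing.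
  congr (_, _, _); apply/matrixP => i j; rewrite !mxE rowK tcoord_tensor !mxE;
  have [h1 h2 h3] := nz1 i; field; rewrite ?h1 ?h2 ?h3 //.
have pHD : polyf (fun z => H (D z)).
  by apply: polyf_comp pH => l ll; apply: polyf_scalar => s x x'; rewrite Dlin ll.
exists (fun p => exists z : 'M[F]_(k, n),
  (forall i, row i z != 0 /\ p i = <[row i z]>%VS) /\ H (D z) != 0); split.
- exact: (points_open_lines pHD).
- exists [ffun i => <[row i (rows y1)]>%VS]; last first.
    exists (rows y1); rewrite Drows; split=> // i; rewrite ffunE; split=> //.
    have [h1 h2 h3] := nz1 i; rewrite rowK.
    by apply: tensor_neq0; apply: row_neq0; [exact: h1 | exact: h2 | exact: h3].
  move=> i; have [h1 h2 h3] := nz1 i; rewrite ffunE rowK.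
  exists (row i y1.1.1), (row i y1.1.2), (row i y1.2).
  by split=> //; apply: row_neq0; [exact: h1 | exact: h2 | exact: h3].
move=> p Xp [z [zp HDz]]; have [PD nzD] := HP _ HDz.
exists (D z) => // i; have [D1 D2 D3] := nzE _ nzD i.
have [z0 pz] := zp i; have [u [v [w [u0 v0 w0 pE]]]] := Xp i.
have [s s0 zE] := vline_eqP z0 (etrans (esym pz) pE).
have zT j l o : tcoord j l o (row i z) = s * (u 0 j * v 0 l * w 0 o).
  by rewrite zE linearZ /=; congr (_ * _); apply: tcoord_tensor.
have rowD1 : row i (D z).1.1 = ((y1.1.2 i 0 * y1.2 i 0)^-1 * s * v 0 0 * w 0 0) *: u.
  by apply/rowP => j; rewrite !mxE zT; ring.
have rowD2 : row i (D z).1.2 = ((y1.1.1 i 0 * y1.2 i 0)^-1 * s * u 0 0 * w 0 0) *: v.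
  by apply/rowP => j; rewrite !mxE zT; ring.
have rowD3 : row i (D z).2 = ((y1.1.1 i 0 * y1.1.2 i 0)^-1 * s * u 0 0 * v 0 0) *: w.
  by apply/rowP => j; rewrite !mxE zT; ring.
have r1 := row_neq0 D1; have r2 := row_neq0 D2; have r3 := row_neq0 D3.
split=> //; rewrite pE.
move: r1 r2 r3; rewrite rowD1 rowD2 rowD3 !scaler_eq0 !negb_or.
set s1 := (X in X *: u); set s2 := (X in X *: v); set s3 := (X in X *: w).
move=> /andP[s10 _] /andP[s20 _] /andP[s30 _].
have -> : tensor (s1 *: u) (s2 *: v) (s3 *: w) = (s1 * s2 * s3) *: tensor u v w.
  by apply: tcoordP => j l o; rewrite linearZ /= !tcoord_tensor !mxE /GRing.scale /=; ring.
by rewrite vline_scale //; exact: mulf_neq0 (mulf_neq0 s10 s20) s30.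
Qed.

Variable R : nat.
Hypothesis k_gt0 : (0 < k)%N.
Hypothesis mR : (c.+1 < (a + b + 2) * R)%N.
Hypothesis room : (k + R + (a + b + 2) <= a.+1 * b.+1)%N.

Lemma general_tangent_subspace (p : {ffun 'I_k -> {vspace 'rV[F]_n}}) (y : triples) :
  spanned_by p y -> good_pairs y.1 -> (forall i, separated R i y) ->
  for_general (@grass_open F n (n - (a + b + 2)))
    (fun L => codim_eq (a + b + 2) L /\
              (\sum_(i < k) tangent_space (segre F a b c) (p i) <= L)%VS)
    (fun L => forall x, segre F a b c x -> (forall i, x <> p i) ->
              ~ tangent_at L (segre F a b c) x).
Proof.
case: y => [[u v] w] py good sep.
have [U UP] := vspace_of_closed (in_tangents0 u v w)
  (fun s t t' => @in_tangents_lin F k _ _ _ u v w s t t').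
have [M UM] := vspace_mx U.
have MP t : (t <= M)%MS <-> in_tangents u v w t by rewrite -UM; apply: UP.
have mE : (a + b + 2 = a.+1 + b.+1)%N by lia.
have dmn : (n - (a + b + 2) + (a + b + 2) = n)%N.
  by rewrite subnK //; have := leq_pmulr (a.+1 * b.+1) (ltn0Sn c); lia.
have [h [ph [K0 [MK0 rK0 hK0]] hP]] := generic_subspace good sep k_gt0 mE mR room MP.
have tangentE t i : t \in tangent_space (segre F a b c) (p i) <-> exists x z o,
    t = tensor x (row i v) (row i w) + tensor (row i u) z (row i w) +
        tensor (row i u) (row i v) o.
  by have [u0 v0 w0 ->] := py i; apply: mem_segre_tangent.
exists (fun L : {vspace 'rV[F]_n} => exists K : 'M[F]_(n, a + b + 2),
  [/\ \rank K = (a + b + 2)%N, h K != 0 & forall t, (t \in L) = (t *m K == 0)]); split.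
- exact: grass_open_kernels.
- have [|s t t' tK t'K|L LK] := @vspace_of_closed F n (fun t => t *m K0 = 0).
  + exact: mul0mx.
  + by rewrite mulmxDl -scalemxAl tK t'K scaler0 addr0.
  exists L; last first.
    by exists K0; split=> // t; apply/idP/eqP => /LK.
  split.
    rewrite /codim_eq (dim_mx (M := kermx K0)) ?mxrank_ker ?rK0 ?dmn // => t.
    by apply/idP/sub_kermxP => /LK.
  apply/subv_sumP => i _; apply/subvP => t /tangentE[x [z [o ->]]]; apply/LK.
  have /MP/submxP[e ->] := in_tangents1 u v w i x z o.
  by rewrite -mulmxA MK0 mulmx0.
move=> L [_ /subv_sumP TL] [K [_ hK LK]] x [ux [vx [wx [ux0 vx0 wx0 xE]]]] xp tx.
have MK : M *m K = 0.
  apply/row_matrixP => i; rewrite row_mul row0; apply/eqP; rewrite -LK.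
  have /MP[x' [z' [o' ->]]] := row_sub i M.
  apply: memv_suml => j _; apply: (subvP (TL j isT)); apply/tangentE.
  by exists (row j x'), (row j z'), (row j o').
have [|i E] := hP K MK hK ux vx wx ux0 vx0 wx0.
  move=> x' z' o'; apply/eqP; rewrite -LK; apply: (subvP tx); rewrite xE.
  by apply/(mem_segre_tangent _ ux0 vx0 wx0); exists x', z', o'.
by apply: (xp i); have [_ _ _ ->] := py i; rewrite xE.
Qed.

End GeneralMembers.

(** * Numerical estimates *)

Lemma mulr_sub_ge0 (Q : realFieldType) (x y z w : Q) : x <= y -> z <= w -> 0 <= (y - x) * (w - z).
Proof. by move=> xy zw; rewrite mulr_ge0 ?subr_ge0. Qed.

(** In these estimates [A], [B], [C] are a + 1, b + 1, c + 1, [h] is a + b, and [r + 1] is the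
    constant R. Multiplying by [C + h], the denominator in the bound on k, allows [kd] to eliminate
    [k]; the products collected beforehand are the nonlinear inequalities that [lra] combines. *)
Lemma room_bound (Q : realFieldType) (A B C h k r : Q)
  (hE : A + B = h + 2) (A4 : 4 <= A) (AB : A <= B) (BC : B <= C) (r0 : 0 <= r)
  (kd : k * (C + h) <= C * (A * B - (C + h))) (rC : r * (h + 2) <= C) :
  k + (r + 1) + A + B <= A * B.
Proof.
have h6 : 6 <= h by lra.
have l : 4 * (h - 2) <= A * B.
  have B4 : 4 <= B by lra.
  have := mulr_sub_ge0 A4 B4; lra.
have r8 : 8 * r <= C by have := mulr_sub_ge0 h6 r0; lra.
have d0 : 0 < C + h by lra.
have C0 : 0 <= C by lra.
have h0 : 0 <= h by lra.
rewrite -(ler_pM2r d0).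
have p1 := mulr_sub_ge0 r8 C0.
have p2 := mulr_sub_ge0 l h0.
have p3 := mulr_sub_ge0 h6 h6.
have p4 := sqr_ge0 (C - 6).
rewrite expr2 in p4.
move: (A * B) l kd p2 => P l kd p2.
have -> : k + (r + 1) + A + B = k + r + h + 3 by lra.
lra.
Qed.

(** For a plane with [2 * s + 1] points, the inequality on the number of slots in the form given by
    [odd_case]. Bounding [s] by [sk] and [k] by [kd] leaves [key], free of both. If [C < h], then
    [r1] forces [r = 0]. *)
Lemma odd_bound (Q : realFieldType) (A B C h k r s : Q)
  (hE : A + B = h + 2) (A4 : 4 <= A) (AB : A <= B) (BC : B <= C) (r0 : 0 <= r)
  (kd : k * (C + h) <= C * (A * B - (C + h))) (rC : r * (h + 2) <= C)
  (r1 : (r == 0) || (h + 2 <= C)) :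
  s * (C - 2) <= k - 1 -> k + (r + 1) + s * (h - 2) + h <= A * B.
Proof.
move=> sk; have h6 : 6 <= h by lra.
have r8 : 8 * r <= C by have := mulr_sub_ge0 h6 r0; lra.
have C6 : 4 <= C by lra.
have d0 : 0 < C + h by lra.
have C2 : 0 < C - 2 by lra.
have u : A * B <= C * C.
  have A0 : 0 <= A by lra.
  have B0 : 0 <= C by lra.
  have AC : A <= C by lra.
  have := mulr_sub_ge0 BC A0; have := mulr_sub_ge0 AC B0; lra.
have key : A * B * (2 * h - 2 * C) <=
    (C + h) * (C * C - 5 * C - C * r + 3 * h + 2 * r).
  have [hC|Ch] := lerP h C.
    have AB0 : 0 <= A * B by apply: mulr_ge0; lra.
    have p1 := mulr_sub_ge0 hC AB0.
    have q : 0 <= C * C - 5 * C - C * r + 3 * h + 2 * r.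
      have p2 := mulr_sub_ge0 r8 (ltW (lt_le_trans (ltr0n Q 4) C6)).
      have p4 := sqr_ge0 (C - 3); rewrite expr2 in p4; lra.
    have p3 := mulr_ge0 (ltW d0) q; lra.
  have -> : r = 0.
    case/orP: r1 => [/eqP //|]; lra.
  have hu : h <= 2 * C - 2 by lra.
  have e0 : 0 <= h - C by lra.
  have p1 := mulr_sub_ge0 u e0.
  have CC : 0 <= C * C by apply: mulr_ge0; lra.
  have p2 := mulr_ge0 CC (_ : 0 <= C - 2 - (h - C)).
  have p2' : 0 <= C * C * (C - 2 - (h - C)) by apply: p2; lra.
  have p5 := mulr_ge0 (mulr_ge0 (ltW (lt_le_trans (ltr0n Q 4) C6)) (ltW (lt_le_trans (ltr0n Q 4) C6))) (ltW C2).
  have p6 : 0 <= C * (h - C) by apply: mulr_ge0; lra.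
  have p7 : 0 <= (h - C) * (h - C) by apply: mulr_ge0; lra.
  lra.
rewrite -(ler_pM2r d0) -(ler_pM2r C2).
have e1 : 0 <= (k - 1 - s * (C - 2)) * ((h - 2) * (C + h)).
  by apply: mulr_ge0; [lra | apply: mulr_ge0; lra].
have e2 := mulr_sub_ge0 kd (_ : 0 <= C + h - 4).
have {}e2 : 0 <= (C * (A * B - (C + h)) - k * (C + h)) * (C + h - 4 - 0) by apply: e2; lra.
lra.
Qed.

(** The same elimination for a plane with [2 * s] points, in the form given by [even_case]. *)
Lemma even_bound (Q : realFieldType) (A B C h k r s : Q)
  (hE : A + B = h + 2) (A4 : 4 <= A) (AB : A <= B) (BC : B <= C) (r0 : 0 <= r)
  (kd : k * (C + h) <= C * (A * B - (C + h))) (rC : r * (h + 2) <= C)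
  (r1 : (r == 0) || (h + 2 <= C)) :
  (2 * s - 1) * (C - 2) <= 2 * k - 2 -> k + (r + 1) + s * h <= A * B.
Proof.
move=> sk; have h6 : 6 <= h by lra.
have r8 : 8 * r <= C by have := mulr_sub_ge0 h6 r0; lra.
have C6 : 4 <= C by lra.
have C0 : 0 <= C by lra.
have d0 : 0 < C + h by lra.
have C2 : 0 < C - 2 by lra.
have key : A * B * (4 * h) <= (C + h) *
    (2 * (C * C) - 6 * C + C * h + 4 * h - 2 * (C * r) + 4 * r + 4).
  have [hC|Ch] := lerP h C.
    have u : 4 * (A * B) <= (h + 2) * (h + 2).
      rewrite -hE; have := sqr_ge0 (A - B); rewrite expr2; lra.
    have h0 : 0 <= h by lra.
    have p1 := mulr_sub_ge0 u h0.
    have p2 := mulr_sub_ge0 r8 C0.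
    have p3 := mulr_sub_ge0 hC hC.
    have q : 2 * (h * h) <= 2 * (C * C) - 6 * C + C * h + 4 * h - 2 * (C * r) + 4 * r + 4.
      have := mulr_sub_ge0 hC h0; have := mulr_sub_ge0 h6 hC; have := mulr_sub_ge0 h6 h6; lra.
    have p4 : 0 <= (C - h) * (2 * (h * h)).
      by apply: mulr_ge0; [lra | apply: mulr_ge0; [lra | apply: mulr_ge0]].
    have p5 := mulr_sub_ge0 q (ltW d0).
    have p6 : 0 <= (h - 6) * (h * h) by apply: mulr_ge0; [lra | apply: mulr_ge0].
    have p7 := mulr_sub_ge0 h6 h0.
    lra.
  have -> : r = 0.
    case/orP: r1 => [/eqP //|]; lra.
  have u : A * B <= C * C.
    have A0 : 0 <= A by lra.
    have AC : A <= C by lra.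
    have := mulr_sub_ge0 BC A0; have := mulr_sub_ge0 AC C0; lra.
  have h0 : 0 <= h by lra.
  have p1 := mulr_sub_ge0 u h0.
  have e0 : 0 <= h - C by lra.
  have p2 : 0 <= C * h * (h - C) by apply: mulr_ge0 => //; apply: mulr_ge0.
  have p3 : 0 <= C * C * (C - 2) by apply: mulr_ge0; [apply: mulr_ge0 | lra].
  have p4 : 0 <= C * (h - C) by apply: mulr_ge0.
  have p5 : 0 <= (h - C) * (h - C) by apply: mulr_ge0.
  lra.
have c2 : 0 < 2 * (C - 2) by lra.
rewrite -(ler_pM2r d0) -(ler_pM2r c2).
have e1 : 0 <= (2 * k - 2 - (2 * s - 1) * (C - 2)) * (h * (C + h)).
  by apply: mulr_ge0; [lra | apply: mulr_ge0; lra].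
have {}e2 : 0 <= (C * (A * B - (C + h)) - k * (C + h)) * (C + h - 2).
  by apply: mulr_ge0; lra.
lra.
Qed.

(** Here [s] counts all points of a plane; if it reached [A], the even distribution would push [k]
    above the bound [kd]. *)
Lemma group_bound_first (Q : realFieldType) (A B C h k s : Q)
  (hE : A + B = h + 2) (A4 : 4 <= A) (AB : A <= B) (BC : B <= C)
  (kd : k * (C + h) <= C * (A * B - (C + h))) :
  (s - 1) * (C - 2) <= 2 * (k - 1) -> s < A.
Proof.
move=> sk; rewrite ltNge; apply/negP => As.
have e1 : 0 <= (s - A) * (C - 2) by apply: mulr_ge0; lra.
have e2 : 0 <= (2 * (k - 1) - (A - 1) * (C - 2)) * (C + h) by apply: mulr_ge0; lra.
have p1 := mulr_sub_ge0 A4 (_ : 4 <= C).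
have {}p1 : 0 <= (A - 4) * (C - 4) by apply: p1; lra.
have e3 : 0 <= (C - B) * (A * C + 2 * A - C - 4) by apply: mulr_ge0; lra.
have e4 : 0 <= (A - 4) * (A * (C - 2)).
  by apply: mulr_ge0; [lra | apply: mulr_ge0; lra].
have e5 : 0 <= (C - A) * C by apply: mulr_ge0; lra.
have e6 : 0 <= (C - 4) * (C - 4) by apply: mulr_ge0; lra.
have hh : h = A + B - 2 by lra.
subst h; lra.
Qed.

Lemma group_bound_second (Q : realFieldType) (A B C h k r s : Q)
  (hE : A + B = h + 2) (A4 : 4 <= A) (AB : A <= B) (BC : B <= C) (k1 : 1 <= k)
  (kd : k * (C + h) <= C * (A * B - (C + h))) (rC : r * (h + 2) <= C)
  (r1 : (r == 0) || (1 <= r) && (h + 2 <= C)) :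
  (s - 1) * (C - 2) <= 2 * (k - 1) -> s + r + 1 < B.
Proof.
move=> sk; rewrite ltNge; apply/negP => Bs.
have e1 : 0 <= (s + r + 1 - B) * (C - 2) by apply: mulr_ge0; lra.
have e2 : 0 <= (2 * (k - 1) - (B - r - 2) * (C - 2)) * (C + h) by apply: mulr_ge0; lra.
have hh : h = A + B - 2 by lra.
case/orP: r1 => [/eqP r0|/andP[r1 SC]].
  have e3 : 0 <= (B - A) * (B * C + 2 * B - 6).
    apply: mulr_ge0; first lra.
    have : 0 <= B * C by apply: mulr_ge0; lra.
    lra.
  have e4 : 0 <= B * ((C - 4) * (C - 4)).
    by apply: mulr_ge0; [lra | apply: mulr_ge0; lra].
  have e5 : 0 <= (C - B) * B by apply: mulr_ge0; lra.
  subst r h; lra.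
have C8 : 8 <= C by lra.
have ABd : C + h + 1 <= A * B.
  have C0 : 0 < C by lra.
  rewrite -(ler_pM2l C0).
  have : 0 <= (k - 1) * (C + h) by apply: mulr_ge0; lra.
  lra.
(* Combines [r * (A + B) <= C <= A * B - h - 1] with [2 * A * B <= B * (A + B)]; the constant is 2 -
   1/4, since [A + B >= 8]. *)
have B2r : 2 * r + 7 / 4 <= B.
  rewrite leNgt; apply/negP => lt.
  have p1 : 0 < (2 * r + 7 / 4 - B) * (A + B) by apply: mulr_gt0; lra.
  have p2 : 0 <= (B - A) * B by apply: mulr_ge0; lra.
  subst h; lra.
have e3 : 2 * C * (A * B) <= C * (B * (h + 2)).
  have : 0 <= C * (B * (B - A)).
    by apply: mulr_ge0; [lra | apply: mulr_ge0; lra].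
  subst h; lra.
have e4 : 0 <= C * (C - r * (h + 2)) by apply: mulr_ge0; lra.
have e5 : 0 <= (C - 8) * ((B - r) * C) by apply: mulr_ge0; [lra | apply: mulr_ge0; lra].
have [le3|lt3] := lerP 3 (B - r).
  have e6 : 0 <= (C - h) * (2 * (B - r) - 6) by apply: mulr_ge0; lra.
  have e7 : 0 < (B - r - 1) * ((C - 8) * C) + (2 * (B - r) + 4) * C.
    apply: ltr_wpDl; last by apply: mulr_gt0; lra.
    by apply: mulr_ge0; [lra | apply: mulr_ge0; lra].
  lra.
have e6 : 0 <= h * (6 - 2 * (B - r)) by apply: mulr_ge0; lra.
have e7 : 0 < (B - r - 1) * ((C - 8) * C) + (4 * (B - r) - 2) * C.
  apply: ltr_wpDl; last by apply: mulr_gt0; lra.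
  by apply: mulr_ge0; [lra | apply: mulr_ge0; lra].
lra.
Qed.

Lemma card_group k q l : (0 < k)%N -> ((#|group k q l|).-1 * q <= k.-1)%N.
Proof.
move=> k0; have lt (i : 'I_k) : (i %/ q < (k.-1 %/ q).+1)%N.
  by rewrite ltnS; apply: leq_div2r; rewrite -ltnS (prednK k0).
pose f (i : 'I_k) := Ordinal (lt i).
have finj : {in group k q l &, injective f}.
  move=> i j; rewrite !inE => /eqP il /eqP jl /(congr1 val) /= e.
  by apply: val_inj; rewrite /= (divn_eq i q) (divn_eq j q) il jl e.
have := max_card (mem (f @: group k q l)); rewrite card_in_imset // card_ord => le.
apply: leq_trans (leq_divM k.-1 q); rewrite leq_mul2r -subn1 leq_subLR.
by rewrite le orbT.
Qed.

(** Whatever the parity, [c.-1] is at most twice [c./2]; this is the origin of [C - 2] in the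
    estimates. *)
Lemma double_half_bound (c k s : nat) :
  (s.-1 * c./2 <= k.-1)%N -> (s.-1 * c.-1 <= k.-1.*2)%N.
Proof.
rewrite -leq_double; apply: leq_trans; rewrite doubleMr leq_mul2l.
by apply/orP; right; have := odd_double_half c; lia.
Qed.

(** The quadratic terms in [t] of the two products on the right cancel, so the inequality on slots
    is linear in [t]. Writing [a] and [b] as [x + t.*2] and [y + t.*2] removes the truncated
    subtractions. *)
Lemma odd_case (a b k R s t : nat) : (1 + t.*2 = s)%N -> (2 < a)%N -> (s <= k)%N ->
  (s <= a)%N -> (s <= b)%N ->
  (k + R + t * (a + b - 2) + (a + b) <= a.+1 * b.+1)%N ->
  (k - s + R <= (a.+1 - s) * (b.+1 - s) + t * (a.+1 - s + (b.+1 - s)))%N.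
Proof.
move=> <- a2 sk sa sb.
have [x ->] : exists x, a = (x + t.*2)%N by exists (a - t.*2)%N; lia.
have [y ->] : exists y, b = (y + t.*2)%N by exists (b - t.*2)%N; lia.
have -> : ((x + t.*2).+1 - (1 + t.*2) = x)%N by lia.
have -> : ((y + t.*2).+1 - (1 + t.*2) = y)%N by lia.
nia.
Qed.

Lemma even_case (a b k R s t : nat) : (0 + t.*2 = s)%N -> (s <= k)%N ->
  (s <= a)%N -> (s <= b)%N -> (k + R + t * (a + b) <= a.+1 * b.+1)%N ->
  (k - s + R <= (a.+1 - s) * (b.+1 - s) + t * (a.+1 - s + (b.+1 - s)))%N.
Proof.
rewrite add0n => <- sk sa sb.
have [x ->] : exists x, a = (x + t.*2)%N by exists (a - t.*2)%N; lia.
have [y ->] : exists y, b = (y + t.*2)%N by exists (b - t.*2)%N; lia.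
have -> : ((x + t.*2).+1 - t.*2 = x.+1)%N by lia.
have -> : ((y + t.*2).+1 - t.*2 = y.+1)%N by lia.
nia.
Qed.

Lemma clear_denominators (a b c k : nat) :
  k%:R <= ((a + 1) * (b + 1) * (c + 1))%:R / (a + b + c + 1)%:R - c%:R - 1 :> rat ->
  (k * (c.+1 + (a + b)) + c.+1 * (c.+1 + (a + b)) <= a.+1 * b.+1 * c.+1)%N.
Proof.
have -> : (a + b + c + 1 = c.+1 + (a + b))%N by lia.
rewrite !addn1; move: (a.+1 * b.+1 * c.+1)%N => n.
set d := (c.+1 + (a + b))%N; have d0 : 0 < (d%:R : rat) by rewrite ltr0n.
rewrite -addrA -opprD natr1 lerBrDr -natrD ler_pdivlMr //.
by rewrite -natrM ler_nat mulnDl.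
Qed.

Section Numbers.
Variables (Q : realFieldType) (a b c k : nat).
Hypotheses (ha : (2 < a)%N) (hab : (a <= b)%N) (hbc : (b <= c)%N) (hk : (0 < k)%N).
Hypothesis hkd :
  (k * (c.+1 + (a + b)) + c.+1 * (c.+1 + (a + b)) <= a.+1 * b.+1 * c.+1)%N.
Local Notation r := (c.+1 %/ (a + b + 2))%N.
Local Notation AB := (a.+1 * b.+1)%N.

Lemma real_hypotheses :
  [/\ [/\ a.+1%:R + b.+1%:R = (a + b)%:R + 2 :> Q, 4 <= a.+1%:R :> Q,
          a.+1%:R <= b.+1%:R :> Q, b.+1%:R <= c.+1%:R :> Q & 1 <= k%:R :> Q],
      0 <= r%:R :> Q, r%:R * ((a + b)%:R + 2) <= c.+1%:R :> Q,
      ((r%:R : Q) == 0) || (1 <= r%:R :> Q) && ((a + b)%:R + 2 <= c.+1%:R :> Q) &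
      k%:R * (c.+1%:R + (a + b)%:R) <=
        c.+1%:R * (a.+1%:R * b.+1%:R - (c.+1%:R + (a + b)%:R)) :> Q].
Proof.
split.
- rewrite -!natrD !ler_nat ler1n; split=> //; congr (_ *+ _); lia.
- exact: ler0n.
- by rewrite -natrD -natrM ler_nat leq_divM.
- rewrite -natrD pnatr_eq0 ler1n ler_nat; case: posnP => //= r0.
  by rewrite addn2 divn_gt0 // in r0; rewrite addn2.
rewrite mulrBr lerBrDr -!natrD -!natrM -natrD ler_nat.
by rewrite [X in (_ <= X)%N]mulnC.
Qed.

Lemma room_le : (k + r.+1 + (a + b + 2) <= AB)%N.
Proof.
have [[hE A4 AB BC k1] r0 rC _ kd] := real_hypotheses.
have := room_bound hE A4 AB BC r0 kd rC.
by rewrite natr1 -!natrD -natrM ler_nat; lia.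
Qed.

Lemma group_small l : let s := #|group k c./2 l| in
  [/\ (s <= a)%N, (s + r.+1 <= b)%N &
      (k - s + r.+1 <= (a.+1 - s) * (b.+1 - s) + s./2 * (a.+1 - s + (b.+1 - s)))%N].
Proof.
move=> s; have ab2 : (2 <= a + b)%N by lia.
have c_gt0 : (0 < c)%N by lia.
have sq := double_half_bound (card_group c./2 l hk); rewrite -/s in sq.
have [[hE A4 AB BC k1] r0 rC rcases kd] := real_hypotheses.
have sk : (s <= k)%N by rewrite -[X in (_ <= X)%N]card_ord max_card.
have r1 : ((r%:R : Q) == 0) || ((a + b)%:R + 2 <= c.+1%:R :> Q).
  by case/orP: rcases => [->|/andP[_ ->]]; rewrite ?orbT.
have sqQ : (s%:R - 1) * (c.+1%:R - 2) <= 2 * (k%:R - 1) :> Q.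
  have c1 : c.+1%:R - 2 = c.-1%:R :> Q.
    by rewrite -[in LHS](prednK c_gt0) -addn2 natrD addrK.
  have -> : 2 * (k%:R - 1) = k.-1.*2%:R :> Q.
    by rewrite -muln2 natrM mulrC; congr (_ * _); rewrite -[in LHS](prednK hk) -natr1 addrK.
  rewrite c1; case: (posnP s) => [->|s0].
    by rewrite sub0r mulN1r (le_trans _ (ler0n _ _)) // oppr_le0 ler0n.
  by rewrite -[in s%:R](prednK s0) -natr1 addrK -natrM ler_nat.
have := group_bound_first hE A4 AB BC kd sqQ; rewrite ltr_nat ltnS => sa.
have := group_bound_second hE A4 AB BC k1 kd rC rcases sqQ.
rewrite -!natrD natr1 ltr_nat => sb; have {}sb : (s + r.+1 <= b)%N by rewrite addnS; move: sb; rewrite ltnS.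
have {}sb' : (s <= b)%N := leq_trans (leq_addr _ _) sb.
split=> //.
have sE := odd_double_half s; move: sE sqQ; case: (odd s) => /= sE sqQ.
  have sQ : s%:R - 1 = 2 * s./2%:R :> Q.
    by rewrite -[in LHS]sE natrD addrC addKr -muln2 natrM mulrC.
  have sk2 : s./2%:R * (c.+1%:R - 2) <= k%:R - 1 :> Q by rewrite sQ in sqQ; lra.
  have h2 : (a + b)%:R - 2 = (a + b - 2)%:R :> Q by rewrite natrB.
  have := odd_bound hE A4 AB BC r0 kd rC r1 sk2.
  rewrite h2 natr1 -!natrM -!natrD ler_nat.
  by apply: odd_case.
have sQ : s%:R = 2 * s./2%:R :> Q by rewrite -[in LHS]sE add0n -muln2 natrM mulrC.
have sk2 : (2 * s./2%:R - 1) * (c.+1%:R - 2) <= 2 * k%:R - 2 :> Q by rewrite sQ in sqQ; lra.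
have := even_bound hE A4 AB BC r0 kd rC r1 sk2.
rewrite natr1 -!natrM -!natrD ler_nat.
by apply: even_case.
Qed.
End Numbers.

Theorem theorem6p1 (R : realType) (a b c k : nat)
  (ha : (2 < a)%N) (hab : (a <= b)%N) (hbc : (b <= c)%N) (hk : (0 < k)%N)
  (hkle : k%:R <= ((a + 1) * (b + 1) * (c + 1))%:R / (a + b + c + 1)%:R
                  - c%:R - 1 :> rat) :
  let X := segre R[i] a b c in
  let n := (a.+1 * b.+1 * c.+1)%N in
  for_general (@points_open R[i] n k)
    (fun p => forall i, X (p i))
    (fun p =>
      for_general (@grass_open R[i] n (n - (a + b + 2)))
        (fun L => codim_eq (a + b + 2) L /\
                  (\sum_(i < k) tangent_space X (p i) <= L)%VS)
        (fun L => forall x, X x -> (forall i, x <> p i) ->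
                  ~ tangent_at L X x)).
Proof.
move=> X n; have kd := clear_denominators hkle.
set r := (c.+1 %/ (a + b + 2))%N.
have room : (k + r.+1 + (a + b + 2) <= a.+1 * b.+1)%N := room_le rat ha hab hbc hk kd.
have small := group_small rat ha hab hbc hk kd.
have q0 : (0 < c./2)%N by lia.
have qc : (c./2.*2 <= c)%N by lia.
have rb : (r.+1 <= b)%N by have [_ sb _] := small 0%N; apply: leq_trans sb; apply: leq_addl.
have mR : (c.+1 < (a + b + 2) * r.+1)%N by rewrite mulnC ltn_ceil // addn2.
have krAB : (k + r.+1 <= a.+1 * b.+1)%N by apply: leq_trans room; apply: leq_addr.
have sep (i : 'I_k) := generic_separated R[i] i q0 qc (fun l _ => small l) rb krAB.
have good : generic (@good_pairs R[i] k a.+1 b.+1).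
  by apply: generic_good_pairs; [lia | apply: leq_trans room; lia].
have [U [oU exU UP]] := general_segre_points
  (generic_and (generic_fst _ good) (generic_all sep)).
exists U; split=> // p Xp Up; have [y [gy sy] py] := UP p Xp Up.
by apply: (general_tangent_subspace hk mR room py gy sy).
Qed.
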